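(* There exists a numerical constant $c>0$ such that the following holds. Let $d\ge1$ and $N\ge2$ be integers, let $\mathcal A_1$ be a unital $C^*$-algebra, and let $a_0,a_1,\ldots,a_{2d}\in\mathcal A_1$. Let $(U_1,\ldots,U_d)$ be independent and Haar-distributed on the unitary group $\mathrm U_N$, and set $U_{i+d}=U_i^*$ for $1\le i\le d$. Let $$A_{\mathrm F}=a_0\otimes 1+\sum_{i=1}^{2d}a_i\otimes\lambda(g_i)\in\mathcal A_1\otimes\mathcal A_{\mathrm F},\qquad A_N=a_0\otimes 1+\sum_{i=1}^{2d}a_i\otimes U_i\in\mathcal A_1\otimes M_N(\mathbb C).$$ Then $$\mathbf E\,\|A_N\|\ge\|A_{\mathrm F}\|\left(1-\frac{c\log(2d)}{\log N}\right).$$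
   Context: Tensor products of $C^*$-algebras are minimal. $\mathrm F_d$ is the free group with free generators $g_1,\ldots,g_d$; for $d+1\le i\le 2d$, $g_i=g_{i-d}^{-1}$. $\lambda$ is the left regular representation on $\ell^2(\mathrm F_d)$, $\lambda(g)\delta_h=\delta_{gh}$, and $\mathcal A_{\mathrm F}$ is the reduced $C^*$-algebra generated by the $\lambda(g)$. $\|\cdot\|$ is the operator norm. A numerical constant is one independent of all parameters. *)

(* Defs.v *)
From HB Require Import structures.
From mathcomp Require Import all_boot all_order all_algebra.
From mathcomp Require Import sesquilinear spectral.
From mathcomp Require Import all_classical all_reals all_analysis.
From mathcomp Require Import complex.
From mathcomp Require Import ring lra.
Set Implicit Arguments.
Unset Strict Implicit.
Unset Printing Implicit Defensive.
Import Order.TTheory GRing.Theory Num.Theory.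
Import numFieldNormedType.Exports.
Local Open Scope classical_set_scope.
Local Open Scope ring_scope.
Local Open Scope complex_scope.

(* Complex Hilbert spaces; the inner product is linear in its first argument. *)
HB.mixin Record isHilbert (R : realType) (H : Type)
    & CompleteNormedModule R[i] H := {
  inner : {dot H for Num.conj} ;
  inner_norm : forall x : H, inner x x = `|x| ^+ 2 }.

#[short(type="hilbertType")]
HB.structure Definition Hilbert (R : realType) :=
  {H of isHilbert R H & CompleteNormedModule R[i] H}.

Section RealSum.
Context {R : realType} {I : choiceType}.
Implicit Types f g : I -> R.

Definition nnsum f : \bar R := \esum_(i in [set: I]) (f i)%:E.

(* The (unordered) sum of an absolutely summable real family, as the sum of the
   positive parts minus the sum of the negative parts. *)
Definition rsum f : R :=
  fine (nnsum (fun i => Num.max (f i) 0)) - fine (nnsum (fun i => Num.max (- f i) 0)).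

Definition fin_sum f := (nnsum f < +oo)%E.

Lemma nnsum_ge0 f : (forall i, 0 <= f i) -> (0 <= nnsum f)%E.
Proof. by move=> f0; apply: esum_ge0 => i _; rewrite lee_fin. Qed.

Lemma nnsum_fin f : (forall i, 0 <= f i) -> fin_sum f -> nnsum f \is a fin_num.
Proof. by move=> f0 ff; rewrite ge0_fin_numE// nnsum_ge0. Qed.

Lemma fin_sum_le f g : (forall i, f i <= g i) -> fin_sum g -> fin_sum f.
Proof.
by move=> fg; apply: le_lt_trans; apply: le_esum => i _; rewrite lee_fin.
Qed.

Lemma nnsumD f g : (forall i, 0 <= f i) -> (forall i, 0 <= g i) ->
  nnsum (fun i => f i + g i) = (nnsum f + nnsum g)%E.
Proof.
move=> f0 g0; rewrite /nnsum -esumD; try by move=> i _; rewrite lee_fin.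
by apply: eq_esum => i _; rewrite EFinD.
Qed.

Lemma fin_sumD f g : (forall i, 0 <= f i) -> (forall i, 0 <= g i) ->
  fin_sum f -> fin_sum g -> fin_sum (fun i => f i + g i).
Proof. by move=> f0 g0 ff fg; rewrite /fin_sum nnsumD// lte_add_pinfty. Qed.

Lemma nnsumZ_le (c : R) f : 0 <= c -> (forall i, 0 <= f i) -> fin_sum f ->
  (nnsum (fun i => c * f i)%R <= c%:E * nnsum f)%E.
Proof.
move=> c0 f0 ff; apply: ge_ereal_sup => _ [X [Xfin _] <-].
rewrite (_ : (\sum_(i \in X) (c * f i)%:E)%E = (c%:E * \sum_(i \in X) (f i)%:E)%E).
  by apply: lee_wpmul2l; rewrite ?lee_fin//; apply: esum_ge; exists X.
under eq_fsbigr do rewrite EFinM; by rewrite ge0_mule_fsumr// => i; rewrite lee_fin.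
Qed.

Lemma nnsumZ (c : R) f : 0 <= c -> (forall i, 0 <= f i) -> fin_sum f ->
  nnsum (fun i => c * f i) = (c%:E * nnsum f)%E.
Proof.
move=> c0 f0 ff; apply/eqP; rewrite eq_le nnsumZ_le//=.
have [->|cn0] := eqVneq c 0.
  by rewrite mul0e nnsum_ge0// => i; rewrite mul0r.
have cp : 0 < c by rewrite lt_neqAle eq_sym cn0.
have fcf : fin_sum (fun i => c * f i).
  by rewrite /fin_sum (le_lt_trans (nnsumZ_le c0 f0 ff))// ltey_eq fin_numM//
    nnsum_fin.
rewrite -lee_pdivlMl// [X in nnsum X](_ : _ = fun i => c^-1 * (c * f i)); last first.
  by apply/funext => i; rewrite mulKf.
by apply: nnsumZ_le => // [|i]; rewrite ?invr_ge0// mulr_ge0.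
Qed.


Lemma nnsum_ge_term f i : (forall i, 0 <= f i) -> ((f i)%:E <= nnsum f)%E.
Proof.
move=> f0; apply: esum_ge; exists [set i]; first by split.
by rewrite fsbig_set1.
Qed.

Lemma nnsum_eq0 f : (forall i, 0 <= f i) -> nnsum f = 0%E -> forall i, f i = 0.
Proof.
move=> f0 f_0 i; apply/eqP; rewrite eq_le f0 andbT -lee_fin.
by rewrite -[leRHS]f_0 nnsum_ge_term.
Qed.

Lemma rsum_dec f p q : (forall i, 0 <= p i) -> (forall i, 0 <= q i) ->
  fin_sum p -> fin_sum q -> (forall i, f i = p i - q i) ->
  rsum f = fine (nnsum p) - fine (nnsum q).
Proof.
move=> p0 q0 fp fq fpq.
have fmax (g : I -> R) i : 0 <= Num.max (g i) 0 by rewrite le_max lexx orbT.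
have f1 : fin_sum (fun i => Num.max (f i) 0).
  apply: fin_sum_le fp => i; rewrite ge_max p0 andbT fpq.
  by rewrite lerBlDr lerDl.
have f2 : fin_sum (fun i => Num.max (- f i) 0).
  apply: fin_sum_le fq => i; rewrite ge_max q0 andbT fpq.
  by rewrite opprB lerBlDr lerDl.
have e : nnsum (fun i => Num.max (f i) 0 + q i)
       = nnsum (fun i => Num.max (- f i) 0 + p i).
  congr nnsum; apply/funext => i; rewrite fpq.
  by case: (lerP (p i - q i) 0); case: (lerP (- (p i - q i)) 0); lra.
move/(congr1 fine): e; rewrite !nnsumD// ?fineD ?nnsum_fin// /rsum; try exact: fmax;
  try exact: (fmax (fun i => - f i)).
lra.
Qed.

Definition absum f := fin_sum (fun i => `|f i|).

Lemma max_absum f : absum f -> fin_sum (fun i => Num.max (f i) 0).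
Proof. by apply: fin_sum_le => i; rewrite ge_max normr_ge0 ler_norm. Qed.

Lemma absumN f : absum f -> absum (fun i => - f i).
Proof. by rewrite /absum; congr fin_sum; apply/funext=> i; rewrite normrN. Qed.

Lemma absumD f g : absum f -> absum g -> absum (fun i => f i + g i).
Proof.
move=> ff fg; have := fin_sumD _ _ ff fg.
move=> /(_ (fun=> normr_ge0 _) (fun=> normr_ge0 _)).
by apply: fin_sum_le => i; exact: ler_normD.
Qed.

Lemma absumZ (c : R) f : absum f -> absum (fun i => c * f i).
Proof.
move=> ff; rewrite /absum.
rewrite (_ : (fun i => `|c * f i|) = (fun i => `|c| * `|f i|)); last first.
  by apply/funext=> i; rewrite normrM.
rewrite /fin_sum nnsumZ// ltey_eq fin_numM// nnsum_fin//.
Qed.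

Let max0 f i : 0 <= Num.max (f i) 0. Proof. by rewrite le_max lexx orbT. Qed.

Let maxE f i : f i = Num.max (f i) 0 - Num.max (- f i) 0.
Proof. by case: (lerP (f i) 0); case: (lerP (- f i) 0); lra. Qed.

Lemma rsumD f g : absum f -> absum g ->
  rsum (fun i => f i + g i) = rsum f + rsum g.
Proof.
move=> ff fg.
have [f1 f2] := (max_absum ff, max_absum (absumN ff)).
have [g1 g2] := (max_absum fg, max_absum (absumN fg)).
rewrite (@rsum_dec _ (fun i => Num.max (f i) 0 + Num.max (g i) 0)
  (fun i => Num.max (- f i) 0 + Num.max (- g i) 0)).
- rewrite !nnsumD//; try exact: max0; try exact: (max0 (fun i => - _ i)).
  rewrite !fineD ?nnsum_fin//; try exact: max0; try exact: (max0 (fun i => - _ i)).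
  rewrite /rsum; lra.
- by move=> i; rewrite addr_ge0// max0.
- by move=> i; rewrite addr_ge0// (max0 (fun i => - _ i)).
- by apply: fin_sumD => // i; exact: max0.
- by apply: fin_sumD => // i; exact: (max0 (fun i => - _ i)).
- by move=> i; rewrite [f i in LHS]maxE [g i in LHS]maxE; lra.
Qed.

Lemma rsumN f : rsum (fun i => - f i) = - rsum f.
Proof.
rewrite /rsum opprB; congr (_ - fine (nnsum _)).
by apply/funext => i; rewrite opprK.
Qed.

Lemma rsumZ (c : R) f : absum f -> rsum (fun i => c * f i) = c * rsum f.
Proof.
wlog c0 : c / 0 <= c => [wlg|] ff.
  case: (lerP 0 c) => [/wlg//|/ltW c0]; first exact.
  have /wlg/(_ ff) : 0 <= - c by rewrite oppr_ge0.
  under [in LHS]eq_fun do rewrite mulNr.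
  by rewrite rsumN mulNr => /oppr_inj.
have [f1 f2] := (max_absum ff, max_absum (absumN ff)).
rewrite (@rsum_dec _ (fun i => c * Num.max (f i) 0)
  (fun i => c * Num.max (- f i) 0)).
- rewrite !nnsumZ//; try exact: max0; try exact: (max0 (fun i => - _ i)).
  rewrite !fineM ?nnsum_fin//; try exact: max0; try exact: (max0 (fun i => - _ i)).
  by rewrite /rsum mulrBr.
- by move=> i; rewrite mulr_ge0// max0.
- by move=> i; rewrite mulr_ge0// (max0 (fun i => - _ i)).
- rewrite /fin_sum nnsumZ ?ltey_eq ?fin_numM// ?nnsum_fin//; exact: max0.
- rewrite /fin_sum nnsumZ ?ltey_eq ?fin_numM// ?nnsum_fin//;
  exact: (max0 (fun i => - _ i)).
- by move=> i; rewrite -mulrBr -maxE.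
Qed.

Lemma rsum_ge0 f : (forall i, 0 <= f i) -> rsum f = fine (nnsum f).
Proof.
move=> f0; rewrite /rsum (_ : (fun i => Num.max (f i) 0) = f); last first.
  by apply/funext=> i; rewrite max_l.
rewrite [X in _ - fine X](_ : _ = 0%E) ?subr0//.
by apply: esum1 => i _; rewrite max_r// oppr_le0.
Qed.

End RealSum.

Section ComplexSum.
Context {R : realType} {I : choiceType}.
Implicit Types z w : I -> R[i].

(* The sum of an absolutely summable complex family. *)
Definition csum z : R[i] :=
  rsum (fun i => complex.Re (z i)) +i* rsum (fun i => complex.Im (z i)).

Definition cabsum z :=
  absum (fun i => complex.Re (z i)) /\ absum (fun i => complex.Im (z i)).

Lemma csumD z w : cabsum z -> cabsum w ->
  csum (fun i => z i + w i) = csum z + csum w.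
Proof.
move=> [z1 z2] [w1 w2]; rewrite /csum; simpc.
by under eq_fun do rewrite raddfD/=; under [X in _ +i* rsum X]eq_fun do rewrite raddfD/=; rewrite !rsumD.
Qed.

Lemma csumZ (c : R[i]) z : cabsum z -> csum (fun i => c * z i) = c * csum z.
Proof.
case: c => a b [z1 z2]; rewrite /csum /=; simpc.
have E1 : (fun i => complex.Re ((a +i* b) * z i)) =
    (fun i => a * complex.Re (z i) + (- b) * complex.Im (z i)).
  by apply/funext => i; case: (z i) => x y; simpc; rewrite ?mulNr.
have E2 : (fun i => complex.Im ((a +i* b) * z i)) =
    (fun i => a * complex.Im (z i) + b * complex.Re (z i)).
  by apply/funext => i; case: (z i) => x y; simpc.
rewrite E1 E2 !rsumD ?rsumZ//; try exact: absumZ.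
by rewrite ?mulNr.
Qed.

Lemma csum_conj z : csum (fun i => (z i)^*) = (csum z)^*.
Proof.
rewrite /csum /=; congr (rsum _ +i* _).
  by apply/funext => i; case: (z i).
by rewrite -rsumN; congr rsum; apply/funext => i; case: (z i).
Qed.

End ComplexSum.

Section L2.
Context {R : realType} {I : choiceType}.
Implicit Types f g : I -> R[i]^o.

Definition sqmod (z : R[i]) : R := complex.Re z ^+ 2 + complex.Im z ^+ 2.

Lemma sqmod_ge0 z : 0 <= sqmod z.
Proof. by rewrite addr_ge0// sqr_ge0. Qed.

Lemma sqmodE z : z * z^* = (sqmod z)%:C.
Proof. by case: z => x y; simpc; rewrite /sqmod/= -!expr2; congr (_ +i* _); ring. Qed.

Definition l2_pred : {pred I -> R[i]^o} :=
  [pred f | `[< fin_sum (fun i => sqmod (f i)) >]].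

Lemma l2_predP f : reflect (fin_sum (fun i => sqmod (f i))) (f \in l2_pred).
Proof. exact: asboolP. Qed.

Lemma l2_submod : submod_closed l2_pred.
Proof.
split=> [|a f g /l2_predP ff /l2_predP fg].
  apply/l2_predP; rewrite /fin_sum /nnsum esum1 ?ltry// => i _.
  by rewrite /sqmod/= expr0n/= addr0.
apply/l2_predP.
have h : fin_sum (fun i => (2 * sqmod a) * sqmod (f i) + 2 * sqmod (g i)).
  have c0 : 0 <= 2 * sqmod a by rewrite mulr_ge0// sqmod_ge0.
  apply: fin_sumD.
  - by move=> i; rewrite !mulr_ge0// sqmod_ge0.
  - by move=> i; rewrite mulr_ge0// sqmod_ge0.
  - by rewrite /fin_sum nnsumZ ?ltey_eq ?fin_numM// ?nnsum_fin// => i; exact: sqmod_ge0.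
  - by rewrite /fin_sum nnsumZ ?ltey_eq ?fin_numM// ?nnsum_fin// => i; exact: sqmod_ge0.
apply: fin_sum_le h => i; rewrite /= -[(_ + _) i]/(a * f i + g i).
case: a (f i) (g i) => a b [x y] [u v]; simpc; rewrite /sqmod/=.
have := sqr_ge0 (a * x - b * y - u); have := sqr_ge0 (a * y + b * x - v).
nra.
Qed.

HB.instance Definition _ :=
  GRing.isSubmodClosed.Build R[i] (I -> R[i]^o) l2_pred l2_submod.

End L2.

(* The space l^2(I) of square-summable complex families. *)
Record l2 (R : realType) (I : choiceType) := L2 {
  l2_fun :> I -> R[i]^o ;
  l2_in : l2_fun \in l2_pred }.

HB.instance Definition _ R I := [isSub for @l2_fun R I].
HB.instance Definition _ R I := [Choice of l2 R I by <:].
HB.instance Definition _ R I := [SubChoice_isSubLmodule of l2 R I by <:].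

Section L2Inner.
Context {R : realType} {I : choiceType}.
Local Notation L := (l2 R I).
Implicit Types x y z : L.

Definition l2_inner x y : R[i] := csum (fun i => x i * (y i)^*).

Definition l2_sq x : R := fine (nnsum (fun i => sqmod (x i))).

Lemma l2_fin x : fin_sum (fun i => sqmod (x i)).
Proof. exact/l2_predP/l2_in. Qed.

Lemma l2_cabsum x y : cabsum (fun i => x i * (y i)^*).
Proof.
have h : fin_sum (fun i => sqmod (x i) + sqmod (y i)).
  by apply: fin_sumD => [i|i||]; rewrite ?sqmod_ge0//; exact: l2_fin.
split; apply: fin_sum_le h => i.
  case: (x i) (y i) => a b [c d]; simpc; rewrite /sqmod/=.
  rewrite ler_norml; apply/andP; split.
    have := sqr_ge0 (a + c); have := sqr_ge0 (b + d); have := sqr_ge0 a; have := sqr_ge0 b; have := sqr_ge0 c; have := sqr_ge0 d; nra.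
  have := sqr_ge0 (a - c); have := sqr_ge0 (b - d); have := sqr_ge0 a; have := sqr_ge0 b; have := sqr_ge0 c; have := sqr_ge0 d; nra.
case: (x i) (y i) => a b [c d]; simpc; rewrite /sqmod/=.
rewrite ler_norml; apply/andP; split.
  have := sqr_ge0 (b + c); have := sqr_ge0 (a - d); have := sqr_ge0 a; have := sqr_ge0 b; have := sqr_ge0 c; have := sqr_ge0 d; nra.
have := sqr_ge0 (b - c); have := sqr_ge0 (a + d); have := sqr_ge0 a; have := sqr_ge0 b; have := sqr_ge0 c; have := sqr_ge0 d; nra.
Qed.

Lemma l2_innerDZl (c : R[i]) x x' y :
  l2_inner (c *: x + x') y = c * l2_inner x y + l2_inner x' y.
Proof.
have e : (fun i => (c *: x) i * (y i)^*) = (fun i => c * (x i * (y i)^*)).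
  by apply/funext => i; rewrite mulrA.
rewrite -(csumZ c (l2_cabsum x y)) -e -(csumD (l2_cabsum _ _) (l2_cabsum _ _)).
by congr csum; apply/funext => i; rewrite -mulrDl.
Qed.

Lemma l2_innerC x y : l2_inner x y = (l2_inner y x)^*.
Proof.
rewrite /l2_inner -csum_conj; congr csum; apply/funext => i.
by rewrite rmorphM/= conjcK mulrC.
Qed.

Lemma l2_inner_sq x : l2_inner x x = (l2_sq x)%:C.
Proof.
rewrite /l2_inner /csum /l2_sq -rsum_ge0; last by move=> i; exact: sqmod_ge0.
under eq_fun do rewrite sqmodE/=.
under [X in _ +i* rsum X]eq_fun do rewrite sqmodE/=.
by rewrite [X in _ +i* X]rsum_ge0// /nnsum esum1.
Qed.

Lemma l2_sq_ge0 x : 0 <= l2_sq x.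
Proof. by apply/fine_ge0/nnsum_ge0 => i; exact: sqmod_ge0. Qed.

Lemma l2_sqE x : nnsum (fun i => sqmod (x i)) = (l2_sq x)%:E.
Proof.
by rewrite fineK// nnsum_fin// ?l2_fin// => i; exact: sqmod_ge0.
Qed.

Lemma l2_sq_eq0 x : l2_sq x = 0 -> x = 0.
Proof.
move=> x0; apply/val_inj/funext => i /=.
have := @nnsum_eq0 _ _ (fun i => sqmod (x i)) (fun=> sqmod_ge0 _).
rewrite l2_sqE x0 => /(_ erefl i)/eqP.
rewrite /sqmod paddr_eq0 ?sqr_ge0// !sqrf_eq0 => /andP[/eqP a0 /eqP b0].
by case: (l2_fun x i) a0 b0 => a b /= -> ->.
Qed.

Fact l2_zmodl y : zmod_morphism (l2_inner ^~ y).
Proof.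
by move=> x x'; rewrite -scaleN1r addrC l2_innerDZl mulN1r addrC.
Qed.

Fact l2_scall y : scalable_for *%R (l2_inner ^~ y).
Proof.
by move=> c x; have := l2_innerDZl c x 0 y;
   rewrite addr0 (_ : l2_inner 0 y = 0) ?addr0// -(subrr 0) l2_zmodl subrr.
Qed.

Fact l2_zmodr x : zmod_morphism (l2_inner x).
Proof.
by move=> y y'; rewrite ![l2_inner x _]l2_innerC l2_zmodl rmorphB.
Qed.

Fact l2_scalr x : scalable_for (Num.conj \; *%R) (l2_inner x).
Proof.
by move=> c y; rewrite ![l2_inner x _]l2_innerC l2_scall rmorphM.
Qed.

Fact l2_herm x y : l2_inner x y = (-1) ^+ false * Num.conj (l2_inner y x).
Proof. by rewrite expr0 mul1r l2_innerC. Qed.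

Fact l2_pos x : x != 0 -> 0 < l2_inner x x.
Proof.
move=> x0; rewrite l2_inner_sq ltcR lt_neqAle l2_sq_ge0 andbT eq_sym.
by apply: contra x0 => /eqP/l2_sq_eq0 ->.
Qed.

HB.instance Definition _ :=
  isBilinear.Build R[i] L L R[i] *%R (Num.conj \; *%R) l2_inner
    l2_zmodl l2_zmodr l2_scall l2_scalr.
HB.instance Definition _ :=
  isHermitianSesquilinear.Build R[i] L false Num.conj l2_inner l2_herm.
HB.instance Definition _ := isDotProduct.Build R[i] L l2_inner l2_pos.

Definition l2_norm x : R[i] := (Num.sqrt (l2_sq x))%:C.

Lemma l2_sqDZ (t : R) x y : l2_sq (x + t%:C *: y) =
  l2_sq x + 2 * t * complex.Re (l2_inner x y) + t ^+ 2 * l2_sq y.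
Proof.
have := l2_inner_sq (x + t%:C *: y).
rewrite addrC l2_innerDZl ![l2_inner _ (_ + x)]l2_innerC !l2_innerDZl.
rewrite !l2_inner_sq (l2_innerC y x).
case: (l2_inner x y) => a b /=; simpc => -[<- _].
by rewrite expr2; ring.
Qed.

Lemma l2_CS x y : complex.Re (l2_inner x y) <= Num.sqrt (l2_sq x) * Num.sqrt (l2_sq y).
Proof.
set b := complex.Re _.
have [/eqP/l2_sq_eq0 y0|yn0] := boolP (l2_sq y == 0).
  rewrite /b y0 -(subrr 0) l2_zmodr subrr/= mulr_ge0// sqrtr_ge0.
have yp : 0 < l2_sq y by rewrite lt_neqAle eq_sym yn0 l2_sq_ge0.
rewrite -sqrtrM ?l2_sq_ge0//.
apply: (le_trans (ler_norm b)); rewrite -sqrtr_sqr ler_wsqrtr//.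
have := l2_sq_ge0 (x + (- b / l2_sq y)%:C *: y).
rewrite l2_sqDZ -/b -(pmulr_lge0 _ yp) => h.
have e : (l2_sq x + 2 * (- b / l2_sq y) * b + (- b / l2_sq y) ^+ 2 * l2_sq y) * l2_sq y
  = l2_sq x * l2_sq y - b ^+ 2 by field.
by move: h; rewrite e subr_ge0.
Qed.

Lemma l2_normD x y : l2_norm (x + y) <= l2_norm x + l2_norm y.
Proof.
rewrite /l2_norm -rmorphD/= lecR -[leRHS]ger0_norm ?addr_ge0 ?sqrtr_ge0//.
rewrite -sqrtr_sqr ler_wsqrtr//.
have := l2_sqDZ 1 x y; rewrite scale1r => ->.
rewrite sqrrD !sqr_sqrtr ?l2_sq_ge0//.
by have := l2_CS x y; rewrite -mulr_natr; lra.
Qed.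

Lemma l2_normZ (c : R[i]) x : l2_norm (c *: x) = `|c| * l2_norm x.
Proof.
rewrite /l2_norm normc_def -rmorphM/= -sqrtrM; last by rewrite addr_ge0// sqr_ge0.
congr (Num.sqrt _)%:C.
have := l2_inner_sq (c *: x).
rewrite l2_scall l2_scalr /= mulrA sqmodE l2_inner_sq -rmorphM/=.
by case.
Qed.

Lemma l2_norm_eq0 x : l2_norm x = 0 -> x = 0.
Proof.
move=> [] /eqP; rewrite sqrtr_eq0 => h; apply: l2_sq_eq0.
by apply/eqP; rewrite eq_le h l2_sq_ge0.
Qed.

HB.instance Definition _ :=
  Lmodule_isNormed.Build R[i] L l2_normD l2_normZ l2_norm_eq0.

Lemma l2_normE x : `|x| = (Num.sqrt (l2_sq x))%:C.
Proof. by []. Qed.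

End L2Inner.

Section L2Complete.
Context {R : realType} {I : choiceType}.
Local Notation L := (l2 R I).
Implicit Types x y z : L.

Lemma l2_term x i : sqmod (x i) <= l2_sq x.
Proof.
rewrite -lee_fin -l2_sqE.
exact: (@nnsum_ge_term _ _ (fun j => sqmod (x j)) i (fun=> sqmod_ge0 _)).
Qed.

Lemma l2_ball x y (e : R) : 0 < e -> ball x e%:C y -> l2_sq (x - y) <= e ^+ 2.
Proof.
move=> e0; rewrite -ball_normE /ball_/= l2_normE ltcR => /ltW h.
by rewrite -[l2_sq _]sqr_sqrtr ?l2_sq_ge0// ler_sqr ?nnegrE ?sqrtr_ge0// ltW.
Qed.

Lemma coord_cauchy (p : R[i] -> R) (F : set_system L) :
  {morph p : a b / a - b} -> (forall a, p a ^+ 2 <= sqmod a) ->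
  ProperFilter F -> cauchy F -> forall i, cvg ((fun x : L => p (x i)) @ F).
Proof.
move=> pB ple FF Fc i; apply: cauchy_cvg; apply: cauchy_exP => e e0.
have /cauchyP/(_ e%:C) := Fc; rewrite ltcR => /(_ e0)[x Fx].
exists (p (x i)); rewrite /fmap/=.
apply: (@filterS _ F _ _ _ _ Fx) => y /= xy.
rewrite -ball_normE /ball_/= -pB.
have xy' : l2_sq (x - y) < e ^+ 2.
  move: xy; rewrite -ball_normE /ball_/= l2_normE ltcR => h.
  rewrite -[l2_sq _]sqr_sqrtr ?l2_sq_ge0// ltr_sqr ?nnegrE ?sqrtr_ge0//.
  exact: ltW.
rewrite -(@ltr_sqr _ `|_|) ?nnegrE ?(ltW e0)// real_normK ?num_real//.
apply: le_lt_trans xy'; apply: le_trans (ple _) _.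
exact: (l2_term (x - y) i).
Qed.

Lemma l2_complete (F : set_system L) : ProperFilter F -> cauchy F -> cvg F.
Proof.
move=> FF Fc.
have cRe : forall i, cvg ((fun x : L => complex.Re (x i)) @ F).
  apply: (@coord_cauchy (@complex.Re R)) => //; first by move=> a b; rewrite raddfB.
  by move=> a; rewrite lerDl sqr_ge0.
have cIm : forall i, cvg ((fun x : L => complex.Im (x i)) @ F).
  apply: (@coord_cauchy (@complex.Im R)) => //; first by move=> a b; rewrite raddfB.
  by move=> a; rewrite lerDr sqr_ge0.
pose g : I -> R[i]^o := fun i =>
  lim ((fun x : L => complex.Re (x i)) @ F) +i* lim ((fun x : L => complex.Im (x i)) @ F).
have key (x : L) (e : R) : 0 < e -> F (ball x e%:C) ->
    (nnsum (fun i => sqmod (x i - g i)%R) <= (e ^+ 2)%:E)%E.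
  move=> e0 Fx; apply: ge_ereal_sup => _ [X [Xfin _] <-].
  rewrite fsumEFin// lee_fin fsbig_finite//.
  pose G (y : L) := \sum_(i <- finmap.enum_fset (fset_set X)) sqmod (x i - y i).
  apply: (@cvgr_to_le _ F FF R G).
    apply: cvg_big => [|i _]; first exact: add_continuous.
    rewrite /sqmod.
    under eq_fun do rewrite !raddfB/=.
    rewrite !raddfB/=.
    apply: cvgD; rewrite expr2; under eq_fun do rewrite expr2.
      by apply: cvgM; apply: cvgB; try exact: cvg_cst; exact: cRe.
    by apply: cvgM; apply: cvgB; try exact: cvg_cst; exact: cIm.
  apply: filterS Fx => y /(l2_ball e0) xy.
  apply: le_trans xy; rewrite -lee_fin -l2_sqE.
  apply: esum_ge; exists X => //.
  by rewrite fsumEFin// fsbig_finite.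
have e1 : (0 : R) < 1 by [].
have /cauchyP Fce := Fc.
have gin : g \in l2_pred.
  have [|x Fx] := Fce (1%:C); first by rewrite ltcR.
  have xg : (fun i => x i - g i : R[i]^o) \in l2_pred.
    apply/l2_predP; rewrite /fin_sum (le_lt_trans (key x 1 e1 Fx))//.
    by rewrite ltry.
  rewrite (_ : g = (val x - (fun i => x i - g i : R[i]^o))); last first.
    by apply/funext => i; rewrite -[RHS]/(x i - (x i - g i)) subKr.
  by rewrite rpredB// l2_in.
pose G := L2 gin.
apply/cvg_ex; exists G; apply/fcvg_ballP => eC eC0.
case: eC eC0 => e ? /[dup]; rewrite ltcE/= => /andP[/eqP-> e0] _.
have e20 : 0 < e / 3 by rewrite divr_gt0.
have [|x Fx] := Fce ((e / 3)%:C); first by rewrite ltcR.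
apply: (@filterS _ F _ _ _ _ Fx) => y xy.
have Gx : ball G (e / 2)%:C x.
  rewrite -ball_normE /ball_/= distrC l2_normE ltcR.
  have : l2_sq (x - G) <= (e / 3) ^+ 2.
    by rewrite -lee_fin -l2_sqE; exact: key.
  move=> /ler_wsqrtr; rewrite sqrtr_sqr ger0_norm ?(ltW e20)// => h.
  apply: le_lt_trans h _; lra.
rewrite -[e +i* 0]/(e%:C) (_ : e%:C = (e / 2)%:C + (e / 2)%:C); last first.
  by rewrite -rmorphD/= -splitr.
apply: ball_triangle Gx _.
apply: le_ball xy; rewrite lecR; lra.
Qed.

HB.instance Definition _ := Uniform_isComplete.Build L l2_complete.

Lemma l2_inner_norm x : l2_inner x x = `|x| ^+ 2.
Proof. by rewrite l2_normE -rmorphXn/= sqr_sqrtr ?l2_sq_ge0// l2_inner_sq. Qed.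

HB.instance Definition _ := isHilbert.Build R L l2_inner_norm.

End L2Complete.

(* Unital C*-algebras (the zero algebra is allowed). The norm is a field of the
   structure, and completeness is spelled out with Cauchy sequences, because the
   hierarchy has no common extension of rings and normed modules. *)
HB.mixin Record isCstarAlgebra (R : realType) (A : Type)
    & GRing.Algebra R[i] A := {
  cnorm : A -> R ;
  star : A -> A ;
  cnormD : forall x y, cnorm (x + y) <= cnorm x + cnorm y ;
  cnormZ : forall (k : R[i]) x, (cnorm (k *: x))%:C = `|k| * (cnorm x)%:C ;
  cnorm_eq0 : forall x, cnorm x = 0 -> x = 0 ;
  cnormM : forall x y, cnorm (x * y) <= cnorm x * cnorm y ;
  cnorm_complete : forall u : nat -> A,
    (forall e, 0 < e -> exists n0, forall m n, (n0 <= m)%N -> (n0 <= n)%N ->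
       cnorm (u m - u n) < e) ->
    exists l, forall e, 0 < e -> exists n0, forall n, (n0 <= n)%N ->
       cnorm (u n - l) < e ;
  starK : involutive star ;
  starD : forall x y, star (x + y) = star x + star y ;
  starZ : forall (k : R[i]) x, star (k *: x) = Num.conj k *: star x ;
  starM : forall x y, star (x * y) = star y * star x ;
  cstar_identity : forall x, cnorm (star x * x) = cnorm x ^+ 2 }.

#[short(type="cstarAlgType")]
HB.structure Definition CstarAlgebra (R : realType) :=
  {A of isCstarAlgebra R A & GRing.Algebra R[i] A}.

Section Operators.
Context {R : realType} {K : hilbertType R}.
Implicit Types S T : K -> K.

Definition bounded_op T :=
  linear T /\ exists M : R, forall x, `|T x| <= M%:C * `|x|.

Definition adjoint S T := forall x y, inner (S x) y = inner x (T y).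

Lemma bounded_op_id : bounded_op idfun.
Proof. by split=> //; exists 1 => x; rewrite mul1r. Qed.

Lemma bounded_op_lin (a : R[i]) S T : bounded_op S -> bounded_op T ->
  bounded_op (fun x => a *: S x + T x).
Proof.
move=> [lS [M MP]] [lT [N NP]]; split.
  move=> k x y; rewrite lS lT scalerDr scalerDr !scalerA [k * a]mulrC -!addrA.
  by congr +%R; rewrite addrCA.
exists (complex.Re `|a| * M + N) => x.
apply: (le_trans (ler_normD _ _)).
rewrite normrZ rmorphD/= rmorphM/= mulrDl lerD//.
have -> : (complex.Re `|a|)%:C = `|a| by rewrite normc_def.
by rewrite -mulrA ler_wpM2l.
Qed.

Lemma bounded_op_comp S T : bounded_op S -> bounded_op T ->
  bounded_op (S \o T).
Proof.
move=> [lS [M MP]] [lT [N NP]]; split; first by move=> k x y /=; rewrite lT lS.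
exists (`|M| * N) => x /=; apply: le_trans (MP _) _.
rewrite rmorphM/= -mulrA; apply: (@le_trans _ _ (`|M|%:C * `|T x|)).
  by rewrite ler_wpM2r// lecR ler_norm.
by rewrite ler_wpM2l// lecR.
Qed.

End Operators.

(* Unital C*-algebras of operators on K: norm-closed unital *-subalgebras of
   B(K). The adjoint of a bounded operator exists by the Riesz theorem, so it is
   not part of the data. *)
Record opAlg (R : realType) (K : hilbertType R) := OpAlg {
  op_set : set (K -> K) ;
  op_bounded : forall T, op_set T -> bounded_op T ;
  op_id : op_set idfun ;
  op_lin : forall (a : R[i]) S T, op_set S -> op_set T ->
    op_set (fun x => a *: S x + T x) ;
  op_comp : forall S T, op_set S -> op_set T -> op_set (S \o T) ;
  op_adj : forall S T, op_set S -> bounded_op T -> adjoint S T -> op_set T ;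
  op_closed : forall T, bounded_op T ->
    (forall e : R, 0 < e ->
      exists2 S, op_set S & forall x, `|T x - S x| <= e%:C * `|x|) ->
    op_set T }.

Definition op_elt (R : realType) (K : hilbertType R) (B : opAlg K) :=
  {T : K -> K | op_set B T}.
Coercion op_elt : opAlg >-> Sortclass.

Section OperatorAlgebras.
Context {R : realType} {K : hilbertType R}.

(* B(K) *)
Definition all_op : opAlg K.
Proof.
refine (@OpAlg R K [set T | bounded_op T] _ _ _ _ _ _) => //.
- exact: bounded_op_id.
- exact: bounded_op_lin.
- exact: bounded_op_comp.
Defined.

Variable X : set (K -> K).

(* The C*-algebra of operators generated by X: the intersection of those that
   contain X. *)
Definition gen_op_set : set (K -> K) :=
  [set T | bounded_op T /\ forall B : opAlg K, X `<=` op_set B -> op_set B T].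

Definition gen_op : opAlg K.
Proof.
refine (@OpAlg R K gen_op_set _ _ _ _ _ _).
- by move=> T [].
- by split=> [|B _]; [exact: bounded_op_id|exact: op_id].
- move=> a S T [bS XS] [bT XT]; split; first exact: bounded_op_lin.
  by move=> B XB; apply: op_lin; [exact: XS|exact: XT].
- move=> S T [bS XS] [bT XT]; split; first exact: bounded_op_comp.
  by move=> B XB; apply: op_comp; [exact: XS|exact: XT].
- move=> S T [bS XS] bT ST; split=> // B XB.
  by apply: op_adj bT ST; exact: XS.
- move=> T bT TX; split=> // B XB; apply: op_closed => // e /TX[S [_ XS] TS].
  by exists S => //; exact: XS.
Defined.

Lemma gen_op_in T : X T -> bounded_op T -> op_set gen_op T.
Proof. by move=> XT bT; split=> // B; exact. Qed.

End OperatorAlgebras.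

(* Unital *-representations of A on the Hilbert space H. *)
Record starRep (R : realType) (A : cstarAlgType R) (H : hilbertType R) := StarRep {
  rep_op :> A -> H -> H ;
  rep_bounded : forall a, bounded_op (rep_op a) ;
  rep_lin : forall (k : R[i]) a b x,
    rep_op (k *: a + b) x = k *: rep_op a x + rep_op b x ;
  repM : forall a b x, rep_op (a * b) x = rep_op a (rep_op b x) ;
  rep1 : forall x, rep_op 1 x = x ;
  rep_star : forall a, adjoint (rep_op a) (rep_op (star a)) }.

Section MinimalTensorNorm.
Context {R : realType}.

(* A list of pairs (x_k, y_k) stands for the element \sum_k x_k (x) y_k of an
   algebraic tensor product. tensor_norm is the norm that the algebraic tensor
   product of H and K inherits from the Hilbert space tensor product, where
   <x (x) y, x' (x) y'> = <x, x'> <y, y'>. *)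
Definition tensor_norm {H K : hilbertType R} (x : seq (H * K)) : R :=
  Num.sqrt (complex.Re (\sum_(u <- x) \sum_(v <- x)
    (inner u.1 v.1 : R[i]) * (inner u.2 v.2 : R[i]))).

Context {A : cstarAlgType R} {K : hilbertType R} {B : opAlg K}.

(* The vector (pi (x) id)(t) x. *)
Definition tensor_op {H : hilbertType R} (pi : starRep A H)
    (t : seq (A * B)) (x : seq (H * K)) : seq (H * K) :=
  [seq (pi u.1 v.1, sval u.2 v.2) | u <- t, v <- x].

(* The operator norm of (pi (x) id)(t) on the Hilbert space tensor product of H
   and K, computed on the unit ball of the dense algebraic tensor product. *)
Definition rep_tensor_norm {H : hilbertType R} (pi : starRep A H)
    (t : seq (A * B)) : \bar R :=
  ereal_sup [set (tensor_norm (tensor_op pi t x))%:E |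
             x in [set x | tensor_norm x <= 1]].

(* The minimal (spatial) tensor norm of an element t of the algebraic tensor
   product of A and B, where B acts on K by definition and A is represented by
   all of its representations at once (their direct sum is faithful). It is
   extended-real valued only because the supremum is taken in \bar R: every
   representation is contractive, so the value is finite. *)
Definition min_norm (t : seq (A * B)) : \bar R :=
  ereal_sup [set r | exists (H : hilbertType R) (pi : starRep A H),
                     r = rep_tensor_norm pi t].

End MinimalTensorNorm.

(* The free group on 'I_d, as the group of reduced words; (i, true) is the
   generator i and (i, false) is its inverse. *)
Section FreeGroup.
Context {d : nat}.
Local Notation letter := ('I_d * bool)%type.
Implicit Types (x y : letter) (u v w : seq letter).

Definition letter_inv x : letter := (x.1, ~~ x.2).

Definition reduced w := sorted (fun x y => y != letter_inv x) w.

Definition letter_mul x w : seq letter :=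
  if w is y :: w' then if y == letter_inv x then w' else x :: w else [:: x].

Definition word_mul u v := foldr letter_mul v u.

Definition word_inv u := rev [seq letter_inv x | x <- u].

Lemma letter_invK : involutive letter_inv.
Proof. by case=> i b; rewrite /letter_inv/= negbK. Qed.

Lemma reduced_tail x w : reduced (x :: w) -> reduced w.
Proof. by case: w => //= y w /andP[]. Qed.

Lemma letter_mul_reduced x w : reduced w -> reduced (letter_mul x w).
Proof.
case: w => //= y w yw; case: ifPn => [_|yx]; first exact: reduced_tail yw.
by rewrite /reduced/= yx.
Qed.

Lemma letter_mulK x w : reduced w ->
  letter_mul x (letter_mul (letter_inv x) w) = w.
Proof.
case: w => [|y w] /=; first by rewrite eqxx.
rewrite letter_invK; have [->|yx] := eqVneq y x; last by rewrite /= eqxx.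
by case: w => //= z w /andP[/negbTE ->].
Qed.

Lemma word_mul_reduced u v : reduced v -> reduced (word_mul u v).
Proof. by move=> vr; elim: u => //= x u; exact: letter_mul_reduced. Qed.

Lemma letter_mulA x u w : reduced w ->
  word_mul (letter_mul x u) w = letter_mul x (word_mul u w).
Proof.
move=> wr; case: u => [//|y u] /=; case: eqP => [->|//].
by rewrite letter_mulK// word_mul_reduced.
Qed.

Lemma word_mulA u v w : reduced w ->
  word_mul u (word_mul v w) = word_mul (word_mul u v) w.
Proof.
by move=> wr; elim: u => //= x u ->; rewrite letter_mulA.
Qed.

Lemma word_mul1 w : reduced w -> word_mul w [::] = w.
Proof.
elim: w => //= x w IH xw; rewrite IH; last exact: reduced_tail xw.
by case: w xw {IH} => //= y w /andP[/negbTE ->].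
Qed.

Lemma word_inv_reduced w : reduced w -> reduced (word_inv w).
Proof.
rewrite /reduced /word_inv rev_sorted sorted_map; apply: sub_sorted => x y /=.
by rewrite letter_invK; apply: contra => /eqP ->.
Qed.

Lemma word_mulV w : word_mul (word_inv w) w = [::].
Proof.
rewrite /word_inv; elim: w => // x w IH.
rewrite map_cons rev_cons -cats1 /word_mul foldr_cat /=.
by rewrite letter_invK eqxx.
Qed.

Lemma word_invK : involutive word_inv.
Proof.
by move=> w; rewrite /word_inv map_rev revK -map_comp map_id_in// => x _ /=;
   rewrite letter_invK.
Qed.

End FreeGroup.

Record free_group (d : nat) := FreeGroup {
  word : seq ('I_d * bool) ;
  word_reduced : reduced word }.

HB.instance Definition _ d := [isSub for @word d].
HB.instance Definition _ d := [Choice of free_group d by <:].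

Section FreeGroupLaws.
Context {d : nat}.
Local Notation F := (free_group d).

Definition free_one : F := @FreeGroup d [::] isT.

Definition free_mul (g h : F) : F :=
  FreeGroup (word_mul_reduced (word g) (word_reduced h)).

Definition free_inv (g : F) : F :=
  FreeGroup (word_inv_reduced (word_reduced g)).

Fact free_mulA : associative free_mul.
Proof. by move=> g h k; apply/val_inj/word_mulA/word_reduced. Qed.

Fact free_mul1g : left_id free_one free_mul.
Proof. by move=> g; exact/val_inj. Qed.

Fact free_mulg1 : right_id free_one free_mul.
Proof. by move=> g; apply/val_inj/word_mul1/word_reduced. Qed.

Fact free_mulVg : left_inverse free_one free_inv free_mul.
Proof. by move=> g; apply/val_inj/word_mulV. Qed.

Fact free_mulgV : right_inverse free_one free_inv free_mul.
Proof.
move=> g; apply/val_inj => /=; rewrite -{1}[word g]word_invK.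
exact: word_mulV.
Qed.

HB.instance Definition _ := isGroup.Build F
  free_mulA free_mul1g free_mulg1 free_mulVg free_mulgV.

Definition free_gen (i : 'I_d) : F := @FreeGroup d [:: (i, true)] isT.

(* g_1, ..., g_d followed by their inverses. *)
Definition free_gens (i : 'I_(d + d)) : F :=
  match fintype.split i with inl j => free_gen j | inr j => ((free_gen j)^-1)%g end.

End FreeGroupLaws.

Section LeftRegular.
Context {R : realType} {G : groupType}.

Lemma nnsum_translate (g : G) (f : G -> R) :
  nnsum (fun h => f (g * h)%g) = nnsum f.
Proof.
rewrite /nnsum [RHS](@reindex_esum _ _ _ setT setT (fun h => (g * h)%g))//.
split=> //; first by move=> h k _ _ /mulgI.
by move=> h _; exists (g^-1 * h)%g => //; rewrite mulVKg.
Qed.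

Lemma l2_translate_in (g : G) (f : l2 R G) :
  (fun h => f (g^-1 * h)%g : R[i]^o) \in l2_pred.
Proof.
apply/l2_predP; rewrite /fin_sum (nnsum_translate g^-1%g (fun h => sqmod (f h))).
exact: l2_fin.
Qed.

(* (lreg g f) h = f (g^-1 h), so that lreg g maps delta_h to delta_(g h). *)
Definition lreg (g : G) (f : l2 R G) : l2 R G := L2 (l2_translate_in g f).

Lemma lreg_bounded g : bounded_op (lreg g).
Proof.
split; first by move=> k x y; exact/val_inj.
exists 1 => x; rewrite mul1r !l2_normE /l2_sq.
by rewrite (nnsum_translate g^-1%g (fun h => sqmod (x h))).
Qed.

(* The reduced C*-algebra of G. *)
Definition redCstar : opAlg (l2 R G) := gen_op (range lreg).

Definition lambda (g : G) : redCstar :=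
  exist _ (lreg g) (gen_op_in (imageT lreg g) (lreg_bounded g)).

End LeftRegular.

(* M_N(C) is the algebra of all operators on C^N = l^2('I_N). *)
Section MatrixOperators.
Context {R : realType} {N : nat}.

Lemma nnsum_ord (f : 'I_N -> R) : (forall i, 0 <= f i) ->
  nnsum f = (\sum_i f i)%:E.
Proof.
move=> f0; have fin : finite_set [set: 'I_N] by exact: finite_finset.
rewrite /nnsum esum_fset//; last by move=> i _; rewrite lee_fin.
rewrite fsumEFin//; congr (_%:E).
rewrite [RHS](@bigfs _ _ _ _ _ xpredT) ?index_enum_uniq//; last first.
  by move=> i _; rewrite mem_index_enum.
by apply: eq_fsbigl; apply/seteqP; split.
Qed.

Lemma mxop_in (M : 'M[R[i]]_N) (f : l2 R 'I_N) :
  (fun i => \sum_j M i j * f j : R[i]^o) \in l2_pred.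
Proof.
apply/l2_predP; rewrite /fin_sum nnsum_ord ?ltry// => i; exact: sqmod_ge0.
Qed.

Definition mxop (M : 'M[R[i]]_N) (f : l2 R 'I_N) : l2 R 'I_N := L2 (mxop_in M f).

Lemma sqmod_norm (z : R[i]) : (sqmod z)%:C = `|z| ^+ 2.
Proof. by rewrite sqr_normc sqmodE. Qed.

Lemma mxop_bounded M : bounded_op (mxop M).
Proof.
split=> [k x y|].
  apply: val_inj; apply: funext => i /=.
  rewrite -[RHS]/(k * (\sum_j M i j * x j) + \sum_j M i j * y j).
  rewrite mulr_sumr -big_split/=; apply: eq_bigr => j _.
  by transitivity (M i j * (k * x j + y j)) => //; rewrite mulrDr mulrCA.
pose c i : R := complex.Re (\sum_j `|M i j|).
have cE i : (c i)%:C = \sum_j `|M i j|.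
  by rewrite /c RRe_real// ger0_real// sumr_ge0.
have c0 i : 0 <= c i by rewrite -lecR cE sumr_ge0.
exists (Num.sqrt (\sum_i c i ^+ 2)) => x.
have bound i : sqmod (mxop M x i) <= c i ^+ 2 * l2_sq x.
  have h : `|mxop M x i| <= (c i * Num.sqrt (l2_sq x))%:C.
    apply: le_trans (ler_norm_sum _ _ _) _.
    rewrite rmorphM/= cE mulr_suml; apply: ler_sum => j _.
    have ge : 0 <= (Num.sqrt (l2_sq x))%:C by rewrite lecR sqrtr_ge0.
    rewrite normrM ler_wpM2l// -(@ler_sqr _ `|_|) ?nnegrE ?normr_ge0 ?ge//.
    by rewrite -sqmod_norm -rmorphXn/= sqr_sqrtr ?l2_sq_ge0// lecR l2_term.
  rewrite -lecR sqmod_norm; apply: le_trans (_ : (c i * Num.sqrt (l2_sq x))%:C ^+ 2 <= _).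
    by rewrite ler_sqr ?nnegrE// lecR mulr_ge0// sqrtr_ge0.
  by rewrite -rmorphXn/= exprMn sqr_sqrtr ?l2_sq_ge0.
rewrite !l2_normE -rmorphM/= lecR -sqrtrM; last by apply: sumr_ge0 => i _; rewrite sqr_ge0.
rewrite ler_wsqrtr// [l2_sq (mxop M x)]/l2_sq nnsum_ord; last by move=> i; exact: sqmod_ge0.
by rewrite /= mulr_suml; apply: ler_sum => i _; exact: bound.
Qed.

Definition mx_elt (M : 'M[R[i]]_N) : @all_op R (l2 R 'I_N) :=
  exist _ (mxop M) (mxop_bounded M).

End MatrixOperators.

Section RandomUnitaries.
Context {R : realType} {disp : measure_display} {T : measurableType disp}.

Definition borel_mx (N : nat) : set (set 'M[R[i]]_N) :=
  <<s @open 'M[R[i]^o]_N >>.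

(* U is a random unitary matrix whose law is the Haar probability measure, that
   is, the left-invariant one. *)
Definition haar_unitary (P : probability T R) (N : nat) (U : T -> 'M[R[i]]_N) :=
  [/\ forall B, borel_mx B -> measurable (U @^-1` B),
      forall w, U w \is unitarymx &
      forall V, V \is unitarymx -> forall B, borel_mx B ->
        P [set w | B (V *m U w)] = P (U @^-1` B)].

(* Some of the B j may be the whole space, so subfamilies are covered. *)
Definition mutually_independent (P : probability T R) (d N : nat)
    (U : 'I_d -> T -> 'M[R[i]]_N) :=
  forall B : 'I_d -> set 'M[R[i]]_N, (forall j, borel_mx (B j)) ->
    P (\bigcap_j (U j @^-1` B j)) = (\prod_(j < d) P (U j @^-1` B j))%E.

End RandomUnitaries.

Section Model.
Context {R : realType} {A : cstarAlgType R} {d : nat}.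
Variable a : 'I_(d + d).+1 -> A.

(* The coefficients are a_0, a_1, ..., a_(2d). *)
Definition A_free : seq (A * @redCstar R (free_group d)) :=
  (a ord0, lambda 1%g) ::
  [seq (a (lift ord0 i), lambda (free_gens i)) | i <- enum 'I_(d + d)].

Definition unitaries {N : nat} (U : 'I_d -> 'M[R[i]]_N) (i : 'I_(d + d)) :=
  match fintype.split i with inl j => U j | inr j => map_mx Num.conj (U j)^T end.

Definition A_mx {N : nat} (U : 'I_d -> 'M[R[i]]_N) :
    seq (A * @all_op R (l2 R 'I_N)) :=
  (a ord0, mx_elt 1%:M) ::
  [seq (a (lift ord0 i), mx_elt (unitaries U i)) | i <- enum 'I_(d + d)].

End Model.

(* Main.v *)
From HB Require Import structures.
Require Import Defs.
From mathcomp Require Import all_boot all_order all_algebra.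
From mathcomp Require Import sesquilinear spectral.
From mathcomp Require Import all_classical all_reals all_analysis.
From mathcomp Require Import measurable_realfun.
From mathcomp Require Import complex.
From mathcomp Require Import ring lra zify.
Set Implicit Arguments.
Unset Strict Implicit.
Unset Printing Implicit Defensive.
Import Order.TTheory GRing.Theory Num.Theory.
Import numFieldNormedType.Exports.
Local Open Scope classical_set_scope.
Local Open Scope ring_scope.
Local Open Scope complex_scope.

(* Fix a representation and view A_F as a convolution operator on l^2(F_d; H).

   Localization: multiplying by hat functions of the word length, of width 2 rho,
   nearly commutes with A_F. The error only involves the parts of A_F that raise
   or lower the length; these are Fourier coefficients of A_F under the unitaries
   i^(k |g|), hence are controlled by the norm of A_F and not by the sum of the
   norms of the coefficients. A windowed vector lives on an annulus of the Cayley
   tree, whose pieces with a given suffix are right translates of subsets of the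
   ball of radius 2 rho. So the norm of A_F on vectors supported in that ball is at
   least (1 - O(1/rho)) times its norm.

   Transfer: for f supported in the ball, the vectors
   F_c = sum_h f(h) (x) U_h e_c satisfy A_N F_c = sum_h (A_F f)(h) (x) U_h e_c, and
   the sum over c of |F_c|^2 is N |f|^2 plus terms <f(h), f(k)> Tr U_(h k^-1) with
   h <> k. The loop equation of the Haar measure gives E |Tr U_w|^2 <= 32^|w| for
   every reduced word w <> 1, so with (2d)^(72 rho) <= N these terms are negligible
   for both f and A_F f. This yields the bound with 1/rho = O(log(2d) / log N). *)

(** * Words in unitary matrices *)

(** Localization cannot be closed in one stroke: its error is a multiple of the very norm to be
    bounded. With lam the best squared bound for A_F and K2 a squared bound on the ball, it reads (1
    - 1/rho) lam <= K2 + (12/rho) lam, which can be solved because lam is finite. This is why an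
    infimum of admissible constants appears, and where the loss 13/rho comes from.

    On the random side no concentration of measure enters. Comparing the quadratic forms of f and
    A_F f bounds the norm of A_N below by an expression linear in the two off-diagonal errors, so
    first moments suffice. What cancellation must provide is a second moment of Tr U_w free of N,
    where the trivial bound is N^2. In the loop equation a factor N multiplies both the leading term
    |Tr U_w|^2 and the products with proper prefixes, so dividing by it leaves a recursion on the
    length alone.

    Both norms are suprema over representations. Any representation used for A_F also tests A_N, so
    one of them is fixed until the end. *)

Section Modulus.
Context {R : realType}.
Implicit Types z w : R[i].

Definition cmod z : R := Num.sqrt (sqmod z).

Lemma cmodE z : `|z| = (cmod z)%:C.
Proof. by rewrite normc_def. Qed.

Lemma cmod_ge0 z : 0 <= cmod z.
Proof. exact: sqrtr_ge0. Qed.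

Lemma cmodM z w : cmod (z * w) = cmod z * cmod w.
Proof. by apply: complexI; rewrite -cmodE normrM !cmodE -rmorphM. Qed.

Lemma cmodD z w : cmod (z + w) <= cmod z + cmod w.
Proof. by rewrite -lecR rmorphD/= -!cmodE ler_normD. Qed.

Lemma cmodN z : cmod (- z) = cmod z.
Proof. by apply: complexI; rewrite -!cmodE normrN. Qed.

Lemma cmod_conj z : cmod (Num.conj z) = cmod z.
Proof. by apply: complexI; rewrite -!cmodE norm_conjC. Qed.

Lemma cmod_real (x : R) : cmod x%:C = `|x|.
Proof. by rewrite /cmod /sqmod/= expr0n addr0 sqrtr_sqr. Qed.

Lemma cmod0 : cmod 0 = 0.
Proof. by rewrite cmod_real normr0. Qed.

Lemma cmod_sqr z : cmod z ^+ 2 = sqmod z.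
Proof. by rewrite sqr_sqrtr ?sqmod_ge0. Qed.

Lemma cmod_sum (I : Type) (r : seq I) (Q : pred I) (F : I -> R[i]) :
  cmod (\sum_(i <- r | Q i) F i) <= \sum_(i <- r | Q i) cmod (F i).
Proof.
elim/big_ind2: _ => [|x a y b xa yb|//]; first by rewrite cmod0.
by apply: le_trans (cmodD _ _) _; rewrite lerD.
Qed.

Lemma normr_Re_le_cmod z : `|complex.Re z| <= cmod z.
Proof. by rewrite -lecR -cmodE normc_ge_Re. Qed.

Lemma normr_Im_le_cmod z : `|complex.Im z| <= cmod z.
Proof. by rewrite -sqrtr_sqr ler_wsqrtr// /sqmod lerDr sqr_ge0. Qed.

Lemma cRe_conj z : complex.Re (Num.conj z) = complex.Re z.
Proof. by rewrite -[Num.conj z]/(conjc z); case: z. Qed.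

Lemma cIm_conj z : complex.Im (Num.conj z) = - complex.Im z.
Proof. by rewrite -[Num.conj z]/(conjc z); case: z. Qed.

Lemma Re_mul_conj z : complex.Re (z * Num.conj z) = cmod z ^+ 2.
Proof. by rewrite cmod_sqr sqmodE. Qed.

End Modulus.

Section UnitaryMatrices.
Context {R : realType} {N : nat}.
Local Notation M := 'M[R[i]]_N.
Implicit Types A B : M.

Definition adjmx A : M := map_mx Num.conj A^T.

Lemma adjmxE A i j : adjmx A i j = Num.conj (A j i).
Proof. by rewrite !mxE. Qed.

Lemma adjmxK A : adjmx (adjmx A) = A.
Proof. by apply/matrixP => i j; rewrite !adjmxE conjCK. Qed.

Lemma adjmxM A B : adjmx (A *m B) = adjmx B *m adjmx A.
Proof. by rewrite /adjmx trmx_mul map_mxM. Qed.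

Lemma adjmx1 : adjmx 1%:M = 1%:M.
Proof. by rewrite /adjmx trmx1 map_mx1. Qed.

Lemma adjmxD A B : adjmx (A + B) = adjmx A + adjmx B.
Proof. by rewrite /adjmx raddfD map_mxD. Qed.

Lemma adjmxZ k A : adjmx (k *: A) = Num.conj k *: adjmx A.
Proof. by rewrite /adjmx linearZ map_mxZ. Qed.

Lemma unitarymx_adj A : (adjmx A \is unitarymx) = (A \is unitarymx).
Proof. exact: trmxC_unitary. Qed.

Lemma mulmx_adj A : A \is unitarymx -> A *m adjmx A = 1%:M.
Proof. by move/unitarymxP. Qed.

Lemma mul_adjmx A : A \is unitarymx -> adjmx A *m A = 1%:M.
Proof. by rewrite -{1 3}[A]adjmxK unitarymx_adj; exact: mulmx_adj. Qed.

Lemma adjmx_unitary A : A \is unitarymx -> adjmx A \is unitarymx.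
Proof. by rewrite unitarymx_adj. Qed.

Lemma unitarymxM A B :
  A \is unitarymx -> B \is unitarymx -> A *m B \is unitarymx.
Proof. exact: mul_unitarymx. Qed.

Lemma unitarymx_entry A i j : A \is unitarymx -> cmod (A i j) <= 1.
Proof.
move=> /mulmx_adj/matrixP/(_ i i); rewrite !mxE eqxx mulr1n.
move=> /(congr1 (@complex.Re R)).
rewrite raddf_sum/= (bigD1 j)//= adjmxE Re_mul_conj => h.
rewrite -(@ler_sqr _ _ 1) ?nnegrE ?cmod_ge0// expr1n -h lerDl.
by apply: sumr_ge0 => k _; rewrite adjmxE Re_mul_conj sqr_ge0.
Qed.

Lemma unitarymx_trace A : A \is unitarymx -> cmod (\tr A) <= N%:R.
Proof.
move=> uA; apply: le_trans (cmod_sum _ _ _) _.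
apply: le_trans (_ : \sum_(i < N) 1 <= _).
  by apply: ler_sum => i _; exact: unitarymx_entry.
by rewrite sumr_const card_ord.
Qed.

Lemma mxtrace_adj A : \tr (adjmx A) = Num.conj (\tr A).
Proof. by rewrite /mxtrace rmorph_sum; apply: eq_bigr => i _; rewrite adjmxE. Qed.

End UnitaryMatrices.

Section WordMatrices.
Context {R : realType} {d N : nat}.
Local Notation M := 'M[R[i]]_N.
Local Notation letter := ('I_d * bool)%type.
Implicit Types (u : 'I_d -> M) (x : letter) (w v : seq letter).

Definition letter_mx u x : M := if x.2 then u x.1 else adjmx (u x.1).

Definition word_mx u w : M := foldr (fun x A => letter_mx u x *m A) 1%:M w.

Lemma word_mx_cons u x w : word_mx u (x :: w) = letter_mx u x *m word_mx u w.
Proof. by []. Qed.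

Lemma word_mx_cat u v w : word_mx u (v ++ w) = word_mx u v *m word_mx u w.
Proof. by elim: v => [|x v IH]; rewrite ?mul1mx//= IH mulmxA. Qed.

Lemma word_mx1 u x : word_mx u [:: x] = letter_mx u x.
Proof. by rewrite /= mulmx1. Qed.

Lemma letter_mx_inv u x : letter_mx u (letter_inv x) = adjmx (letter_mx u x).
Proof. by case: x => j [] //=; rewrite /letter_mx/= adjmxK. Qed.

Lemma word_mx_inv u w : word_mx u (word_inv w) = adjmx (word_mx u w).
Proof.
elim: w => [|x w IH]; first by rewrite adjmx1.
rewrite /word_inv map_cons rev_cons -cats1 word_mx_cat IH word_mx1.
by rewrite letter_mx_inv -adjmxM.
Qed.

Section Unitary.
Variable u : 'I_d -> M.
Hypothesis uu : forall j, u j \is unitarymx.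

Lemma letter_mx_unitary x : letter_mx u x \is unitarymx.
Proof.
rewrite /letter_mx; case: ifP => _; first exact: uu.
exact: (adjmx_unitary (uu x.1)).
Qed.

Lemma word_mx_unitary w : word_mx u w \is unitarymx.
Proof.
elim: w => [|x w IH]; last exact: unitarymxM (letter_mx_unitary x) IH.
by apply/unitarymxP; rewrite trmx1 map_mx1 mulmx1.
Qed.

Lemma word_mx_letter_mul x w :
  word_mx u (letter_mul x w) = letter_mx u x *m word_mx u w.
Proof.
case: w => [|y w] //=; case: eqP => [->|//].
by rewrite letter_mx_inv mulmxA mulmx_adj ?letter_mx_unitary// mul1mx.
Qed.

Lemma word_mx_mul v w : word_mx u (word_mul v w) = word_mx u v *m word_mx u w.
Proof. by elim: v => [|x v IH]; rewrite ?mul1mx//= word_mx_letter_mul IH mulmxA. Qed.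

Lemma word_mx_trace w : cmod (\tr (word_mx u w)) <= N%:R.
Proof. exact/unitarymx_trace/word_mx_unitary. Qed.

End Unitary.

(* The derivative of [word_mx u w] when [u j] moves in the direction [X *m u j]
   with [X] anti-Hermitian, extended linearly to all [X]. *)
Definition dletter (j : 'I_d) (X : M) u x : M :=
  if x.1 == j then if x.2 then X *m u j else - (adjmx (u j) *m X) else 0.

Fixpoint dword (j : 'I_d) (X : M) u w : M :=
  if w is x :: w' then
    dletter j X u x *m word_mx u w' + letter_mx u x *m dword j X u w'
  else 0.

Lemma dletter_lin j u x k X Y :
  dletter j (k *: X + Y) u x = k *: dletter j X u x + dletter j Y u x.
Proof.
rewrite /dletter; case: eqP => _; last by rewrite scaler0 addr0.
case: x.2; first by rewrite mulmxDl scalemxAl.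
by rewrite mulmxDr -scalemxAr opprD scalerN.
Qed.

Lemma dword_lin j u w k X Y :
  dword j (k *: X + Y) u w = k *: dword j X u w + dword j Y u w.
Proof.
elim: w => [|x w IH] /=; first by rewrite scaler0 addr0.
rewrite dletter_lin IH mulmxDl mulmxDr scalerDr -scalemxAl -scalemxAr.
by rewrite -!addrA; congr (_ + _); rewrite addrCA.
Qed.

Lemma sum_delta_mul (A B C : M) (a b : 'I_N) :
  (A *m delta_mx a b *m B) a b = A a a * B b b.
Proof.
rewrite mxE (bigD1 b)//= [X in _ + X]big1 ?addr0; last first.
  move=> k kb; rewrite mxE big1 ?mul0r// => l _.
  by rewrite mxE (negbTE kb) andbF mulr0.
rewrite mxE (bigD1 a)//= [X in _ + X]big1 ?addr0 ?mxE ?eqxx ?mulr1//.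
by move=> k ka; rewrite mxE (negbTE ka) mulr0.
Qed.

(** A matrix unit inserted at the letter in position [k] cuts the word in two. The cut lies in front
    of g_j but behind its inverse, with a sign, because [dletter] puts [X] to the left of [u j] and
    to the right of its adjoint. *)
Definition split_term (j : 'I_d) u w (k : nat) : R[i] :=
  let x := nth (j, true) w k in
  if x == (j, true) then \tr (word_mx u (take k w)) * \tr (word_mx u (drop k w))
  else if x == (j, false) then
    - (\tr (word_mx u (take k.+1 w)) * \tr (word_mx u (drop k.+1 w)))
  else 0.

(** Contracting (A E_ab B)_ab over a and b gives Tr A * Tr B, so the trace splits. The prefix [v]
    holds the letters already passed, which the induction on [w] must keep. *)
Lemma sum_dword j u v w :
  \sum_a \sum_b (word_mx u v *m dword j (delta_mx a b) u w) a b =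
  \sum_(size v <= k < size v + size w) split_term j u (v ++ w) k.
Proof.
elim: w v => [|x w IH] v.
  by rewrite addn0 big_geq// big1// => a _; rewrite big1// => b _; rewrite mulmx0 mxE.
rewrite /= big_ltn ?addnS ?ltnS ?leq_addr//.
under eq_bigr => a _ do under eq_bigr => b _ do rewrite mulmxDr mxE !mulmxA.
under eq_bigr => a _ do rewrite big_split/=.
rewrite big_split/=; congr (_ + _); last first.
  have := IH (rcons v x); rewrite -cats1 -catA size_cat/= addn1 addSn => <-.
  apply: eq_bigr => a _; apply: eq_bigr => b _.
  by rewrite word_mx_cat word_mx1.
have sumE (A B : M) : \sum_a \sum_b (A *m delta_mx a b *m B) a b = \tr A * \tr B.
  rewrite /mxtrace mulr_suml; apply: eq_bigr => a _; rewrite mulr_sumr.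
  by apply: eq_bigr => b _; rewrite sum_delta_mul.
have tk : take (size v).+1 (v ++ x :: w) = rcons v x.
  by rewrite -cat_rcons take_size_cat// size_rcons.
have dk : drop (size v).+1 (v ++ x :: w) = w.
  by rewrite -cat_rcons drop_size_cat// size_rcons.
rewrite /split_term tk dk nth_cat ltnn subnn /= take_size_cat// drop_size_cat//.
rewrite -cats1 word_mx_cat word_mx1.
case: x {tk dk} => i b; rewrite /dletter/= !xpair_eqE.
case: eqP => [->|_]; last first.
  rewrite big1// => a _; rewrite big1// => c _.
  by rewrite mulmx0 mul0mx mxE.
case: b => /=.
  under eq_bigr => a _ do under eq_bigr => b _ do rewrite mulmxA -mulmxA.
  by rewrite sumE.
under eq_bigr => a _ do under eq_bigr => b _ do rewrite mulmxN mulNmx mxE mulmxA.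
under eq_bigr => a _ do rewrite sumrN.
by rewrite sumrN sumE.
Qed.

(** Here the contraction merges: G_ab Tr (A E_ab B) sums to Tr (G B A), the trace of a single
    unitary, hence at most N for each letter of [w]. *)
Lemma sum_trace_dword j u (C G : M) w : (forall i, u i \is unitarymx) ->
  C \is unitarymx -> G \is unitarymx ->
  cmod (\sum_a \sum_b G a b * \tr (C *m dword j (delta_mx a b) u w)) <=
  (size w * N)%:R.
Proof.
move=> uu; elim: w C => [|x w IH] C uC uG.
  rewrite big1 ?cmod0// => a _; rewrite big1// => b _.
  by rewrite mulmx0 mxtrace0 mulr0.
rewrite /=.
under eq_bigr => a _ do under eq_bigr => b _ do rewrite mulmxDr mxtraceD mulrDr !mulmxA.
under eq_bigr => a _ do rewrite big_split/=.
rewrite big_split/= (le_trans (cmodD _ _))// mulSn natrD lerD//; last first.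
  exact: (IH _ (unitarymxM uC (letter_mx_unitary uu x)) uG).
have trE (A B : M) a b : \tr (A *m delta_mx a b *m B) = (B *m A) b a.
  rewrite mxtrace_mulC mulmxA /mxtrace (bigD1 b)//= [X in _ + X]big1 ?addr0.
    rewrite mxE (bigD1 a)//= [X in _ + X]big1 ?addr0 ?mxE ?eqxx ?mulr1//.
    by move=> k ka; rewrite !mxE (negbTE ka) mulr0.
  move=> k kb; rewrite mxE big1// => l _.
  by rewrite !mxE (negbTE kb) andbF mulr0.
have sumE (A B : M) : A \is unitarymx -> B \is unitarymx ->
    cmod (\sum_a \sum_b G a b * \tr (A *m delta_mx a b *m B)) <= N%:R.
  move=> uA uB.
  rewrite (_ : \sum_a _ = \tr (G *m (B *m A))).
    exact: (unitarymx_trace (unitarymxM uG (unitarymxM uB uA))).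
  by apply: eq_bigr => a _; rewrite mxE; apply: eq_bigr => b _; rewrite trE.
rewrite /dletter; case: eqP => [_|_]; last first.
  rewrite big1 ?cmod0// => a _; rewrite big1// => b _.
  by rewrite mulmx0 mul0mx mxtrace0 mulr0.
case: x.2.
  under eq_bigr => a _ do under eq_bigr => b _ do rewrite mulmxA -mulmxA.
  exact: (sumE _ _ uC (unitarymxM (uu j) (word_mx_unitary uu w))).
under eq_bigr => a _ do under eq_bigr => b _ do
  rewrite mulmxN mulNmx mulmxA (raddfN (@mxtrace _ N)) mulrN.
under eq_bigr => a _ do rewrite sumrN.
have uaj : adjmx (u j) \is unitarymx := adjmx_unitary (uu j).
by rewrite sumrN cmodN; exact: (sumE _ _ (unitarymxM uC uaj) (word_mx_unitary uu w)).
Qed.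

End WordMatrices.

(** * Invariance of the joint law *)

Section BoundedRandomVariables.
Context {R : realType} {disp : measure_display} {T : measurableType disp}.
Variable P : probability T R.
Implicit Types (X Y : T -> R) (Z : T -> R[i]).

Definition bounded_rv X :=
  measurable_fun setT X /\ exists K : R, forall w, `|X w| <= K.

Definition cmeasurable Z :=
  measurable_fun setT (fun w => complex.Re (Z w)) /\
  measurable_fun setT (fun w => complex.Im (Z w)).

Definition Ex X : R := Rintegral P setT X.

Lemma bounded_rv_integrable X : bounded_rv X -> P.-integrable setT (EFin \o X).
Proof.
move=> [mX [K XK]]; apply: measurable_bounded_integrable => //.
  by rewrite (le_lt_trans (probability_le1 P measurableT))// ltry.
exists K; split; first exact: num_real.
by move=> r Kr w _ /=; rewrite (le_trans (XK w))// ltW.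
Qed.

Lemma bounded_rv_cst (k : R) : bounded_rv (fun=> k).
Proof. by split; [exact: measurable_cst|exists `|k|]. Qed.

Lemma bounded_rvD X Y : bounded_rv X -> bounded_rv Y ->
  bounded_rv (fun w => X w + Y w).
Proof.
move=> [mX [K XK]] [mY [L YL]]; split; first exact: measurable_funD.
by exists (K + L) => w; rewrite (le_trans (ler_normD _ _))// lerD.
Qed.

Lemma bounded_rvN X : bounded_rv X -> bounded_rv (fun w => - X w).
Proof.
move=> [mX [K XK]]; split; first exact: measurableT_comp.
by exists K => w; rewrite normrN.
Qed.

Lemma bounded_rvB X Y : bounded_rv X -> bounded_rv Y ->
  bounded_rv (fun w => X w - Y w).
Proof. by move=> bX bY; apply: bounded_rvD => //; exact: bounded_rvN. Qed.

Lemma bounded_rvM X Y : bounded_rv X -> bounded_rv Y ->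
  bounded_rv (fun w => X w * Y w).
Proof.
move=> [mX [K XK]] [mY [L YL]]; split; first exact: measurable_funM.
by exists (K * L) => w; rewrite normrM ler_pM.
Qed.

Lemma bounded_rvZ (k : R) X : bounded_rv X -> bounded_rv (fun w => k * X w).
Proof. by move=> bX; apply: bounded_rvM => //; exact: bounded_rv_cst. Qed.

Lemma bounded_rv_norm X : bounded_rv X -> bounded_rv (fun w => `|X w|).
Proof.
move=> [mX [K XK]]; split; first exact: measurableT_comp.
by exists K => w; rewrite normr_id.
Qed.

Lemma bounded_rv_sum (I : Type) (r : seq I) (F : I -> T -> R) :
  (forall i, bounded_rv (F i)) -> bounded_rv (fun w => \sum_(i <- r) F i w).
Proof.
move=> bF; elim: r => [|i r IH].
  by under eq_fun do rewrite big_nil; exact: bounded_rv_cst.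
by under eq_fun do rewrite big_cons; exact: bounded_rvD.
Qed.

Lemma Ex_cst (k : R) : Ex (fun=> k) = k.
Proof.
have PT : fine (P setT) = 1 by rewrite probability_setT.
have /= h := @Rintegral_cst _ T R P setT measurableT k.
by rewrite /Ex h PT mulr1.
Qed.

Lemma ExD X Y : bounded_rv X -> bounded_rv Y ->
  Ex (fun w => X w + Y w) = Ex X + Ex Y.
Proof.
by move=> /(bounded_rv_integrable) bX /bounded_rv_integrable bY;
   exact: (RintegralD measurableT bX bY).
Qed.

Lemma ExB X Y : bounded_rv X -> bounded_rv Y ->
  Ex (fun w => X w - Y w) = Ex X - Ex Y.
Proof.
by move=> /(bounded_rv_integrable) bX /bounded_rv_integrable bY;
   exact: (RintegralB measurableT bX bY).
Qed.

Lemma ExZ (k : R) X : bounded_rv X -> Ex (fun w => k * X w) = k * Ex X.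
Proof. by move=> /bounded_rv_integrable bX; by have := RintegralZl k measurableT bX. Qed.

Lemma Ex_le X Y : bounded_rv X -> bounded_rv Y -> (forall w, X w <= Y w) ->
  Ex X <= Ex Y.
Proof.
move=> /bounded_rv_integrable bX /bounded_rv_integrable bY XY.
by apply: (le_Rintegral measurableT bX bY) => w _; exact: XY.
Qed.

Lemma Ex_norm X : bounded_rv X -> `|Ex X| <= Ex (fun w => `|X w|).
Proof. by move=> /bounded_rv_integrable bX; exact: (le_normr_Rintegral measurableT bX). Qed.

Lemma Ex_sum (I : Type) (r : seq I) (F : I -> T -> R) :
  (forall i, bounded_rv (F i)) ->
  Ex (fun w => \sum_(i <- r) F i w) = \sum_(i <- r) Ex (F i).
Proof.
move=> bF; elim: r => [|i r IH].
  by under eq_fun do rewrite big_nil; rewrite Ex_cst big_nil.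
under eq_fun do rewrite big_cons; rewrite big_cons ExD ?IH//.
exact: bounded_rv_sum.
Qed.

Lemma ReM (z z' : R[i]) : complex.Re (z * z') =
  complex.Re z * complex.Re z' - complex.Im z * complex.Im z'.
Proof. by case: z z' => a b []. Qed.

Lemma ImM (z z' : R[i]) : complex.Im (z * z') =
  complex.Re z * complex.Im z' + complex.Im z * complex.Re z'.
Proof. by case: z z' => a b []. Qed.

Lemma cmeasurable_cst (k : R[i]) : cmeasurable (fun=> k).
Proof. by split; exact: measurable_cst. Qed.

Lemma cmeasurableD Z Z' : cmeasurable Z -> cmeasurable Z' ->
  cmeasurable (fun w => Z w + Z' w).
Proof.
by move=> [a b] [a' b']; split; under eq_fun do rewrite raddfD/=; exact: measurable_funD.
Qed.

Lemma cmeasurableM Z Z' : cmeasurable Z -> cmeasurable Z' ->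
  cmeasurable (fun w => Z w * Z' w).
Proof.
move=> [a b] [a' b']; split.
  by under eq_fun do rewrite ReM; apply: measurable_funB; exact: measurable_funM.
by under eq_fun do rewrite ImM; apply: measurable_funD; exact: measurable_funM.
Qed.

Lemma cmeasurable_conj Z : cmeasurable Z -> cmeasurable (fun w => Num.conj (Z w)).
Proof.
move=> [a b]; split; first by under eq_fun do rewrite cRe_conj.
by under eq_fun do rewrite cIm_conj; exact: measurableT_comp.
Qed.

Lemma measurable_cmod Z : cmeasurable Z -> measurable_fun setT (fun w => cmod (Z w)).
Proof.
move=> mZ; have [m _] := cmeasurableM mZ (cmeasurable_conj mZ).
rewrite (_ : (fun w => cmod (Z w)) =
    Num.sqrt \o (fun w => complex.Re (Z w * Num.conj (Z w)))).
  apply: measurableT_comp m; apply: continuous_measurable_fun.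
  exact: sqrt_continuous.
by apply/funext => w /=; rewrite Re_mul_conj sqrtr_sqr ger0_norm ?cmod_ge0.
Qed.

End BoundedRandomVariables.

Section BorelMatrices.
Context {R : realType} {N : nat}.
Local Notation M := 'M[R[i]]_N.

Lemma Re_continuous : continuous (@complex.Re R : R[i]^o -> R).
Proof.
move=> z A /nbhs_ballP[e /= e0 zA]; apply/nbhs_ballP.
exists e%:C => /=; first by rewrite ltcR.
move=> y; rewrite -ball_normE /ball_/= cmodE ltcR => zy; apply: zA.
rewrite -ball_normE /ball_/= -raddfB; apply: le_lt_trans zy.
exact: normr_Re_le_cmod.
Qed.

Lemma Im_continuous : continuous (@complex.Im R : R[i]^o -> R).
Proof.
move=> z A /nbhs_ballP[e /= e0 zA]; apply/nbhs_ballP.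
exists e%:C => /=; first by rewrite ltcR.
move=> y; rewrite -ball_normE /ball_/= cmodE ltcR => zy; apply: zA.
rewrite -ball_normE /ball_/= -raddfB; apply: le_lt_trans zy.
exact: normr_Im_le_cmod.
Qed.

Lemma borel_mx_open (O : set 'M[R[i]^o]_N) : open O -> borel_mx O.
Proof. exact: sub_sigma_algebra. Qed.

Lemma borel_mxT : borel_mx ([set: 'M[R[i]]_N]).
Proof. by apply: (@borel_mx_open setT); exact: openT. Qed.

Lemma borel_mxI (B C : set M) : borel_mx B -> borel_mx C -> borel_mx (B `&` C).
Proof.
exact: (@measurableI _ (g_sigma_algebraType (@open 'M[R[i]^o]_N)) B C).
Qed.

Lemma borel_mx_entry (p : R[i]^o -> R) (a b : 'I_N) (O : set R) :
  continuous p -> open O -> borel_mx [set A : 'M[R[i]]_N | O (p (A a b))].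
Proof.
move=> cp oO; apply: borel_mx_open.
have c : continuous (fun A : 'M[R[i]^o]_N => p (A a b)).
  by move=> A; apply: continuous_comp; [exact: coord_continuous|exact: cp].
by move/continuousP: c; apply.
Qed.

Lemma continuous_near (f : 'M[R[i]^o]_N -> R[i]^o) (A : 'M[R[i]^o]_N)
  (S : set R[i]^o) : continuous f -> nbhs (f A) S -> \forall B \near A, S (f B).
Proof. by move=> cf; exact: (cf A S). Qed.

Lemma continuous_near_ball (f : 'M[R[i]^o]_N -> R[i]^o) (A : 'M[R[i]^o]_N)
  (e : R[i]) : continuous f -> 0 < e -> \forall B \near A, ball (f A) e (f B).
Proof.
by move=> cf e0; apply: continuous_near => //; apply/nbhs_ballP; exists e.
Qed.

Lemma mulmx_continuous (V : M) : continuous (mulmx V : 'M[R[i]^o]_N -> 'M[R[i]^o]_N).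
Proof.
move=> A S /nbhs_ballP[e /= e0 AS].
have near_entry (ij : 'I_N * 'I_N) : \forall B \near (A : 'M[R[i]^o]_N),
    ball ((V *m A) ij.1 ij.2 : R[i]^o) e ((V *m B) ij.1 ij.2).
  have c : continuous (fun B : 'M[R[i]^o]_N => (V *m B) ij.1 ij.2 : R[i]^o).
    have cM k : continuous (fun B : 'M[R[i]^o]_N => V ij.1 k * B k ij.2 : R[i]^o).
      move=> B; apply: (@continuous_comp _ R[i]^o R[i]^o
        (fun B : 'M[R[i]^o]_N => B k ij.2) ( *%R (V ij.1 k))).
        exact: coord_continuous.
      exact: (@mulrl_continuous R[i] (V ij.1 k)).
    under eq_fun do rewrite mxE.
    by apply: continuous_big => // ; exact: add_continuous.
  exact: (continuous_near_ball A c e0).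
have H := filter_forall (@nbhs_filter _ A) near_entry.
have {}AS (B : 'M[R[i]^o]_N) : (forall ij : 'I_N * 'I_N,
    ball ((V *m A) ij.1 ij.2 : R[i]^o) e ((V *m B) ij.1 ij.2)) -> S (V *m B).
  by move=> AB; apply: AS; split=> // i j; exact: (AB (i, j)).
exact: (filterS AS H).
Qed.

(** The sets with Borel preimage under multiplication by [V] form a sigma-algebra that contains the
    open sets. *)
Lemma borel_mx_mull (V : M) (B : set M) : borel_mx B ->
  borel_mx [set A | B (V *m A)].
Proof.
move=> bB; apply: (bB [set C | borel_mx [set A | C (V *m A)]]); split.
  split=> [|C bC|F bF].
  - exact: sigma_algebra0.
  - by rewrite setTD; exact: sigma_algebraC bC.
  - exact: (@sigma_algebra_bigcup _ setT _ (fun n => [set A | F n (V *m A)]) bF).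
move=> O oO; apply: borel_mx_open.
by have /continuousP := @mulmx_continuous V; apply.
Qed.

End BorelMatrices.

Section MatrixTuples.
Context {R : realType} {d N : nat}.
Local Notation M := 'M[R[i]]_N.

(** Independence speaks of rectangles only. They form a pi-system that generates the sigma-algebra
    of [mx_tuple], so they determine the joint law. *)
Definition borel_rect : set (set ('I_d -> M)) :=
  [set A | exists2 B : 'I_d -> set M, (forall j, borel_mx (B j)) &
           A = \bigcap_j [set u | B j (u j)]].

Definition mx_tuple :=
  g_sigma_algebraType (borel_rect : set (set ('I_d -> 'M[R[i]^o]_N))).
HB.instance Definition _ := Measurable.on mx_tuple.

Lemma borel_rectI : setI_closed borel_rect.
Proof.
move=> _ _ [B bB ->] [C bC ->]; exists (fun j => B j `&` C j).
  by move=> j; apply: borel_mxI.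
by rewrite -bigcapI; apply: eq_bigcap.
Qed.

Lemma borel_rectT : borel_rect setT.
Proof.
exists (fun=> setT) => [j|]; first exact: borel_mxT.
by apply/esym/seteqP; split.
Qed.

Lemma bounded_entry_measurable (p : R[i]^o -> R) (j : 'I_d) (a b : 'I_N) :
  continuous p -> measurable_fun setT (fun u : mx_tuple => p (u j a b)).
Proof.
move=> cp; apply: (measurability _ (RGenOpens.measurableE R)).
move=> _ [_ [x [y ->] <-]]; rewrite setTI; apply: sub_sigma_algebra.
exists (fun i => if i == j then [set A : M | `]x, y[%classic (p (A a b))] else setT).
  move=> i; case: ifP => _; last exact: borel_mxT.
  exact: (borel_mx_entry _ _ cp (@interval_open _ _ _ _ _)).
apply/seteqP; split => u /=.
  by move=> ux i _ /=; case: eqP => [->|].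
by move=> /(_ j I) /=; rewrite eqxx.
Qed.

End MatrixTuples.

Section Invariance.
Context {R : realType} {d N : nat}.
Context {disp : measure_display} {T : measurableType disp}.
Variables (P : probability T R) (U : 'I_d -> T -> 'M[R[i]]_N).
Hypothesis haarU : forall j, haar_unitary P (U j).
Hypothesis indepU : mutually_independent P U.
Local Notation M := 'M[R[i]]_N.
Implicit Types (V : M) (j : 'I_d).

Definition translate V j (u : 'I_d -> M) : 'I_d -> M :=
  fun i => if i == j then V *m u i else u i.

Definition tuple_rv (w : T) : mx_tuple := fun i => U i w.

Lemma tuple_rv_unitary w i : tuple_rv w i \is unitarymx.
Proof. by have [_ h _] := haarU i; exact: h. Qed.

Lemma translate_unitary V j (u : 'I_d -> M) : V \is unitarymx ->
  (forall i, u i \is unitarymx) -> forall i, translate V j u i \is unitarymx.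
Proof.
move=> uV uu i; rewrite /translate.
by case: (i == j); [exact: (unitarymxM uV (uu i))|exact: uu].
Qed.

Lemma tuple_rv_measurable : measurable_fun setT tuple_rv.
Proof.
apply: (@measurability _ _ _ mx_tuple _ _ borel_rect erefl) => _ [_ [B bB ->] <-].
rewrite setTI preimage_bigcap; apply: fin_bigcap_measurable; first exact: finite_finset.
by move=> i _; have [h _ _] := haarU i; exact: h.
Qed.

Lemma translate_measurable V j : measurable_fun setT (fun w => translate V j (tuple_rv w) : mx_tuple).
Proof.
apply: (@measurability _ _ _ mx_tuple _ _ borel_rect erefl) => _ [_ [B bB ->] <-].
rewrite setTI preimage_bigcap; apply: fin_bigcap_measurable; first exact: finite_finset.
move=> i _; have [h _ _] := haarU i.
rewrite /translate /preimage /=; case: (i == j); last exact: h.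
exact: h (borel_mx_mull V (bB i)).
Qed.

(** By uniqueness of measures on a pi-system it suffices to test rectangles; there the probability
    factors, and only the factor [j] is affected, where Haar invariance applies. *)
Lemma law_translate V j (A : set mx_tuple) : V \is unitarymx -> measurable A ->
  P (tuple_rv @^-1` A) = P [set w | A (translate V j (tuple_rv w))].
Proof.
move=> uV mA.
pose f1 : {mfun T >-> mx_tuple} := mfun_Sub (mem_set tuple_rv_measurable).
pose f2 : {mfun T >-> mx_tuple} := mfun_Sub (mem_set (translate_measurable V j)).
suff : pushforward P f1 A = pushforward P f2 A by [].
apply: (@measure_unique _ R mx_tuple borel_rect (fun=> setT)) => //.
- exact: borel_rectI.
- by move=> _; exact: borel_rectT.
- by rewrite bigcup_const//; exists 0%N.
- move=> _ [B bB ->] /=.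
  pose C i := if i == j then [set D | B i (V *m D)] else B i.
  have bC i : borel_mx (C i).
    by rewrite /C; case: eqP => _ //; exact: borel_mx_mull.
  transitivity (P (\bigcap_i (U i @^-1` B i))).
    by congr (P _); apply/seteqP; split.
  transitivity (P (\bigcap_i (U i @^-1` C i))); last first.
    congr (P _); apply/seteqP; split => w /= h i _; have := h i I;
      by rewrite /= /translate /C; case: eqP.
  rewrite !indepU//; apply: eq_bigr => i _; rewrite /C; case: eqP => // _.
  by have [_ _ h] := haarU i; rewrite -(h V).
- move=> _; apply: (@le_lt_trans _ _ 1%E); last exact: ltry.
  exact: (probability_le1 P measurableT).
Qed.

Lemma Ex_translate (X : mx_tuple -> R) V j : V \is unitarymx ->
  measurable_fun setT X ->
  (exists K, forall u, (forall i, u i \is unitarymx) -> `|X u| <= K) ->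
  Ex P (fun w => X (translate V j (tuple_rv w))) = Ex P (fun w => X (tuple_rv w)).
Proof.
move=> uV mX [K XK]; rewrite /Ex /Rintegral; congr fine.
have b1 : bounded_rv (fun w => X (tuple_rv w)).
  split; first exact: (measurableT_comp mX tuple_rv_measurable).
  by exists K => w; apply: XK => i; exact: tuple_rv_unitary.
have b2 : bounded_rv (fun w => X (translate V j (tuple_rv w))).
  split; first exact: (measurableT_comp mX (translate_measurable V j)).
  exists K => w; apply: XK => i.
  exact: (translate_unitary j uV (tuple_rv_unitary w) i).
pose f1 : {mfun T >-> mx_tuple} := mfun_Sub (mem_set tuple_rv_measurable).
pose f2 : {mfun T >-> mx_tuple} := mfun_Sub (mem_set (translate_measurable V j)).
have mE : measurable_fun setT (EFin \o X) by exact/measurable_EFinP.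
have := integral_pushforward tuple_rv_measurable mE (bounded_rv_integrable P b1) measurableT.
have := integral_pushforward (translate_measurable V j) mE (bounded_rv_integrable P b2) measurableT.
rewrite !preimage_setT => <- <-.
apply: (eq_measure_integral (pushforward P f1)).
  exact: (translate_measurable V j).
by move=> mt A mA _; exact: (esym (law_translate j uV mA)).
Qed.

End Invariance.

(** * The loop equation *)

Section RegularFunctions.
Context {R : realType} {d N : nat}.
Local Notation M := 'M[R[i]]_N.
Local Notation E := (@mx_tuple R d N).
Implicit Types (G : E -> R[i]) (u : E).

(** Entries are bounded on unitary tuples only, and the random tuple takes no other values. The
    class is stable under polynomial operations and makes all expectations finite. *)
Definition regular G := cmeasurable G /\
  exists K : R, forall u : E, (forall i, u i \is unitarymx) -> cmod (G u) <= K.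

Lemma regular_cst (k : R[i]) : regular (fun=> k).
Proof. by split; [exact: cmeasurable_cst|exists (cmod k)]. Qed.

Lemma regularD G H : regular G -> regular H -> regular (fun u => G u + H u).
Proof.
move=> [mG [K GK]] [mH [L HL]]; split; first exact: cmeasurableD.
exists (K + L) => u uu; apply: le_trans (cmodD _ _) _.
by apply: lerD; [exact: GK|exact: HL].
Qed.

Lemma regularM G H : regular G -> regular H -> regular (fun u => G u * H u).
Proof.
move=> [mG [K GK]] [mH [L HL]]; split; first exact: cmeasurableM.
exists (K * L) => u uu; rewrite cmodM; apply: ler_pM; rewrite ?cmod_ge0//.
  exact: GK.
exact: HL.
Qed.

Lemma regular_conj G : regular G -> regular (fun u => Num.conj (G u)).
Proof.
move=> [mG [K GK]]; split; first exact: cmeasurable_conj.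
by exists K => u uu; rewrite cmod_conj; exact: GK.
Qed.

Lemma regular_ext G H : regular G -> H =1 G -> regular H.
Proof. by move=> rG /funext ->. Qed.

Lemma regularN G : regular G -> regular (fun u => - G u).
Proof.
move=> rG; apply: (regular_ext (regularM (regular_cst (-1)) rG)) => u.
by rewrite mulN1r.
Qed.

Lemma regular_sum (I : Type) (r : seq I) (F : I -> E -> R[i]) :
  (forall i, regular (F i)) -> regular (fun u => \sum_(i <- r) F i u).
Proof.
move=> rF; elim: r => [|i r IH].
  by apply: (regular_ext (regular_cst 0)) => u; rewrite big_nil.
by apply: (regular_ext (regularD (rF i) IH)) => u; rewrite big_cons.
Qed.

Lemma regular_entry j a b : regular (fun u => u j a b).
Proof.
split.
  split; first exact: (bounded_entry_measurable _ _ _ Re_continuous).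
  exact: (bounded_entry_measurable _ _ _ Im_continuous).
by exists 1 => u uu; exact: (unitarymx_entry _ _ (uu j)).
Qed.

Definition regular_mx (A : E -> M) := forall a b, regular (fun u => A u a b).

Lemma regular_mx_cst (A : M) : regular_mx (fun=> A).
Proof. by move=> a b; exact: regular_cst. Qed.

Lemma regular_mxM (A B : E -> M) : regular_mx A -> regular_mx B ->
  regular_mx (fun u => A u *m B u).
Proof.
move=> rA rB a b.
apply: (regular_ext (regular_sum (index_enum 'I_N) (fun k => regularM (rA a k) (rB k b)))).
by move=> u; rewrite mxE.
Qed.

Lemma regular_mxD (A B : E -> M) : regular_mx A -> regular_mx B ->
  regular_mx (fun u => A u + B u).
Proof.
by move=> rA rB a b; apply: (regular_ext (regularD (rA a b) (rB a b))) => u; rewrite mxE.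
Qed.

Lemma regular_mx_adj (A : E -> M) : regular_mx A -> regular_mx (fun u => adjmx (A u)).
Proof.
by move=> rA a b; apply: (regular_ext (regular_conj (rA b a))) => u; rewrite adjmxE.
Qed.

Lemma regular_tr (A : E -> M) : regular_mx A -> regular (fun u => \tr (A u)).
Proof. by move=> rA; apply: regular_sum => k; exact: rA. Qed.

Lemma regular_letter x : regular_mx (fun u : E => letter_mx u x).
Proof.
rewrite /letter_mx; case: x.2; first by move=> a b; exact: regular_entry.
by apply: regular_mx_adj => a b; exact: regular_entry.
Qed.

Lemma regular_word w : regular_mx (fun u : E => word_mx u w).
Proof.
elim: w => [|x w IH]; first exact: regular_mx_cst.
exact: regular_mxM (regular_letter x) IH.
Qed.

Lemma regular_dletter j X x : regular_mx (fun u : E => dletter j X u x).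
Proof.
rewrite /dletter; case: (x.1 == j); last exact: regular_mx_cst.
case: x.2.
  apply: regular_mxM; first exact: regular_mx_cst.
  by move=> a b; exact: regular_entry.
have r : regular_mx (fun u : E => adjmx (u j) *m X).
  apply: regular_mxM; last exact: regular_mx_cst.
  by apply: regular_mx_adj => a b; exact: regular_entry.
by move=> a b; apply: (regular_ext (regularN (r a b))) => u; rewrite mxE.
Qed.

Lemma regular_dword j X w : regular_mx (fun u : E => dword j X u w).
Proof.
elim: w => [|x w IH]; first exact: regular_mx_cst.
apply: regular_mxD; apply: regular_mxM => //.
- exact: regular_dletter.
- exact: regular_word.
- exact: regular_letter.
Qed.

End RegularFunctions.

(** * First-order expansions along curves of unitaries *)

Section Expansions.
Context {R : realType} {d N : nat}.
Local Notation M := 'M[R[i]]_N.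
Local Notation E := ('I_d -> M).
Implicit Types (t : R) (u : E).

(* First-order Taylor expansion at t = 0, uniform over tuples of unitaries. *)
Definition expands (F : R -> E -> R[i]) (F0 F1 : E -> R[i]) := exists2 K : R, 0 <= K &
  forall t u, `|t| <= 1 -> (forall i, u i \is unitarymx) ->
  [/\ cmod (F t u - F0 u - t%:C * F1 u) <= K * t ^+ 2,
      cmod (F0 u) <= K & cmod (F1 u) <= K].

Lemma expands_cst (F0 : E -> R[i]) (K : R) :
  (forall u, (forall i, u i \is unitarymx) -> cmod (F0 u) <= K) ->
  expands (fun=> F0) F0 (fun=> 0).
Proof.
move=> F0K; exists `|K| => // t u _ uu.
rewrite subrr mulr0 subrr cmod0; split=> //.
  by rewrite mulr_ge0// sqr_ge0.
by rewrite (le_trans (F0K _ uu))// ler_norm.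
Qed.

Lemma expandsD F F0 F1 G G0 G1 : expands F F0 F1 -> expands G G0 G1 ->
  expands (fun t u => F t u + G t u) (fun u => F0 u + G0 u) (fun u => F1 u + G1 u).
Proof.
move=> [K K0 FK] [L L0 GL]; exists (K + L); first exact: addr_ge0.
move=> t u t1 uu; have [f f0 f1] := FK t u t1 uu; have [g g0 g1] := GL t u t1 uu.
split; last 2 first.
- by rewrite (le_trans (cmodD _ _))// lerD.
- by rewrite (le_trans (cmodD _ _))// lerD.
rewrite (_ : _ - _ = (F t u - F0 u - t%:C * F1 u) + (G t u - G0 u - t%:C * G1 u)).
  by rewrite mulrDl (le_trans (cmodD _ _))// lerD.
by ring.
Qed.

Lemma expandsM F F0 F1 G G0 G1 : expands F F0 F1 -> expands G G0 G1 ->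
  expands (fun t u => F t u * G t u) (fun u => F0 u * G0 u)
    (fun u => F0 u * G1 u + F1 u * G0 u).
Proof.
move=> [K K0 FK] [L L0 GL]; have KL : 0 <= K * L by rewrite mulr_ge0.
exists (6 * (K * L)); first by rewrite mulr_ge0.
move=> t u t1 uu; have [f f0 f1] := FK t u t1 uu; have [g g0 g1] := GL t u t1 uu.
have t2 : t ^+ 2 <= 1 by rewrite -real_normK ?num_real// expr_le1.
have t20 : 0 <= t ^+ 2 by rewrite sqr_ge0.
have mulle (x y : R[i]) (k l : R) : cmod x <= k -> cmod y <= l -> cmod (x * y) <= k * l.
  by move=> xk yl; rewrite cmodM ler_pM// cmod_ge0.
have tc : cmod t%:C <= 1 by rewrite cmod_real.
split; last 2 first.
- by apply: le_trans (mulle _ _ _ _ f0 g0) _; lra.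
- apply: le_trans (cmodD _ _) _.
  by have := mulle _ _ _ _ f0 g1; have := mulle _ _ _ _ f1 g0; lra.
rewrite (_ : _ - _ = (F t u - F0 u - t%:C * F1 u) *
    (G0 u + t%:C * G1 u + (G t u - G0 u - t%:C * G1 u))
  + (F0 u + t%:C * F1 u) * (G t u - G0 u - t%:C * G1 u)
  + (t ^+ 2)%:C * (F1 u * G1 u)); last first.
  by rewrite rmorphXn/=; ring.
have hG : cmod (G0 u + t%:C * G1 u + (G t u - G0 u - t%:C * G1 u)) <= 3 * L.
  apply: le_trans (cmodD _ _) _; apply: le_trans (lerD (cmodD _ _) g) _.
  have := mulle _ _ _ _ tc g1; rewrite mul1r => h.
  have : L * t ^+ 2 <= L by rewrite ler_piMr.
  lra.
have hF : cmod (F0 u + t%:C * F1 u) <= 2 * K.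
  apply: le_trans (cmodD _ _) _.
  by have := mulle _ _ _ _ tc f1; rewrite mul1r; lra.
apply: le_trans (cmodD _ _) _; apply: le_trans (lerD (cmodD _ _) (lexx _)) _.
have h1 := mulle _ _ _ _ f hG; have h2 := mulle _ _ _ _ hF g.
have h3 : cmod (t ^+ 2)%:C <= t ^+ 2 by rewrite cmod_real ger0_norm.
have h4 := mulle _ _ _ _ h3 (mulle _ _ _ _ f1 g1).
apply: le_trans (lerD (lerD h1 h2) h4) _.
by rewrite le_eqVlt; apply/orP; left; apply/eqP; ring.
Qed.

Lemma expands_conj F F0 F1 : expands F F0 F1 ->
  expands (fun t u => Num.conj (F t u)) (fun u => Num.conj (F0 u))
    (fun u => Num.conj (F1 u)).
Proof.
move=> [K K0 FK]; exists K => // t u t1 uu; have [f f0 f1] := FK t u t1 uu.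
rewrite !cmod_conj; split=> //.
rewrite -cmod_conj !rmorphB rmorphM/= !conjCK (_ : Num.conj t%:C = t%:C)//.
by rewrite -[LHS]/(conjc _) conjc_real.
Qed.

Lemma expands_sum (I : Type) (r : seq I) (F : I -> R -> E -> R[i])
    (F0 F1 : I -> E -> R[i]) : (forall i, expands (F i) (F0 i) (F1 i)) ->
  expands (fun t u => \sum_(i <- r) F i t u) (fun u => \sum_(i <- r) F0 i u)
    (fun u => \sum_(i <- r) F1 i u).
Proof.
move=> eF; elim: r => [|i r [K K0 IH]].
  exists 0 => // t u _ _; rewrite !big_nil; split; rewrite ?cmod0//.
  by rewrite mulr0 !subr0 mul0r cmod0.
have [L L0 h] := expandsD (eF i) (ex_intro2 _ _ K K0 IH).
by exists L => // t u t1 uu; rewrite !big_cons; exact: h.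
Qed.

Lemma expands_ext F F0 F1 G (G0 G1 : E -> R[i]) : expands F F0 F1 ->
  (forall t u, G t u = F t u) -> F0 =1 G0 -> F1 =1 G1 -> expands G G0 G1.
Proof.
move=> [K K0 FK] e e0 e1; exists K => // t u t1 uu.
by rewrite e -e0 -e1; exact: FK.
Qed.

Definition expands_mx (A : R -> E -> M) (A0 A1 : E -> M) :=
  forall a b, expands (fun t u => A t u a b) (fun u => A0 u a b) (fun u => A1 u a b).

Lemma expands_mxM A A0 A1 B B0 B1 : expands_mx A A0 A1 -> expands_mx B B0 B1 ->
  expands_mx (fun t u => A t u *m B t u) (fun u => A0 u *m B0 u)
    (fun u => A0 u *m B1 u + A1 u *m B0 u).
Proof.
move=> eA eB a b.
apply: (expands_ext (expands_sum (index_enum 'I_N) (fun k => expandsM (eA a k) (eB k b)))).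
- by move=> t u; rewrite mxE.
- by move=> u; rewrite mxE.
- by move=> u; rewrite !mxE -big_split.
Qed.

Lemma expands_mx_adj A A0 A1 : expands_mx A A0 A1 ->
  expands_mx (fun t u => adjmx (A t u)) (fun u => adjmx (A0 u)) (fun u => adjmx (A1 u)).
Proof.
move=> eA a b; apply: (expands_ext (expands_conj (eA b a))) => [t u|u|u];
  by rewrite /adjmx !mxE.
Qed.

End Expansions.

Section RankOnePerturbation.
Context {R : realType} {d N : nat}.
Local Notation M := 'M[R[i]]_N.
Variable v : 'I_N -> R[i].

Definition rank_one : M := \matrix_(a, b) (v a * Num.conj (v b)).

Let n : R := \sum_a sqmod (v a).

(* The Cayley parametrization 2it / (1 - itn), for which 1 + cayley t * vv^* is
   unitary. *)
Definition cayley (t : R) : R[i] :=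
  (- (2 * t ^+ 2 * n) / (1 + (t * n) ^+ 2)) +i* (2 * t / (1 + (t * n) ^+ 2)).

(** A rational curve of unitaries through 1 whose velocity at 0 is 2i times a rank-one projection up
    to scale. Such directions span all matrices over the complex numbers, so no matrix exponential
    is called for. *)
Definition perturb (t : R) : M := 1%:M + cayley t *: rank_one.

Let n_ge0 : 0 <= n. Proof. by apply: sumr_ge0 => a _; exact: sqmod_ge0. Qed.

Let den_gt0 t : 0 < 1 + (t * n) ^+ 2.
Proof. by rewrite ltr_pwDl// sqr_ge0. Qed.

Lemma adjmx_rank_one : adjmx rank_one = rank_one.
Proof. by apply/matrixP => a b; rewrite adjmxE !mxE rmorphM/= conjCK mulrC. Qed.

Lemma rank_one_sqr : rank_one *m rank_one = n%:C *: rank_one.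
Proof.
apply/matrixP => a b; rewrite !mxE /n rmorph_sum/= mulr_suml.
apply: eq_bigr => k _; rewrite !mxE -sqmodE.
by rewrite -[Num.conj (v k)]/(conjc _); ring.
Qed.

Lemma cayley_eq t :
  cayley t + Num.conj (cayley t) + cayley t * Num.conj (cayley t) * n%:C = 0.
Proof.
rewrite -[Num.conj _]/(conjc _) /cayley /=; simpc.
have dn := lt0r_neq0 (den_gt0 t).
by congr (_ +i* _); field.
Qed.

Lemma perturb_unitary t : perturb t \is unitarymx.
Proof.
apply/unitarymxP; rewrite -/(adjmx _) /perturb.
have -> : adjmx (1%:M + cayley t *: rank_one) =
    1%:M + Num.conj (cayley t) *: rank_one.
  by rewrite adjmxD adjmxZ adjmx1 adjmx_rank_one.
rewrite mulmxDl !mulmxDr !mul1mx mulmx1 -scalemxAl -scalemxAr scalerA.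
rewrite rank_one_sqr scalerA -!addrA -!scalerDl [X in X *: _](_ : _ = 0) ?scale0r ?addr0//.
by rewrite -(cayley_eq t); ring.
Qed.

Lemma cayley_expands : @expands R d N (fun t _ => cayley t) (fun=> 0) (fun=> 0 +i* 2).
Proof.
exists (2 + 2 * n + 2 * n ^+ 2); first by have := sqr_ge0 n; have := n_ge0; lra.
move=> t u t1 _; rewrite cmod0 subr0.
have n20 := sqr_ge0 n; have nn := n_ge0; split; last 2 first.
- by lra.
- rewrite /cmod /sqmod/= expr0n add0r sqrtr_sqr ger0_norm//; lra.
have cmod_le (x y : R) : cmod (x +i* y) <= `|x| + `|y|.
  rewrite /cmod /sqmod/= -[leRHS]ger0_norm ?addr_ge0// -sqrtr_sqr ler_wsqrtr//.
  rewrite sqrrD !real_normK ?num_real// lerD2r lerDl mulrn_wge0// mulr_ge0//.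
rewrite /cayley; simpc; apply: le_trans (cmod_le _ _) _.
have d0 := den_gt0 t; set D := 1 + _ in d0 *.
have D1 : 1 <= D by rewrite /D lerDl sqr_ge0.
have t20 := sqr_ge0 t.
have iD : D^-1 <= 1 by rewrite invf_le1.
have h1 : `|- (2 * t ^+ 2 * n) / D| <= 2 * n * t ^+ 2.
  rewrite (_ : - (2 * t ^+ 2 * n) / D = - (2 * n * t ^+ 2 * D^-1)); last by ring.
  have hn : 0 <= 2 * n * t ^+ 2 by rewrite mulr_ge0// mulr_ge0.
  by rewrite normrN ger0_norm ?ler_piMr// mulr_ge0// invr_ge0 ltW.
have h2 : `|2 * t / D - 2 * t| <= 2 * n ^+ 2 * t ^+ 2.
  rewrite (_ : 2 * t / D - 2 * t = - (2 * n ^+ 2 * t ^+ 2 * (t / D))); last first.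
    rewrite (_ : 2 * t / D - 2 * t = - (2 * t * (D - 1) / D)); last first.
      by field; rewrite gt_eqF.
    by rewrite {1}/D; field; rewrite gt_eqF.
  have hn : 0 <= 2 * n ^+ 2 * t ^+ 2 by rewrite mulr_ge0// mulr_ge0.
  rewrite normrN normrM [`|2 * _ * _|]ger0_norm// ler_piMr//.
  rewrite normrM [`|D^-1|]ger0_norm ?invr_ge0 ?(ltW d0)//.
  by rewrite mulr_ile1// invr_ge0 ltW.
rewrite -mulNr (mulrC t 2); apply: le_trans (lerD h1 h2) _; rewrite -mulrDl.
by rewrite ler_wpM2r//; lra.
Qed.

Implicit Types (j : 'I_d) (x : 'I_d * bool).

Lemma translate_expands j i : @expands_mx R d N
  (fun t u => translate (perturb t) j u i) (fun u => u i)
  (fun u => if i == j then (0 +i* 2) *: (rank_one *m u j) else 0).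
Proof.
have entry k a b : @expands R d N (fun _ u => u k a b) (fun u => u k a b) (fun=> 0).
  by apply: (@expands_cst _ _ _ _ 1) => u uu; exact: (unitarymx_entry _ _ (uu k)).
move=> a b; rewrite /translate; case: eqP => [->|_]; last first.
  by apply: (expands_ext (entry i a b)) => // u; rewrite mxE.
have cst (z : R[i]) : @expands R d N (fun _ _ => z) (fun=> z) (fun=> 0).
  by apply: (@expands_cst _ _ _ _ (cmod z)).
have e := expandsD (entry j a b) (expandsM cayley_expands
  (expands_sum (index_enum 'I_N) (fun k => expandsM (cst (rank_one a k)) (entry j k b)))).
apply: (expands_ext e) => [t u|u|u].
- by rewrite mulmxDl mul1mx -scalemxAl !mxE.
- by rewrite mul0r addr0.
- by rewrite mul0r !add0r !mxE.
Qed.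

Lemma letter_expands j x : @expands_mx R d N
  (fun t u => letter_mx (translate (perturb t) j u) x) (fun u => letter_mx u x)
  (fun u => (0 +i* 2) *: dletter j rank_one u x).
Proof.
case: x => i [] a b; rewrite /letter_mx /dletter /=.
  apply: (expands_ext (translate_expands j i a b)) => // u.
  by case: eqP; rewrite ?scaler0.
apply: (expands_ext (expands_mx_adj (translate_expands j i) a b)) => // u.
case: eqP => _; last by rewrite scaler0 /adjmx trmx0 map_mx0.
rewrite adjmxZ adjmxM adjmx_rank_one scalerN -scaleNr.
rewrite (_ : Num.conj (0 +i* 2) = - (0 +i* 2))//.
by rewrite -[LHS]/(conjc _); simpc.
Qed.

Lemma word_expands j w : @expands_mx R d N
  (fun t u => word_mx (translate (perturb t) j u) w) (fun u => word_mx u w)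
  (fun u => (0 +i* 2) *: dword j rank_one u w).
Proof.
elim: w => [|x w IH] a b.
  apply: (expands_ext (@expands_cst _ _ _ (fun=> (1%:M : M) a b) (cmod ((1%:M : M) a b)) _)) => //.
  by move=> u /=; rewrite scaler0 mxE.
apply: (expands_ext (expands_mxM (letter_expands j x) IH a b)) => // u /=.
by rewrite addrC scalerDr -scalemxAl -scalemxAr.
Qed.

Lemma word_trace_expands j w : @expands R d N
  (fun t u => \tr (word_mx (translate (perturb t) j u) w)) (fun u => \tr (word_mx u w))
  (fun u => (0 +i* 2) * \tr (dword j rank_one u w)).
Proof.
apply: (expands_ext (expands_sum (index_enum 'I_N) (fun a => word_expands j w a a))) => // u.
by rewrite /mxtrace mulr_sumr; apply: eq_bigr => a _; rewrite mxE.
Qed.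

End RankOnePerturbation.

(** * Second moments of traces of reduced words *)

Lemma sum_pow_le (R : realFieldType) (q : nat) :
  \sum_(1 <= l < q) 2 ^+ (q - l) * 32 ^+ l <= 32 ^+ q / 8 :> R.
Proof.
have p0 k : 0 <= 32 ^+ k :> R by rewrite exprn_ge0.
elim: q => [|[|q] IH]; [by rewrite big_geq// divr_ge0|by rewrite big_geq// divr_ge0|].
rewrite big_nat_recr//= subSnn expr1.
rewrite (_ : \sum_(1 <= l < q.+1) 2 ^+ (q.+2 - l) * 32 ^+ l =
    2 * \sum_(1 <= l < q.+1) 2 ^+ (q.+1 - l) * 32 ^+ l :> R).
  by have := p0 q.+1; rewrite (exprS _ q.+1); lra.
rewrite mulr_sumr !big_nat; apply: eq_bigr => l /andP[_ lq].
by rewrite subSn ?exprS ?mulrA// ltnW.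
Qed.

(** These are the weights put on |Tr w|^2 by the arithmetic-geometric inequality in [trace_step]. As
    they sum to at most 1/2, half of the leading term survives. *)
Lemma sum_half_le (R : realFieldType) (q : nat) :
  \sum_(1 <= l < q) 2^-1 ^+ (q - l).+1 <= 2^-1 :> R.
Proof.
elim: q => [|[|q] IH]; [by rewrite big_geq// invr_ge0|by rewrite big_geq// invr_ge0|].
rewrite big_nat_recr//= subSnn.
rewrite (_ : \sum_(1 <= l < q.+1) 2^-1 ^+ (q.+2 - l).+1 =
    2^-1 * \sum_(1 <= l < q.+1) 2^-1 ^+ (q.+1 - l).+1 :> R).
  by rewrite expr2; lra.
rewrite mulr_sumr !big_nat; apply: eq_bigr => l /andP[_ lq].
by rewrite subSn ?exprS// ltnW.
Qed.

Lemma cRe_sum (R : realType) (I : Type) (r : seq I) (F : I -> R[i]) :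
  complex.Re (\sum_(i <- r) F i) = \sum_(i <- r) complex.Re (F i).
Proof. exact: raddf_sum. Qed.

Section TraceBound.
Context {R : realType} {d N : nat}.
Context {disp : measure_display} {T : measurableType disp}.
Variables (P : probability T R) (U : 'I_d -> T -> 'M[R[i]]_N).
Hypothesis haarU : forall j, haar_unitary P (U j).
Hypothesis indepU : mutually_independent P U.
Local Notation M := 'M[R[i]]_N.
Local Notation E := (@mx_tuple R d N).
Local Notation tU := (tuple_rv U).

Let uU w := tuple_rv_unitary haarU w.

Lemma regular_bounded_Re (G : E -> R[i]) : regular G ->
  bounded_rv (fun w => complex.Re (G (tU w))).
Proof.
move=> [[mG _] [K GK]]; split.
  exact: (measurableT_comp mG (tuple_rv_measurable haarU)).
exists K => w; apply: le_trans (normr_Re_le_cmod _) _; exact: GK (uU w).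
Qed.

Lemma regular_bounded_cmod (G : E -> R[i]) : regular G ->
  bounded_rv (fun w => cmod (G (tU w))).
Proof.
move=> [mG [K GK]]; split.
  exact: (measurableT_comp (measurable_cmod mG) (tuple_rv_measurable haarU)).
exists K => w; rewrite ger0_norm ?cmod_ge0//; exact: GK (uU w).
Qed.

(** The expectation of [G] along the curve does not depend on t, so t times the expected derivative
    is, up to sign, the expected remainder, of size K t^2. Dividing by t and letting t tend to 0
    leaves 0. *)
Lemma Ex_derivative (G : E -> R[i]) (F1 : E -> R[i]) (V : R -> M) j :
  regular G -> regular F1 -> (forall t, V t \is unitarymx) ->
  expands (fun t u => G (translate (V t) j u)) G F1 ->
  Ex P (fun w => complex.Re (F1 (tU w))) = 0.
Proof.
move=> rG rF uV [K K0 h]; set e := Ex P _.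
have key t : 0 < t -> t <= 1 -> `|e| <= K * t.
  move=> t0 t1; have tn : `|t| <= 1 by rewrite ger0_norm ?(ltW t0).
  rewrite -(ler_pM2l t0) -{1}(ger0_norm (ltW t0)) -normrM.
  have [[mG mG'] [L GL]] := rG.
  have bV : bounded_rv (fun w => complex.Re (G (translate (V t) j (tU w)))).
    split; first exact: (measurableT_comp mG (translate_measurable haarU (V t) j)).
    exists L => w; apply: le_trans (normr_Re_le_cmod _) _; apply: GL.
    exact: (translate_unitary j (uV t) (uU w)).
  have bG := regular_bounded_Re rG; have bF := regular_bounded_Re rF.
  have inv : Ex P (fun w => complex.Re (G (translate (V t) j (tU w)))) =
      Ex P (fun w => complex.Re (G (tU w))).
    apply: (Ex_translate haarU indepU j (uV t) mG); exists L => u uu.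
    by apply: le_trans (normr_Re_le_cmod _) _; exact: GL.
  have -> : t * e = - Ex P (fun w => complex.Re (G (translate (V t) j (tU w)))
      - complex.Re (G (tU w)) - t * complex.Re (F1 (tU w))).
    by rewrite ExB ?ExB ?ExZ ?inv ?subrr ?sub0r ?opprK//;
      [exact: bounded_rvB|exact: bounded_rvZ].
  rewrite normrN; apply: le_trans (Ex_norm P _) _.
    by apply: bounded_rvB; [exact: bounded_rvB|exact: bounded_rvZ].
  rewrite mulrCA -expr2 -[leRHS](Ex_cst P); apply: Ex_le.
  - by apply: bounded_rv_norm; apply: bounded_rvB; [exact: bounded_rvB|exact: bounded_rvZ].
  - exact: bounded_rv_cst.
  - move=> w; have [+ _ _] := h t (tU w) tn (uU w); apply: le_trans.
    apply: le_trans (normr_Re_le_cmod _); rewrite le_eqVlt; apply/orP; left.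
    case: (G _) (G _) (F1 _) => [x y] [x' y'] [x1 y1] /=.
    by rewrite mul0r subr0.
apply/eqP; rewrite -normr_eq0; apply/eqP/le_anti; rewrite normr_ge0 andbT.
apply/ler_addgt0Pr => eps eps0; rewrite add0r.
have K1 : 0 < K + 1 by rewrite ltr_wpDl.
pose t := Num.min 1 (eps / (K + 1)).
have t0 : 0 < t by rewrite lt_min ltr01 divr_gt0.
apply: le_trans (key t t0 _) _; first by rewrite ge_min lexx.
apply: le_trans (_ : (K + 1) * (eps / (K + 1)) <= _).
  apply: ler_pM; rewrite ?(ltW t0)// ?lerDl//.
  by rewrite ge_min lexx orbT.
by rewrite mulrC divfK// gt_eqF.
Qed.

(** The derivative along [X] of an entry of the word [w] times the trace of [v]. Later [v] is the
    inverse of [w]: its trace replaces the conjugate of Tr w and keeps the expression complex linear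
    in [X], as polarization requires. *)
Definition loop_term j a b X w v (u : E) : R[i] :=
  dword j X u w a b * \tr (word_mx u v) + word_mx u w a b * \tr (dword j X u v).

Lemma regular_loop_term j a b X w v : regular (loop_term j a b X w v).
Proof.
apply: regularD; apply: regularM.
- exact: regular_dword.
- exact: (regular_tr (regular_word v)).
- exact: regular_word.
- exact: (regular_tr (regular_dword _ _ v)).
Qed.

(** The factor [c] is arbitrary because only real parts are integrated: it gives access to the
    imaginary part and absorbs the coefficients of linear combinations of directions. *)
Lemma loop_rank_one j a b w v (c : R[i]) (z : 'I_N -> R[i]) :
  Ex P (fun om => complex.Re (c * loop_term j a b (rank_one z) w v (tU om))) = 0.
Proof.
pose c' := c / (0 +i* 2).
pose G (u : E) := c' * (word_mx u w a b * \tr (word_mx u v)).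
have rG : regular G.
  apply: regularM; first exact: regular_cst.
  by apply: regularM; [exact: regular_word|exact: (regular_tr (regular_word v))].
have rF : regular (fun u => c * loop_term j a b (rank_one z) w v u).
  by apply: regularM; [exact: regular_cst|exact: regular_loop_term].
have i2 : (0 +i* 2 : R[i]) != 0 by rewrite eq_complex/= pnatr_eq0 andbF.
apply: (Ex_derivative (V := perturb z) (j := j) rG rF (perturb_unitary z)).
have ec : @expands R d N (fun _ _ => c') (fun=> c') (fun=> 0).
  by apply: (@expands_cst _ _ _ _ (cmod c')).
apply: (expands_ext (expandsM ec (expandsM (word_expands z j w a b) (word_trace_expands z j v)))) => // u.
rewrite mul0r addr0 /loop_term mxE /c'.
have -> : word_mx u w a b * ((0 +i* 2) * \tr (dword j (rank_one z) u v)) +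
    (0 +i* 2) * dword j (rank_one z) u w a b * \tr (word_mx u v) =
  (0 +i* 2) * (dword j (rank_one z) u w a b * \tr (word_mx u v)
    + word_mx u w a b * \tr (dword j (rank_one z) u v)) by ring.
by rewrite mulrA divfK.
Qed.

Lemma loop_term_lin j a b w v u k X Y :
  loop_term j a b (k *: X + Y) w v u =
  k * loop_term j a b X w v u + loop_term j a b Y w v u.
Proof. by rewrite /loop_term !dword_lin mxtraceD mxtraceZ !mxE; ring. Qed.

(* By polarization, matrix units are combinations of rank-one projections. *)
Lemma loop_delta j a b a' b' w v (c : R[i]) :
  Ex P (fun om => complex.Re (c * loop_term j a b (delta_mx a' b') w v (tU om))) = 0.
Proof.
pose Z X := forall c, Ex P (fun om => complex.Re (c * loop_term j a b X w v (tU om))) = 0.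
have rT k X : bounded_rv (fun om => complex.Re (k * loop_term j a b X w v (tU om))).
  have r : regular (fun u => k * loop_term j a b X w v u).
    by apply: regularM; [exact: regular_cst|exact: regular_loop_term].
  exact: regular_bounded_Re r.
have Zlin k X Y : Z X -> Z Y -> Z (k *: X + Y).
  move=> ZX ZY e.
  under eq_fun do rewrite loop_term_lin mulrDr mulrA raddfD/=.
  by rewrite ExD// ZX ZY addr0.
have Zrank z : Z (rank_one z) by move=> e; exact: loop_rank_one.
have Z0 : Z 0.
  by have := Zlin (-1) _ _ (Zrank (fun=> 0)) (Zrank (fun=> 0)); rewrite scaleN1r addNr.
pose z k (e : 'I_N) : R[i] := (e == a')%:R + 'i%C ^+ k * (e == b')%:R.
suff ZD : Z (delta_mx a' b') by exact: ZD.
have -> : delta_mx a' b' = 4^-1 *: (rank_one (z 0%N)) + ((4^-1 * 'i%C) *: (rank_one (z 1%N))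
    + ((- 4^-1) *: (rank_one (z 2%N)) + ((- 4^-1 * 'i%C) *: rank_one (z 3%N) + 0))).
  apply/matrixP => e f; rewrite !mxE /z !expr0 !expr1.
  have i2 : 'i%C ^+ 2 = -1 :> R[i] by exact: sqr_i.
  have i3 : 'i%C ^+ 3 = - 'i%C :> R[i] by rewrite exprS i2 mulrN1.
  have ci : Num.conj 'i%C = - 'i%C :> R[i] by rewrite -[LHS]/(conjc _); simpc.
  rewrite i2 i3 !rmorphD !rmorphM/= !rmorph_nat ?(rmorphN, rmorph1)/= ?ci ?opprK.
  have i4 : 4%:R != 0 :> R[i] by rewrite pnatr_eq0.
  case: (e == a'); case: (e == b'); case: (f == a'); case: (f == b') => /=;
    by field: i2.
exact: (Zlin _ _ _ (Zrank _) (Zlin _ _ _ (Zrank _)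
  (Zlin _ _ _ (Zrank _) (Zlin _ _ _ (Zrank _) Z0)))).
Qed.

Local Notation tr w om := (\tr (word_mx (tU om) w)).

(* The Schwinger-Dyson equation for E |tr w|^2: invariance of the law of U under
   left translation, differentiated at the identity and contracted over the
   matrix units. *)
Lemma loop_equation j w :
  Ex P (fun om => complex.Re
    ((\sum_(0 <= k < size w) split_term j (tU om) w k) * Num.conj (tr w om) +
     \sum_a \sum_b word_mx (tU om) w a b *
       \tr (dword j (delta_mx a b) (tU om) (word_inv w)))) = 0.
Proof.
have rT a b : bounded_rv (fun om => complex.Re
    (1 * loop_term j a b (delta_mx a b) w (word_inv w) (tU om))).
  apply: (@regular_bounded_Re (fun u => 1 * loop_term j a b _ w (word_inv w) u)).
  by apply: regularM; [exact: regular_cst|exact: regular_loop_term].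
transitivity (Ex P (fun om => \sum_a \sum_b complex.Re
    (1 * loop_term j a b (delta_mx a b) w (word_inv w) (tU om)))).
  congr (Ex P _); apply/funext => om.
  under [RHS]eq_bigr => a _ do rewrite -cRe_sum.
  rewrite -cRe_sum; congr complex.Re.
  under [RHS]eq_bigr => a _ do under eq_bigr => b _ do
    rewrite mul1r /loop_term {1}word_mx_inv mxtrace_adj.
  under [RHS]eq_bigr => a _ do rewrite big_split/=.
  rewrite [RHS]big_split/=; congr (_ + _); rewrite -(sum_dword j (tU om) [::] w) mulr_suml.
  apply: eq_bigr => a _; rewrite mulr_suml; apply: eq_bigr => b _.
  by rewrite mul1mx.
rewrite Ex_sum; last by move=> a; exact: bounded_rv_sum.
by rewrite big1// => a _; rewrite Ex_sum// big1// => b _; exact: loop_delta.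
Qed.

(** A final letter inverse to g_j would be cut behind the whole word and give - N Tr w, which
    competes with the leading term. The condition on [last] excludes this, so every cut leaves a
    proper nonempty prefix; the other factor is at most N. *)
Lemma split_term_bound j (u : 'I_d -> M) w k : (forall i, u i \is unitarymx) ->
  (0 < k < size w)%N -> last (j, true) w != (j, false) ->
  cmod (split_term j u w k) <= N%:R * (cmod (\tr (word_mx u (take k w))) +
    (if (k.+1 < size w)%N then cmod (\tr (word_mx u (take k.+1 w))) else 0)).
Proof.
move=> uu /andP[k0 kw] lw; rewrite /split_term.
have c0 (z : R[i]) := cmod_ge0 z.
have if0 : 0 <= if (k.+1 < size w)%N then cmod (\tr (word_mx u (take k.+1 w))) else 0.
  by case: ifP.
case: eqP => [_|_].
  rewrite cmodM mulrC; apply: ler_pM; rewrite ?c0//; first exact: (word_mx_trace uu).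
  by rewrite lerDl.
case: eqP => [e|_]; last by rewrite cmod0 mulr_ge0// addr_ge0.
case: ifPn => [_|].
  rewrite cmodN cmodM mulrC; apply: ler_pM; rewrite ?c0//; first exact: (word_mx_trace uu).
  by rewrite lerDr.
rewrite -leqNgt => wk; move: lw; rewrite -nth_last (_ : (size w).-1 = k) ?e ?eqxx//.
by apply/eqP; rewrite eqn_leq -ltnS prednK ?(ltn_trans k0 kw)// wk -ltnS prednK ?kw//
   (ltn_trans k0 kw).
Qed.

Lemma sum_shift_le (q : nat) (f : nat -> R) : (forall k, 0 <= f k) ->
  \sum_(1 <= k < q) (f k + (if (k.+1 < q)%N then f k.+1 else 0)) <=
  2 * \sum_(1 <= k < q) f k.
Proof.
move=> f0; rewrite big_split/= mulr_natl mulr2n lerD2l.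
case: q => [|q]; first by rewrite !big_geq.
case: q => [|q]; first by rewrite !big_geq.
rewrite big_nat_recr//= ltnn addr0.
rewrite (_ : \sum_(1 <= k < q.+1) _ = \sum_(2 <= k < q.+2) f k).
  by rewrite [leRHS]big_ltn// lerDr.
rewrite [RHS]big_add1/= !big_nat; apply: eq_bigr => k /andP[_ kq].
by rewrite ltnS kq.
Qed.

(* In each product of two traces of the loop equation, one factor is bounded by N
   and the other is the trace of a proper prefix of w; the weights of the
   arithmetic-geometric inequality decrease geometrically, so that the recursion
   has exponential growth in the length. *)
Lemma trace_step j w : (0 < N)%N -> (0 < size w)%N -> nth (j, true) w 0 = (j, true) ->
  last (j, true) w != (j, false) ->
  Ex P (fun om => cmod (tr w om) ^+ 2) <=
  4 * (\sum_(1 <= l < size w) 2 ^+ (size w - l) *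
    Ex P (fun om => cmod (tr (take l w) om) ^+ 2)) + 2 * (size w)%:R.
Proof.
move=> N0 w0 w1 lw; set q := size w in w0 *.
have bt v : bounded_rv (fun om => cmod (tr v om)).
  exact: (regular_bounded_cmod (regular_tr (regular_word v))).
have bt2 v : bounded_rv (fun om => cmod (tr v om) ^+ 2).
  by under eq_fun do rewrite expr2; exact: bounded_rvM.
pose m v := Ex P (fun om => cmod (tr v om) ^+ 2).
pose S om := \sum_(1 <= l < q) (2 ^+ (q - l).+1 * cmod (tr (take l w) om) ^+ 2).
have bS : bounded_rv S by apply: bounded_rv_sum => l; exact: bounded_rvZ.
have point om : 2^-1 * cmod (tr w om) ^+ 2 - S om - q%:R <= N%:R^-1 * complex.Re
    ((\sum_(0 <= k < size w) split_term j (tU om) w k) * Num.conj (tr w om) +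
     \sum_a \sum_b word_mx (tU om) w a b *
       \tr (dword j (delta_mx a b) (tU om) (word_inv w))).
  have uu := uU om; set t := tr w om.
  have NR : 0 < N%:R :> R by rewrite ltr0n.
  rewrite ler_pdivlMl// big_ltn//.
  (* The cut in front of the first letter gives Tr 1 * Tr w, the leading term. *)
  have -> : split_term j (tU om) w 0 = N%:R * t.
    by rewrite /split_term w1 eqxx take0 drop0 mxtrace1.
  rewrite mulrDl !raddfD/=.
  have -> : complex.Re (N%:R * t * Num.conj t) = N%:R * cmod t ^+ 2.
    rewrite -mulrA -[Num.conj t]/(conjc t) sqmodE cmod_sqr.
    by rewrite -(rmorph_nat (@real_complex R)) -rmorphM.
  set X := (\sum_(1 <= k < _) _) * _; set Y := \sum_a _.
  have hY : cmod Y <= q%:R * N%:R.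
    have uI : (1%:M : M) \is unitarymx := word_mx_unitary uu [::].
    have := sum_trace_dword j (word_inv w) uu uI (word_mx_unitary uu w).
    rewrite natrM /word_inv size_rev size_map -/q; congr (cmod _ <= _).
    by apply: eq_bigr => a _; apply: eq_bigr => b _; rewrite mul1mx.
  have hX : cmod X <= N%:R * (cmod t * (2 * \sum_(1 <= l < q) cmod (tr (take l w) om))).
    rewrite /X cmodM cmod_conj mulrC mulrCA; apply: ler_wpM2l; first exact: cmod_ge0.
    apply: le_trans (ler_wpM2l (ltW NR) (sum_shift_le q (fun k => cmod_ge0 (tr (take k w) om)))).
    apply: le_trans (cmod_sum _ _ _) _; rewrite mulr_sumr !big_nat.
    by apply: ler_sum => k kq; exact: split_term_bound.
  have amgm : cmod t * (2 * \sum_(1 <= l < q) cmod (tr (take l w) om)) <=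
      S om + 2^-1 * cmod t ^+ 2.
    apply: le_trans (_ : \sum_(1 <= l < q) (2 ^+ (q - l).+1 *
        cmod (tr (take l w) om) ^+ 2 + 2^-1 ^+ (q - l).+1 * cmod t ^+ 2) <= _).
      rewrite mulrA mulr_sumr; apply: ler_sum => l _.
      set a := 2 ^+ _; set b := 2^-1 ^+ _; set x := cmod (tr (take l w) om).
      have ab : a * b = 1 by rewrite /a /b -exprMn divff ?expr1n.
      have b0 : 0 < b by rewrite exprn_gt0 ?invr_gt0.
      rewrite -subr_ge0 (_ : _ - _ = b * (a * x - cmod t) ^+ 2).
        by rewrite mulr_ge0 ?sqr_ge0// ltW.
      rewrite (_ : b * (a * x - cmod t) ^+ 2 =
        a * b * (a * x ^+ 2) - 2 * (a * b) * x * cmod t + b * cmod t ^+ 2); last by ring.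
      by rewrite ab; ring.
    by rewrite big_split/= lerD2l -mulr_suml ler_wpM2r ?sqr_ge0// sum_half_le.
  have := normr_Re_le_cmod X; rewrite ler_norml => /andP[+ _].
  have := normr_Re_le_cmod Y; rewrite ler_norml => /andP[+ _].
  have := ler_wpM2l (ltW NR) amgm.
  move: hX hY; nra.
have := loop_equation j w; set Z := (X in Ex P X) => EZ.
have bZ : bounded_rv Z.
  rewrite /Z; apply: (@regular_bounded_Re (fun u =>
    (\sum_(0 <= k < size w) split_term j u w k) * Num.conj (\tr (word_mx u w)) +
     \sum_a \sum_b word_mx u w a b * \tr (dword j (delta_mx a b) u (word_inv w)))).
  apply: regularD.
    apply: regularM; last exact: (regular_conj (regular_tr (regular_word w))).
    apply: regular_sum => k; rewrite /split_term.
    case: (_ == _); first by apply: regularM; exact: (regular_tr (regular_word _)).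
    case: (_ == _); last exact: regular_cst.
    by apply: regularN; apply: regularM; exact: (regular_tr (regular_word _)).
  apply: regular_sum => a; apply: regular_sum => b; apply: regularM.
    exact: regular_word.
  exact: (regular_tr (regular_dword _ _ _)).
have h1 : bounded_rv (fun om => 2^-1 * cmod (tr w om) ^+ 2) by exact: bounded_rvZ.
have h2 : bounded_rv (fun om => 2^-1 * cmod (tr w om) ^+ 2 - S om) by exact: bounded_rvB.
have h3 : bounded_rv (fun om => 2^-1 * cmod (tr w om) ^+ 2 - S om - q%:R).
  by apply: bounded_rvB => //; exact: bounded_rv_cst.
have := Ex_le P h3 (bounded_rvZ N%:R^-1 bZ) point.
rewrite (ExZ _ _ bZ) EZ mulr0 (ExB _ h2 (bounded_rv_cst _)) Ex_cst (ExB _ h1 bS).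
rewrite (ExZ _ _ (bt2 w)) /S Ex_sum; last by move=> l; exact: bounded_rvZ.
under eq_bigr => l _ do rewrite (ExZ _ _ (bt2 _)) exprS -mulrA.
by rewrite -mulr_sumr; lra.
Qed.

(** [trace_step] wants a word that begins with a generator and does not end with its inverse.
    Conjugation by the first letter, or passing to the adjoint, brings every reduced word to this
    form or to a shorter one. *)
Lemma word_trace_bound w : (0 < N)%N -> reduced w -> w != [::] ->
  Ex P (fun om => cmod (tr w om) ^+ 2) <= 32 ^+ size w.
Proof.
move=> N0; have [n] := ubnP (size w); elim: n w => // n IH w wn rw wn0.
have start j v : (size v < n)%N -> reduced ((j, true) :: v) ->
    last (j, true) v != (j, false) ->
    Ex P (fun om => cmod (tr ((j, true) :: v) om) ^+ 2) <= 32 ^+ (size v).+1.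
  move=> vn rv lv; set z := _ :: v.
  apply: le_trans (@trace_step j z N0 isT erefl lv) _.
  have -> : (size v).+1 = size z by [].
  have sb : \sum_(1 <= l < size z) 2 ^+ (size z - l) *
      Ex P (fun om => cmod (tr (take l z) om) ^+ 2) <=
      \sum_(1 <= l < size z) 2 ^+ (size z - l) * 32 ^+ l.
    (* Proper prefixes are reduced and nonempty, so the induction hypothesis covers them even when
       they are not cyclically reduced. *)
    rewrite !big_nat; apply: ler_sum => l /andP[l0 lz].
    rewrite ler_wpM2l ?exprn_ge0//.
    have sl : size (take l z) = l by rewrite size_takel// ltnW.
    rewrite -[in leRHS]sl; apply: IH.
    - by rewrite sl (leq_trans lz).
    - exact: take_sorted.
    - by rewrite -size_eq0 sl -lt0n.
  (* Half of 32^q, with q the length, pays for the prefixes and the other half for the linear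
     term. *)
  have := sum_pow_le R (size z).
  have : 4 * (size z)%:R <= 32 ^+ size z :> R.
    rewrite -natrM -natrX ler_nat; elim: (size z) => // k; rewrite expnS; lia.
  by move: sb; lra.
case: w wn rw wn0 => // x v wn rw _.
case: (eqVneq (last x v) (letter_inv x)) => [|lx].
  (* Not cyclically reduced: the outer letters cancel in the trace. Something is left between them,
     since a letter and its inverse are never adjacent in a reduced word. *)
  case/lastP: v wn rw => [|v y] wn rw /=; first by case: x {wn rw} => i [].
  rewrite last_rcons => yx; rewrite {y}yx in wn rw *.
  have rv : reduced v.
    rewrite -[v](@take_size_cat _ _ v [:: letter_inv x] erefl) cats1.
    exact: take_sorted (reduced_tail rw).
  have vn0 : v != [::] by apply: contraTN rw => /eqP ->; rewrite /reduced/= eqxx.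
  have -> : (fun om => cmod (\tr (letter_mx (tU om) x *m
      word_mx (tU om) (rcons v (letter_inv x)))) ^+ 2) = (fun om => cmod (tr v om) ^+ 2).
    apply/funext => om; rewrite -cats1 word_mx_cat word_mx1 letter_mx_inv.
    rewrite mulmxA mxtrace_mulC mulmxA mul_adjmx ?mul1mx//.
    exact: (letter_mx_unitary (uU om)).
  rewrite /= size_rcons in wn *.
  apply: le_trans (IH v _ rv vn0) _; first by rewrite -ltnS ltnW.
  by rewrite ler_weXn2l ?ler1n//= ltnW.
case: x => j [] in wn rw lx *; first exact: start.
(* The adjoint has a trace of the same modulus; rotating its last letter to the front makes the word
   begin with a generator. *)
have <- : (fun om => cmod (tr ((j, true) :: word_inv v) om) ^+ 2) =
    (fun om => cmod (tr ((j, false) :: v) om) ^+ 2).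
  apply/funext => om; rewrite !word_mx_cons word_mx_inv mxtrace_mulC.
  rewrite -[in RHS]cmod_conj -mxtrace_adj adjmxM; congr (cmod (\tr (_ *m _)) ^+ 2).
  by rewrite /letter_mx/= adjmxK.
have sv : size (word_inv v) = size v by rewrite size_rev size_map.
rewrite /= -sv; apply: start; first by rewrite sv.
- have := word_inv_reduced (reduced_tail rw); case/lastP: v lx {wn rw sv} => // v y.
  rewrite last_rcons /word_inv map_rcons rev_rcons /reduced /= => yj ->.
  by rewrite andbT; apply: contra yj => /eqP/(can_inj letter_invK) ->.
- case: v rw {wn lx sv} => [_|y v /andP[yj _]].
    by rewrite /word_inv/= xpair_eqE andbF.
  rewrite /word_inv map_cons rev_cons last_rcons.
  by apply: contra yj => /eqP <-; rewrite letter_invK.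
Qed.

End TraceBound.

(** * Vectors of the tensor product *)

Section InnerProduct.
Context {R : realType} {H : hilbertType R}.
Implicit Types (x y z : H) (k : R[i]).

Definition ip x y : R[i] := inner x y.

(** Norms in [H] have values in R[i]; the estimates below use this real squared norm. *)
Definition sq x : R := complex.Re (ip x x).

Lemma ipDl x y z : ip (x + y) z = ip x z + ip y z.
Proof. by rewrite /ip linearDl. Qed.

Lemma ipZl k x z : ip (k *: x) z = k * ip x z.
Proof. by rewrite /ip linearZl_LR. Qed.

Lemma ipC x y : ip x y = Num.conj (ip y x).
Proof. by rewrite /ip hermC/= expr0 mul1r. Qed.

Lemma ipDr x y z : ip z (x + y) = ip z x + ip z y.
Proof. by rewrite ipC ipDl rmorphD/= -!ipC. Qed.

Lemma ipZr k x z : ip z (k *: x) = Num.conj k * ip z x.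
Proof. by rewrite ipC ipZl rmorphM/= -ipC. Qed.

Lemma ip0l z : ip 0 z = 0.
Proof. by rewrite -(scale0r (0 : H)) ipZl mul0r. Qed.

Lemma ip0r z : ip z 0 = 0.
Proof. by rewrite ipC ip0l rmorph0. Qed.

Lemma ip_suml (I : Type) (r : seq I) (F : I -> H) z :
  ip (\sum_(i <- r) F i) z = \sum_(i <- r) ip (F i) z.
Proof.
by elim: r => [|i r IH]; rewrite ?big_nil ?ip0l// !big_cons ipDl IH.
Qed.

Lemma ip_sumr (I : Type) (r : seq I) (F : I -> H) z :
  ip z (\sum_(i <- r) F i) = \sum_(i <- r) ip z (F i).
Proof.
by elim: r => [|i r IH]; rewrite ?big_nil ?ip0r// !big_cons ipDr IH.
Qed.

Lemma sqE x : ip x x = (sq x)%:C.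
Proof.
rewrite /sq RRe_real//; apply: ger0_real.
by rewrite /ip inner_norm exprn_ge0.
Qed.

Lemma sq_norm x : (sq x)%:C = `|x| ^+ 2.
Proof. by rewrite -sqE /ip inner_norm. Qed.

Lemma sq_ge0 x : 0 <= sq x.
Proof. by rewrite -lecR sq_norm exprn_ge0. Qed.

Lemma sq0 : sq 0 = 0.
Proof. by rewrite /sq ip0l. Qed.

Lemma sqZ k x : sq (k *: x) = sqmod k * sq x.
Proof.
apply: complexI; rewrite -sqE ipZl ipZr sqE mulrA rmorphM/=; congr (_ * _).
by rewrite -sqmodE.
Qed.

Lemma sqZr (t : R) x : sq (t%:C *: x) = t ^+ 2 * sq x.
Proof. by rewrite sqZ /sqmod/= expr0n addr0. Qed.

Lemma sqN x : sq (- x) = sq x.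
Proof. by rewrite -scaleN1r sqZ /sqmod/= oppr0 expr0n addr0 sqrrN expr1n mul1r. Qed.

Lemma sqD x y : sq (x + y) = sq x + sq y + 2 * complex.Re (ip x y).
Proof.
rewrite /sq ipDl !ipDr !raddfD/= (ipC y x) cRe_conj; lra.
Qed.

Lemma sqB x y : sq (x - y) = sq x + sq y - 2 * complex.Re (ip x y).
Proof.
rewrite sqD sqN -scaleN1r ipZr rmorphN1 mulN1r raddfN/=; lra.
Qed.

Lemma parallelogram x y : sq (x + y) + sq (x - y) = 2 * sq x + 2 * sq y.
Proof. by rewrite sqD sqB; lra. Qed.

Lemma sqD_le x y : sq (x + y) <= 2 * sq x + 2 * sq y.
Proof. by rewrite -parallelogram lerDl sq_ge0. Qed.

Lemma sq_sum_le (I : Type) (r : seq I) (F : I -> H) :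
  sq (\sum_(i <- r) F i) <= 2 ^+ size r * \sum_(i <- r) sq (F i).
Proof.
elim: r => [|i r IH]; first by rewrite !big_nil sq0 mulr0.
rewrite !big_cons /= exprS -mulrA; apply: le_trans (sqD_le _ _) _.
rewrite -mulrDr ler_wpM2l// mulrDr lerD//.
by rewrite ler_peMl ?sq_ge0// exprn_ege1// ler1n.
Qed.

Lemma sqD_ge (t : R) x y : 0 < t -> (1 - t) * sq x - t^-1 * sq y <= sq (x + y).
Proof.
move=> t0; have := sq_ge0 (t%:C *: x + y).
rewrite (sqD (t%:C *: x)) sqZr ipZl (sqD x y) (_ : complex.Re (t%:C * ip x y) = t * complex.Re (ip x y)).
  rewrite -(pmulr_rge0 _ (_ : 0 < t^-1)) ?invr_gt0//.
  have -> : t^-1 * (t ^+ 2 * sq x + sq y + 2 * (t * complex.Re (ip x y))) =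
      t * sq x + t^-1 * sq y + 2 * complex.Re (ip x y) by field; rewrite gt_eqF.
  by have := sq_ge0 y; lra.
by case: (ip x y) => a b /=; rewrite mul0r subr0.
Qed.

(* Parseval on the group of 4th roots of unity. *)
Lemma sq_parseval x y z :
  sq (x + y + z) + sq (x - 'i%C *: y + 'i%C *: z) +
  sq (x - y - z) + sq (x + 'i%C *: y - 'i%C *: z) = 4 * sq x + 4 * sq y + 4 * sq z.
Proof.
have h1 := parallelogram x (y + z); have h2 := parallelogram x ('i%C *: (y - z)).
have h3 := parallelogram y z.
have h4 : sq ('i%C *: (y - z)) = sq (y - z) by rewrite sqZ /sqmod/= expr0n add0r expr1n mul1r.
have -> : x + y + z = x + (y + z) by rewrite addrA.
have -> : x - y - z = x - (y + z) by rewrite opprD addrA.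
have -> : x + 'i%C *: y - 'i%C *: z = x + 'i%C *: (y - z) by rewrite scalerBr addrA.
have -> : x - 'i%C *: y + 'i%C *: z = x - 'i%C *: (y - z).
  by rewrite scalerBr opprB addrA addrAC.
by move: h1 h2; rewrite h4; lra.
Qed.

Lemma ip_sq_bound x y : cmod (ip x y) <= (sq x + sq y) / 2.
Proof.
have [c0|cn0] := eqVneq (cmod (ip x y)) 0.
  by rewrite c0 divr_ge0// addr_ge0// sq_ge0.
have cp : 0 < cmod (ip x y) by rewrite lt_neqAle eq_sym cn0 cmod_ge0.
pose k := Num.conj (ip x y) * ((cmod (ip x y))^-1)%:C.
have sk : sqmod k = 1.
  by rewrite -cmod_sqr cmodM cmod_conj cmod_real ger0_norm ?invr_ge0 ?cmod_ge0//
    divff// expr1n.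
have := sq_ge0 (k *: x - y); rewrite sqB sqZ sk mul1r ipZl.
have -> : complex.Re (k * ip x y) = cmod (ip x y).
  rewrite /k mulrAC mulrC (mulrC (Num.conj _)).
  rewrite (_ : ip x y * Num.conj (ip x y) = (cmod (ip x y) ^+ 2)%:C); last first.
    by rewrite cmod_sqr -sqmodE.
  by rewrite -rmorphM/= expr2 mulKf.
lra.
Qed.

End InnerProduct.

Section TensorFunctions.
Context {R : realType} {H : hilbertType R} {I : choiceType}.
Implicit Types (x : seq (H * l2 R I)) (z : I -> R[i]).

(* The element of l^2(I; H) represented by an element of the algebraic tensor
   product. *)
Definition tfun x : I -> H := fun i => \sum_(u <- x) (u.2 i : R[i]) *: u.1.

Lemma cabsumD z z' : cabsum z -> cabsum z' -> cabsum (fun i => z i + z' i).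
Proof.
move=> [a b] [a' b']; split; under eq_fun do rewrite raddfD/=; exact: absumD.
Qed.

Lemma cabsumZ (k : R[i]) z : cabsum z -> cabsum (fun i => k * z i).
Proof.
move=> [a b]; case: k => p q; split.
  rewrite (_ : (fun i => _) = fun i => p * complex.Re (z i) + (- q) * complex.Im (z i)).
    by apply: absumD; exact: absumZ.
  by apply/funext => i; case: (z i) => s t /=; rewrite mulNr.
rewrite (_ : (fun i => _) = fun i => p * complex.Im (z i) + q * complex.Re (z i)).
  by apply: absumD; exact: absumZ.
by apply/funext => i; case: (z i).
Qed.

Lemma cabsum0 : cabsum (fun _ : I => 0 : R[i]).
Proof.
by split; rewrite /absum /fin_sum /nnsum esum1 ?ltry// => i _; rewrite normr0.
Qed.

Lemma csum0 : csum (fun _ : I => 0 : R[i]) = 0.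
Proof.
by have := csumZ 0 cabsum0; rewrite !mul0r.
Qed.

Lemma csum_sum (J : Type) (r : seq J) (z : J -> I -> R[i]) :
  (forall j, cabsum (z j)) ->
  cabsum (fun i => \sum_(j <- r) z j i) /\
  csum (fun i => \sum_(j <- r) z j i) = \sum_(j <- r) csum (z j).
Proof.
move=> zs; elim: r => [|j r [IH1 IH2]].
  by under eq_fun do rewrite big_nil; rewrite big_nil csum0; split=> //; exact: cabsum0.
under eq_fun do rewrite big_cons; rewrite big_cons csumD// IH2; split=> //.
exact: cabsumD.
Qed.

(** Expanding the inner products of the second factors over i and exchanging sums turns the Gram
    double sum into a squared norm in l^2(I; H). For its norm a list thus counts only through
    [tfun], whichever decomposition it spells. *)
Lemma tensor_norm_sq x :
  nnsum (fun i => sq (tfun x i)) = (tensor_norm x ^+ 2)%:E.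
Proof.
pose z (u v : H * l2 R I) i := ip u.1 v.1 * (u.2 i * (v.2 i)^*).
have cz u v : cabsum (z u v) by apply: cabsumZ; exact: l2_cabsum.
have czz u := csum_sum x (cz u).
have [cs cE] := csum_sum x (fun u => (czz u).1).
have zE i : \sum_(u <- x) \sum_(v <- x) z u v i = (sq (tfun x i))%:C.
  rewrite -sqE /tfun ip_suml; apply: eq_bigr => u _.
  rewrite ip_sumr; apply: eq_bigr => v _; rewrite ipZl ipZr /z.
  by rewrite -[Num.conj _]/(conjc _); ring.
have sE : \sum_(u <- x) \sum_(v <- x) (inner u.1 v.1 : R[i]) * (inner u.2 v.2 : R[i])
    = csum (fun i => (sq (tfun x i))%:C).
  rewrite -[RHS](_ : csum (fun i => \sum_(u <- x) \sum_(v <- x) z u v i) = _); last first.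
    by congr csum; apply/funext => i.
  rewrite cE; apply: eq_bigr => u _; rewrite (czz u).2; apply: eq_bigr => v _.
  by rewrite csumZ//; exact: l2_cabsum.
have rE : complex.Re (csum (fun i => (sq (tfun x i))%:C)) = rsum (fun i => sq (tfun x i)) by [].
have sq0' i : 0 <= sq (tfun x i) by exact: sq_ge0.
have fin : fin_sum (fun i => sq (tfun x i)).
  have [h _] := cs; apply: fin_sum_le h => i; rewrite zE/=.
  exact: ler_norm.
rewrite /tensor_norm sE rE rsum_ge0// sqr_sqrtr ?fine_ge0 ?nnsum_ge0//.
by rewrite fineK// nnsum_fin.
Qed.

Lemma tensor_norm_ge0 x : 0 <= tensor_norm x.
Proof. exact: sqrtr_ge0. Qed.

Lemma tensor_norm_scale (k : R) x :
  tensor_norm [seq (k%:C *: u.1, u.2) | u <- x] = `|k| * tensor_norm x.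
Proof.
rewrite /tensor_norm -sqrtr_sqr -sqrtrM ?sqr_ge0//; congr Num.sqrt.
rewrite big_map.
under eq_bigr => u _ do rewrite big_map/=.
under eq_bigr => u _ do under eq_bigr => v _ do
  rewrite -[inner (_ *: _) _]/(ip _ _) ipZl ipZr.
have -> : \sum_(u <- x) \sum_(v <- x) k%:C * (Num.conj k%:C * ip u.1 v.1) *
    (inner u.2 v.2 : R[i]) = (k ^+ 2)%:C * \sum_(u <- x) \sum_(v <- x)
    (inner u.1 v.1 : R[i]) * (inner u.2 v.2 : R[i]).
  rewrite mulr_sumr; apply: eq_bigr => u _; rewrite mulr_sumr; apply: eq_bigr => v _.
  rewrite -[Num.conj _]/(conjc _) conjc_real rmorphXn/= /ip; ring.
by case: (\sum_(u <- x) _) => p q /=; rewrite mul0r subr0.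
Qed.

End TensorFunctions.

(** * Localization on the free group *)

Section FreeGroupBalls.
Context {d : nat}.
Local Notation F := (free_group d).
Implicit Types (g h u v s : F).

Definition len g : nat := size (word g).

Fixpoint words_upto (n : nat) : seq (seq ('I_d * bool)) :=
  if n is n'.+1 then [::] :: [seq x :: w | x <- enum {: 'I_d * bool}, w <- words_upto n']
  else [:: [::]].

Definition gball n : seq F := undup (pmap insub (words_upto n)).

Lemma mem_words_upto n w : (w \in words_upto n) = (size w <= n)%N.
Proof.
elim: n w => [|n IH] [|x w]; rewrite ?inE//=.
rewrite ltnS -IH; apply/allpairsP/idP => [[[y w'] /= [_ h [_ ->]]]//|h].
by exists (x, w); rewrite mem_enum.
Qed.

Lemma mem_gball n g : (g \in gball n) = (len g <= n)%N.
Proof. by rewrite mem_undup mem_pmap_sub mem_words_upto. Qed.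

Lemma gball_uniq n : uniq (gball n).
Proof. exact: undup_uniq. Qed.

Lemma size_gball n : (size (gball n) <= (d + d).+1 ^ n)%N.
Proof.
apply: leq_trans (size_undup _) _; rewrite size_pmap.
apply: leq_trans (count_size _ _) _.
elim: n => // n IH; rewrite /= size_allpairs -cardE card_prod card_ord card_bool.
rewrite expnS mulSn -addn1 addnC leq_add ?expn_gt0// muln2 -addnn leq_mul2l IH orbT//.
Qed.

Lemma word_mulg g h : word (g * h)%g = word_mul (word g) (word h).
Proof. by []. Qed.

(** Left multiplication by a letter adds or cancels one letter at the front. The rest of the word is
    untouched, which is why pieces of annuli are sorted by their suffixes. *)
Lemma step_cases s g : (len s <= 1)%N ->
  [\/ (s * g)%g = g, exists x, word (s * g)%g = x :: word g |
      exists x, word g = x :: word (s * g)%g].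
Proof.
move=> s1; case: s s1 => [[|x [|y w]] rs] // _.
  by constructor 1; apply/val_inj.
have : word (FreeGroup rs * g)%g = letter_mul x (word g) by [].
case: (word g) => [|y w] /=; first by move=> ->; constructor 2; exists x.
by case: ifP => _ ->; [constructor 3; exists y|constructor 2; exists x].
Qed.

Lemma len_step s g : (len s <= 1)%N ->
  [\/ len (s * g)%g = len g, (len (s * g)%g).+1 = len g | len (s * g)%g = (len g).+1].
Proof.
move=> /(step_cases g)[->|[x e]|[x e]].
- by constructor 1.
- by constructor 3; rewrite /len e.
- by constructor 2; rewrite /len e.
Qed.

Lemma len_mul g h : (len (g * h)%g <= len g + len h)%N.
Proof.
rewrite /len word_mulg; elim: (word g) => //= x w IH.
rewrite /letter_mul; case: (word_mul w _) IH => [|y v] //= IH.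
by case: ifP => _ /=; lia.
Qed.

Lemma len_inv g : len g^-1%g = len g.
Proof. by rewrite /len /= size_rev size_map. Qed.

Lemma drop_reduced (w : seq ('I_d * bool)) k : reduced w -> reduced (drop k w).
Proof. exact: drop_sorted. Qed.

Definition suf (o : nat) g : F :=
  FreeGroup (drop_reduced (len g - o) (word_reduced g)).

(** The bound on the length of s g is strict: length [o] may be reached from length o - 1, where the
    suffix is one letter shorter. For [o = 0] all suffixes are empty. *)
Lemma suf_step o s g : (len s <= 1)%N -> (o == 0)%N || (o < len (s * g)%g)%N ->
  suf o (s * g)%g = suf o g.
Proof.
move=> s1 o1; apply/val_inj.
rewrite -[LHS]/(drop (len (s * g)%g - o) (word (s * g)%g)).
rewrite -[RHS]/(drop (len g - o) (word g)).
have dropn (w : seq ('I_d * bool)) : (o == 0)%N -> drop (size w - o) w = [::].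
  by move/eqP ->; rewrite subn0 drop_size.
case/orP: o1 => [/dropn drop0'|o1]; first by rewrite !drop0'.
rewrite /len in o1 *; have [->|[x e]|[x e]] := step_cases g s1; first by [].
  by rewrite e in o1 *; rewrite [size (_ :: _)]/= subSn.
by rewrite [in RHS]e [size (_ :: _)]/= subSn// ltnW.
Qed.

Lemma word_mul_cat (p w : seq ('I_d * bool)) : reduced (p ++ w) -> word_mul p w = p ++ w.
Proof.
elim: p => //= x p IH r; rewrite IH ?(reduced_tail r)//.
by case: (p ++ w) r => //= y v /andP[/negbTE ->].
Qed.

(** When [v] is the suffix of u v, [u] is the complementary prefix and the product has no
    cancellation. Removing the suffix thus moves a piece of an annulus of width r into the ball of
    radius r. *)
Lemma suf_len o u v : suf o (u * v)%g = v -> (o <= len (u * v)%g)%N ->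
  (len u + o = len (u * v)%g)%N.
Proof.
move=> e ol; set g := (u * v)%g in e ol *.
pose p := take (len g - o) (word g).
have rp : reduced p by apply: take_sorted; exact: word_reduced.
have ev : word v = drop (len g - o) (word g) := esym (congr1 (@word d) e).
have pv : p ++ word v = word g by rewrite ev cat_take_drop.
have ug : u = FreeGroup rp.
  apply: (mulIg v); apply/val_inj.
  rewrite -[LHS]/(word g) -[RHS]/(word_mul p (word v)) word_mul_cat pv//.
  exact: word_reduced.
by rewrite {1}ug /len /= size_takel ?leq_subr// subnK.
Qed.

End FreeGroupBalls.

Section SumLemmas.
Context {R : realFieldType}.

Lemma sum_uniq_le (I : eqType) (r1 r2 : seq I) (f : I -> R) :
  uniq r1 -> (forall i, 0 <= f i) -> (forall i, i \in r1 -> f i != 0 -> i \in r2) ->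
  \sum_(i <- r1) f i <= \sum_(i <- r2) f i.
Proof.
move=> + f0; elim: r1 r2 => [|i r1 IH] r2 /=.
  by move=> _ _; rewrite big_nil sumr_ge0.
move=> /andP[ir u] sub; rewrite big_cons.
have [fi|fi] := eqVneq (f i) 0.
  rewrite fi add0r; apply: IH => // j jr; apply: sub.
  by rewrite inE jr orbT.
have ir2 : i \in r2 by apply: sub => //; rewrite inE eqxx.
rewrite (big_rem i ir2)/= lerD2l; apply: IH => // j jr fj.
have : j \in r2 by apply: sub => //; rewrite inE jr orbT.
rewrite (perm_mem (perm_to_rem ir2)) inE => /orP[/eqP ji|//].
by rewrite ji in jr; rewrite jr in ir.
Qed.

Lemma sum_fibers (I J : eqType) (r : seq I) (p : I -> J) (f : I -> R) :
  \sum_(i <- r) f i = \sum_(j <- undup (map p r)) \sum_(i <- r | p i == j) f i.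
Proof.
rewrite (exchange_big_dep xpredT)//= [LHS]big_seq [RHS]big_seq.
apply: eq_bigr => i ir; under eq_bigl do rewrite eq_sym.
rewrite -big_filter (@filter_pred1_uniq _ (undup (map p r)) (p i)) ?undup_uniq//.
  by rewrite big_seq1.
by rewrite mem_undup map_f.
Qed.

(** Truncated subtraction sends every s beyond [L] to 0, where [G] vanishes; hence the total is the
    same for all admissible [L]. *)
Lemma sum_window (G : nat -> R) (L S r : nat) : G 0 = 0 ->
  (forall m, (r <= m)%N -> G m = 0) -> (r <= L)%N -> (L < S)%N ->
  \sum_(0 <= s < S) G (L - s)%N = \sum_(0 <= m < r) G m.
Proof.
move=> G0 Gr rL LS.
rewrite (big_cat_nat (n := L.+1))//= [X in _ + X]big_nat_cond [X in _ + X]big1 ?addr0; last first.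
  by move=> s /andP[/andP[Ls _] _]; rewrite (eqP (_ : L - s == 0)%N) ?subn_eq0 ?(ltnW Ls).
rewrite big_nat_rev/= add0n [RHS](_ : _ = \sum_(0 <= m < L.+1) G m).
  rewrite !big_nat; apply: eq_bigr => s /andP[_ sL].
  by rewrite subSS subKn.
rewrite [RHS](big_cat_nat (n := r))//=; last exact: leqW.
rewrite [X in _ = _ + X]big_nat_cond [X in _ = _ + X]big1 ?addr0// => m /andP[/andP[rm _] _].
exact: Gr.
Qed.

End SumLemmas.

Section Hat.
Context {R : realFieldType}.
Variable rho : nat.

(** Slope at most one over a range of 2 rho, against a sum of squares of order rho^3: the squared
    increments are smaller by a factor of order rho^2, which is what makes the localization loss
    O(1/rho). *)
Definition hat (m : nat) : R := (minn m (rho.*2 - m))%:R.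

Lemma hat0 : hat 0 = 0. Proof. by rewrite /hat min0n. Qed.

Lemma hat_ge m : (rho.*2 <= m)%N -> hat m = 0.
Proof. by rewrite /hat -subn_eq0 => /eqP ->; rewrite minn0. Qed.

Lemma hat_neq0 m : hat m != 0 -> (0 < m < rho.*2)%N.
Proof.
move=> h; apply/andP; split; first by rewrite lt0n; apply: contra h => /eqP ->; rewrite hat0.
by rewrite ltnNge; apply: contra h => /hat_ge ->.
Qed.

Lemma hat_step m : (hat m.+1 - hat m) ^+ 2 <= (m < rho.*2)%N%:R.
Proof.
have [mr|mr] := ltnP m rho.*2; last by rewrite !hat_ge ?(leqW mr)// subrr expr0n.
have h1 : hat m.+1 <= hat m + 1 by rewrite /hat natr1 ler_nat; lia.
have h2 : hat m <= hat m.+1 + 1 by rewrite /hat natr1 ler_nat; lia.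
rewrite -real_normK ?num_real// expr_le1// ler_norml; lra.
Qed.

Lemma sum_hat_step L S : \sum_(0 <= s < S) (hat (L.+1 - s)%N - hat (L - s)%N) ^+ 2 <= rho.*2%:R.
Proof.
have nz m : (rho.*2 <= m)%N -> (m < rho.*2)%N%:R = 0 :> R by rewrite ltnNge => ->.
apply: le_trans (_ : \sum_(0 <= s < S) (if (s <= L)%N then (L - s < rho.*2)%N%:R else 0) <= _).
  apply: ler_sum => s _; case: (leqP s L) => sL; first by rewrite subSn// hat_step.
  rewrite (eqP (_ : L - s == 0)%N) ?subn_eq0 ?(ltnW sL)//.
  by rewrite (eqP (_ : L.+1 - s == 0)%N) ?subn_eq0// subrr expr0n.
pose r1 := [seq (L - s)%N | s <- [seq s <- index_iota 0 S | (s <= L)%N]].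
have u1 : uniq r1.
  rewrite map_inj_in_uniq ?filter_uniq ?iota_uniq// => s s'.
  by rewrite !mem_filter => /andP[sL _] /andP[sL' _]; lia.
rewrite -big_mkcond -big_filter/=.
rewrite -[leLHS](big_map (fun s => L - s)%N xpredT (fun m => (m < rho.*2)%N%:R)) -/r1.
apply: le_trans (@sum_uniq_le _ _ r1 (index_iota 0 rho.*2) _ u1 _ _) _ => //.
- by move=> m _; rewrite mem_index_iota pnatr_eq0 eqb0 negbK.
- apply: le_trans (_ : \sum_(0 <= i < rho.*2) 1 <= _).
    by apply: ler_sum => m _; rewrite (ler_nat _ _ 1) leq_b1.
  by rewrite sumr_const_nat subn0.
Qed.

Lemma sum_hat_sqr : rho%:R ^+ 3 / 3 <= \sum_(0 <= m < rho.*2) hat m ^+ 2.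
Proof.
apply: le_trans (_ : \sum_(0 <= m < rho.+1) m%:R ^+ 2 <= _).
  elim: rho => [|k IH]; first by rewrite expr0n/= mul0r sumr_ge0// => *; rewrite sqr_ge0.
  rewrite big_nat_recr//= -(natr1 k) (_ : (k%:R + 1) ^+ 3 / 3 =
    k%:R ^+ 3 / 3 + k%:R ^+ 2 + k%:R + 3^-1 :> R); last by field.
  by have := ler0n R k; move: IH; rewrite sqrrD; lra.
case: (posnP rho) => [->|r0]; first by rewrite big_nat1 expr0n big_geq.
have rr : (rho.+1 <= rho.*2)%N by lia.
rewrite [leRHS](big_cat_nat (n := rho.+1))//=.
rewrite -[leLHS]addr0 lerD//; last by apply: sumr_ge0 => *; rewrite sqr_ge0.
rewrite !big_nat; apply: ler_sum => m /andP[_ mr].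
by rewrite /hat (minn_idPl _)//; lia.
Qed.

End Hat.

(** * Convolution operators and their localization *)

Section Convolution.
Context {R : realType} {d m : nat} {H : hilbertType R}.
Local Notation F := (free_group d).
Variables (B : 'I_m -> H -> H) (s : 'I_m -> F).
Hypothesis B_lin : forall t (k : R[i]) x y, B t (k *: x + y) = k *: B t x + B t y.
Hypothesis B_bnd : forall t, exists2 K : R, 0 <= K & forall x, sq (B t x) <= K * sq x.
Hypothesis s_len : forall t, (len (s t) <= 1)%N.
Implicit Types (f : F -> H) (g h u v : F).

(** When [s t] is the inverse of a group element g_t, this is the action of sum_t B_t (x)
    lambda(g_t) on l^2(F_d; H). It commutes with right translations. *)
Definition convolve f g : H := \sum_t B t (f (s t * g)%g).

Let B0 t : B t 0 = 0.
Proof. by have := B_lin t (-1) 0 0; rewrite !scaleN1r !addNr. Qed.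

Let BZ t k x : B t (k *: x) = k *: B t x.
Proof. by have := B_lin t k x 0; rewrite !addr0 B0 addr0. Qed.

Definition supported f n := forall g, (n < len g)%N -> f g = 0.

Definition normsq n f : R := \sum_(g <- gball n) sq (f g).

Lemma normsq_ge0 n f : 0 <= normsq n f.
Proof. by apply: sumr_ge0 => g _; exact: sq_ge0. Qed.

Lemma supported_conv f n : supported f n -> supported (convolve f) n.+1.
Proof.
move=> fn g ng; rewrite /convolve big1// => t _; rewrite fn ?B0//.
by have [] := len_step g (s_len t); lia.
Qed.

Lemma sq_neq0 (x : H) : sq x != 0 -> x != 0.
Proof. by apply: contra => /eqP ->; rewrite sq0. Qed.

Lemma normsq_le n n' f : supported f n -> normsq n' f <= normsq n f.
Proof.
move=> fn; apply: sum_uniq_le; first exact: gball_uniq.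
  by move=> g; exact: sq_ge0.
move=> g _ /sq_neq0 fg; rewrite mem_gball leqNgt; apply: contra fg => ng.
by rewrite fn.
Qed.

(** A bound for the square of the operator norm, tested on finitely supported functions so that all
    sums are finite. *)
Definition conv_bound (lam : R) :=
  forall n f, supported f n -> normsq n.+1 (convolve f) <= lam * normsq n f.

Definition local_conv_bound (r : nat) (K2 : R) :=
  forall f, supported f r -> normsq r.+1 (convolve f) <= K2 * normsq r f.

(** The constant is crude and depends on the individual coefficients. Only its existence matters: it
    makes the best constant finite. *)
Lemma conv_bound_exists : exists2 lam, 0 <= lam & conv_bound lam.
Proof.
have [K KB] := choice (fun t => (exists2P _ _).1 (B_bnd t)).
have K0 t : 0 <= K t by have [] := KB t.
exists (2 ^+ size (index_enum 'I_m) * \sum_t K t).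
  by rewrite mulr_ge0 ?exprn_ge0// sumr_ge0.
move=> n f fn; rewrite -mulrA mulr_suml.
apply: le_trans (_ : \sum_(g <- gball n.+1) (2 ^+ size (index_enum 'I_m) *
    \sum_t K t * sq (f (s t * g)%g)) <= _).
  apply: ler_sum => g _; apply: le_trans (sq_sum_le _ _) _.
  rewrite ler_wpM2l ?exprn_ge0//; apply: ler_sum => t _.
  by have [_] := KB t; apply.
rewrite -mulr_sumr ler_wpM2l ?exprn_ge0// exchange_big/=; apply: ler_sum => t _.
rewrite -mulr_sumr ler_wpM2l//.
rewrite -[leLHS](big_map (fun g => s t * g)%g xpredT (fun g => sq (f g))).
apply: sum_uniq_le.
- by rewrite map_inj_uniq ?gball_uniq//; exact: mulgI.
- by move=> g; exact: sq_ge0.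
- move=> g _ /sq_neq0 fg; rewrite mem_gball leqNgt; apply: contra fg => ng.
  by rewrite fn.
Qed.

(* Connected pieces of an annulus in the Cayley graph are contained in right
   translates of a ball, by the common suffix of their elements. *)
Lemma annulus_conv_bound (r : nat) (K2 : R) (o n : nat) f : local_conv_bound r K2 -> 0 <= K2 ->
  supported f n ->
  (forall g, f g != 0 -> (((o == 0) || (o < len g)) && (len g <= o + r))%N) ->
  normsq n.+1 (convolve f) <= K2 * normsq n f.
Proof.
move=> loc K20 fn fo.
(* The part of [f] with suffix [v], translated on the right by the inverse of [v] to sit around the
   identity. *)
pose fv v u := if suf o (u * v)%g == v then f (u * v)%g else 0.
(* Neighbours of [g] at which [f] does not vanish share the suffix of [g], so the convolution at [g]
   sees a single piece. *)
have convE g : convolve f g = convolve (fv (suf o g)) (g * (suf o g)^-1)%g.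
  apply: eq_bigr => t _; rewrite /fv mulgA mulgVK; case: eqP => // ne.
  have [->//|/fo/andP[ho _]] := eqVneq (f (s t * g)%g) 0.
  by case: ne; exact: suf_step.
have supp_fv v : supported (fv v) r.
  move=> u ru; rewrite /fv; case: eqP => // uv.
  have [//|/fo/andP[ho hr]] := eqVneq (f (u * v)%g) 0.
  have ol : (o <= len (u * v)%g)%N by case/orP: ho => [/eqP ->//|/ltnW].
  by have := suf_len uv ol; move: ru hr; lia.
rewrite /normsq (sum_fibers (gball n.+1) (suf o)).
set V := undup _.
apply: le_trans (_ : \sum_(v <- V) normsq r.+1 (convolve (fv v)) <= _).
  apply: ler_sum => v _.
  under eq_bigr => g /eqP gv do rewrite convE gv.
  rewrite -big_filter -[leLHS](big_map (fun g => g * v^-1)%g xpredT (fun u => sq (convolve (fv v) u))).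
  apply: sum_uniq_le.
  - by rewrite map_inj_uniq ?filter_uniq ?gball_uniq//; exact: mulIg.
  - by move=> g; exact: sq_ge0.
  - move=> g _ /sq_neq0 fg; rewrite mem_gball leqNgt; apply: contra fg => ng.
    by rewrite (supported_conv (supp_fv v)).
apply: le_trans (_ : \sum_(v <- V) K2 * normsq r (fv v) <= _).
  by apply: ler_sum => v _; exact: loc (supp_fv v).
rewrite -mulr_sumr ler_wpM2l//.
apply: le_trans (_ : \sum_(v <- V) \sum_(g <- gball n.+1 | suf o g == v) sq (f g) <= _).
  apply: ler_sum => v _; rewrite /normsq /fv.
  rewrite -[leRHS]big_filter.
  apply: le_trans (_ : \sum_(u <- gball r | suf o (u * v)%g == v) sq (f (u * v)%g) <= _).
    rewrite [leRHS]big_mkcond; apply: ler_sum => u _; case: ifP => //.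
    by rewrite sq0.
  rewrite -[leLHS]big_filter -[leLHS](big_map (fun g => g * v)%g xpredT (fun u => sq (f u))).
  apply: sum_uniq_le.
  - by rewrite map_inj_uniq ?filter_uniq ?gball_uniq//; exact: mulIg.
  - by move=> g; exact: sq_ge0.
  - move=> g /mapP[u + ->] /sq_neq0 fg; rewrite !mem_filter => /andP[-> _] /=.
    rewrite mem_gball leqNgt; apply: contra fg => ng.
    by rewrite fn// ltnW.
rewrite -(sum_fibers (gball n.+1) (suf o) (fun g => sq (f g))).
exact: (normsq_le n.+1 fn).
Qed.

(** The three parts are named by the length at which [f] is read, relative to that of [g]: as
    operators [conv_dn] raises lengths and [conv_up] lowers them. *)
Definition conv_eq f g := \sum_(t | len (s t * g)%g == len g) B t (f (s t * g)%g).
Definition conv_dn f g := \sum_(t | (len (s t * g)%g).+1 == len g) B t (f (s t * g)%g).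
Definition conv_up f g := \sum_(t | len (s t * g)%g == (len g).+1) B t (f (s t * g)%g).

Lemma conv_split (c : nat -> R[i]) f g :
  convolve (fun h => c (len h) *: f h) g =
  c (len g) *: conv_eq f g + c (len g).-1 *: conv_dn f g + c (len g).+1 *: conv_up f g.
Proof.
rewrite !scaler_sumr.
rewrite (big_mkcond (fun t => len (s t * g)%g == len g))/=.
rewrite (big_mkcond (fun t => (len (s t * g)%g).+1 == len g))/=.
rewrite (big_mkcond (fun t => len (s t * g)%g == (len g).+1))/=.
rewrite -!big_split/=; apply: eq_bigr => t _; rewrite BZ.
have n1 (k : nat) : (k == k.+1) = false by apply/negbTE; rewrite neq_ltn ltnSn.
have n2 (k : nat) : (k.+1 == k) = false by rewrite eq_sym n1.
have n3 (k : nat) : (k == k.+2) = false by apply/negbTE; rewrite neq_ltn (ltn_trans (ltnSn k)).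
have n4 (k : nat) : (k.+2 == k) = false by rewrite eq_sym n3.
have [->|<-|->] := len_step g (s_len t).
- by rewrite eqxx n1 n2 !addr0.
- by rewrite eqxx n1 n3 addr0 add0r.
- by rewrite eqxx n2 n4 !add0r.
Qed.

Lemma conv_parts f g : convolve f g = conv_eq f g + conv_dn f g + conv_up f g.
Proof.
rewrite -(scale1r (conv_eq f g)) -(scale1r (conv_dn f g)) -(scale1r (conv_up f g)).
rewrite -[RHS](conv_split (fun=> 1) f g).
by apply: eq_bigr => t _; rewrite scale1r.
Qed.

(** Multiplication by c^|g| is unitary. Conjugating by it preserves norms and multiplies [conv_dn]
    by the conjugate of c and [conv_up] by c. *)
Lemma conv_gauge (lam : R) n f (c : R[i]) : conv_bound lam -> supported f n ->
  sqmod c = 1 ->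
  \sum_(g <- gball n.+1) sq (conv_eq f g + Num.conj c *: conv_dn f g + c *: conv_up f g)
  <= lam * normsq n f.
Proof.
move=> cb fn c1.
have c1' : c * Num.conj c = 1 by rewrite -[Num.conj c]/(conjc c) sqmodE c1.
have ck k : sqmod (c ^+ k) = 1.
  apply: complexI; rewrite -sqmodE.
  transitivity ((c * Num.conj c) ^+ k); first by rewrite exprMn -rmorphXn.
  by rewrite c1' expr1n.
have -> : normsq n f = normsq n (fun h => c ^+ len h *: f h).
  by apply: eq_bigr => g _; rewrite sqZ ck mul1r.
have fn' : supported (fun h => c ^+ len h *: f h) n by move=> g /fn ->; rewrite scaler0.
apply: le_trans (cb _ _ fn'); rewrite le_eqVlt; apply/orP; left; apply/eqP.
apply: eq_bigr => g _; rewrite (conv_split (fun k => c ^+ k)).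
have -> : c ^+ (len g).-1 *: conv_dn f g = c ^+ len g *: (Num.conj c *: conv_dn f g).
  have [l0|l0] := posnP (len g).
    by rewrite /conv_dn l0 big_pred0 ?scaler0.
  rewrite scalerA -[in RHS](prednK l0) exprSr -[_ * _ * _]mulrA c1' mulr1.
  by [].
by rewrite exprSr -scalerA -!scalerDr sqZ ck mul1r.
Qed.

(** Averaging [conv_gauge] over c = 1, i, -1, -i removes the cross terms, since the frequencies 0,
    -1, 1 of the three parts are distinct modulo 4. The length-preserving part is then dropped. *)
Lemma conv_parseval (lam : R) n f : conv_bound lam -> supported f n ->
  \sum_(g <- gball n.+1) (sq (conv_dn f g) + sq (conv_up f g)) <= lam * normsq n f.
Proof.
move=> cb fn.
have h1 := conv_gauge cb fn (_ : sqmod 1 = 1).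
have h2 := conv_gauge cb fn (_ : sqmod 'i%C = 1).
have h3 := conv_gauge cb fn (_ : sqmod (-1) = 1).
have h4 := conv_gauge cb fn (_ : sqmod (- 'i%C) = 1).
have ci : Num.conj 'i%C = - 'i%C :> R[i] by rewrite -[LHS]/(conjc _); simpc.
move: h1 h2 h3 h4.
rewrite /sqmod/= !oppr0 !sqrrN expr0n expr1n add0r addr0.
move=> /(_ erefl) h1 /(_ erefl) h2 /(_ erefl) h3 /(_ erefl) h4.
have := lerD (lerD (lerD h1 h2) h3) h4; rewrite -!big_split/= => h.
rewrite -(ler_pM2l (_ : 0 < 4)) ?ltr0n// mulr_sumr.
apply: le_trans (_ : lam * normsq n f + lam * normsq n f + lam * normsq n f
  + lam * normsq n f <= _); last by lra.
apply: le_trans h; apply: ler_sum => g _.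
rewrite !rmorphN/= ci rmorph1 opprK !scaleN1r !scale1r !scaleNr.
have := sq_parseval (conv_eq f g) (conv_dn f g) (conv_up f g).
have := sq_ge0 (conv_eq f g); lra.
Qed.

Section Slicing.
Variables (rho n : nat).
Local Notation r := rho.*2.
Local Notation hatr := (@hat R rho).

(** The hat moved to the lengths strictly between o - r and [o]. Adding [r] before the truncated
    subtraction admits windows that overlap the identity, so that every length up to n + 1 meets a
    complete family of windows. *)
Definition window (k : nat) (o : nat) : R := hatr (k + r - o)%N.

Let W : R := \sum_(0 <= k < r) hatr k ^+ 2.

Let S := (n + r).+2.

Lemma sum_window_sqr k : (k <= n.+1)%N -> \sum_(0 <= o < S) window k o ^+ 2 = W.
Proof.
move=> kn; apply: (@sum_window _ (fun j => hatr j ^+ 2) (k + r) S r).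
- by rewrite hat0 expr0n.
- by move=> j rj; rewrite hat_ge// expr0n.
- exact: leq_addl.
- by rewrite /S; lia.
Qed.

Lemma sum_window_step k : \sum_(0 <= o < S) (window k.+1 o - window k o) ^+ 2 <= r%:R.
Proof. exact: sum_hat_step. Qed.

(** Convolving a windowed function gives the window times the convolution, plus a commutator
    weighted by increments of the window. The length-preserving part commutes with the window, so
    only [conv_dn] and [conv_up] enter the error. *)
Lemma windowed_pointwise (t : R) f g : 0 < t -> (len g <= n.+1)%N ->
  (1 - t) * W * sq (convolve f g) - t^-1 * (2 * r%:R * (sq (conv_dn f g) + sq (conv_up f g))) <=
  \sum_(0 <= o < S) sq (convolve (fun h => (window (len h) o)%:C *: f h) g).
Proof.
move=> t0 gn; set l := len g in gn *.
pose dn o := window l.-1 o - window l o; pose up o := window l.+1 o - window l o.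
have sdn : \sum_(0 <= o < S) dn o ^+ 2 <= r%:R.
  rewrite /dn; case: l {gn dn up} => [|l] /=.
    by rewrite big1 ?ler0n// => o _; rewrite subrr expr0n.
  apply: le_trans (sum_window_step l); apply: ler_sum => o _.
  by rewrite -[leLHS]sqrrN opprB.
have sup : \sum_(0 <= o < S) up o ^+ 2 <= r%:R by exact: sum_window_step.
apply: le_trans (_ : \sum_(0 <= o < S) ((1 - t) * (window l o ^+ 2 * sq (convolve f g)) -
   t^-1 * (2 * (dn o ^+ 2 * sq (conv_dn f g)) + 2 * (up o ^+ 2 * sq (conv_up f g)))) <= _).
  rewrite sumrB -!mulr_sumr big_split/= -!mulr_sumr -!mulr_suml sum_window_sqr//.
  apply: lerB; first by rewrite mulrA.
  apply: ler_wpM2l; first by rewrite invr_ge0 ltW.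
  have hd := ler_wpM2r (sq_ge0 (conv_dn f g)) sdn.
  by have hu := ler_wpM2r (sq_ge0 (conv_up f g)) sup; move: hd hu; lra.
apply: ler_sum => o _.
have -> : convolve (fun h => (window (len h) o)%:C *: f h) g =
    (window l o)%:C *: convolve f g + ((dn o)%:C *: conv_dn f g + (up o)%:C *: conv_up f g).
  rewrite (conv_split (fun k => (window k o)%:C)) conv_parts !scalerDr.
  rewrite /dn /up -/l !rmorphB/= !scalerBl -!addrA; congr (_ + _).
  have zmodE (a b p q : H) : a + b = p + (q + (a + (- p + (b - q)))).
    by rewrite (addrA a) (addrCA q) (addrC q) subrK addrA (addrC p) subrK.
  exact: zmodE.
apply: le_trans (sqD_ge _ _ t0); rewrite sqZr lerD2l lerN2 ler_wpM2l ?invr_ge0 ?(ltW t0)//.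
by apply: le_trans (sqD_le _ _) _; rewrite !sqZr.
Qed.

(** Each windowed function lives on an annulus and costs [K2]. The commutator is paid for with the
    global constant [lam], through [conv_parseval]. *)
Lemma slicing (K2 lam t : R) f : local_conv_bound r K2 -> 0 <= K2 ->
  conv_bound lam -> 0 < t -> supported f n ->
  (1 - t) * W * normsq n.+1 (convolve f) - t^-1 * (2 * r%:R * (lam * normsq n f)) <=
  K2 * W * normsq n f.
Proof.
move=> loc K20 cb t0 fn.
apply: le_trans (_ : \sum_(0 <= o < S) normsq n.+1
    (convolve (fun h => (window (len h) o)%:C *: f h)) <= _).
  rewrite /normsq exchange_big/=.
  apply: le_trans (_ : \sum_(g <- gball n.+1) ((1 - t) * W * sq (convolve f g) -
     t^-1 * (2 * r%:R * (sq (conv_dn f g) + sq (conv_up f g)))) <= _).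
    rewrite sumrB -!mulr_sumr lerB// ler_wpM2l ?invr_ge0 ?(ltW t0)//.
    by rewrite ler_wpM2l ?mulr_ge0//; exact: (conv_parseval cb fn).
  rewrite !big_seq; apply: ler_sum => g; rewrite mem_gball => gn.
  exact: windowed_pointwise.
apply: le_trans (_ : \sum_(0 <= o < S) K2 *
    normsq n (fun h => (window (len h) o)%:C *: f h) <= _).
  (* For o <= r the truncated offset is 0: the window covers a ball and the suffix is empty. *)
  apply: ler_sum => o _; apply: (@annulus_conv_bound r K2 (o - r)) => //.
    by move=> g /fn ->; rewrite scaler0.
  move=> g; have [->|h _] := eqVneq (window (len g) o) 0; first by rewrite scale0r eqxx.
  have := hat_neq0 h; lia.
rewrite -mulr_sumr -mulrA ler_wpM2l// /normsq exchange_big/= mulr_sumr.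
rewrite !big_seq; apply: ler_sum => g; rewrite mem_gball => gn.
under eq_bigr => o _ do rewrite sqZr.
by rewrite -mulr_suml sum_window_sqr// leqW.
Qed.

End Slicing.

(** With t = 1/rho in [slicing], any admissible lam may be replaced by (K2 + (12/rho) lam) / (1 -
    1/rho). The infimum of the admissible constants is below all these values, which gives (1 -
    13/rho) inf E <= K2. For rho <= 13 the left side of the claim is not positive. *)
Lemma local_to_global (rho : nat) (K2 : R) n f : (0 < rho)%N ->
  local_conv_bound rho.*2 K2 -> 0 <= K2 -> supported f n ->
  (1 - 13 / rho%:R) * normsq n.+1 (convolve f) <= K2 * normsq n f.
Proof.
move=> rho0 loc K20 fn; set x := rho%:R : R.
have x0 : 0 < x by rewrite ltr0n.
have nn f' k : 0 <= normsq k f' := normsq_ge0 k f'.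
have [x13|x13] := leP x 13.
  apply: le_trans (_ : 0 <= _); last by rewrite mulr_ge0.
  by rewrite mulr_le0_ge0// subr_le0 ler_pdivlMr// mul1r.
pose W : R := \sum_(0 <= k < rho.*2) hat rho k ^+ 2.
have Wx : x ^+ 3 / 3 <= W by exact: sum_hat_sqr.
have W0 : 0 < W by apply: lt_le_trans Wx; rewrite divr_gt0// exprn_gt0.
have improve lam : 0 <= lam -> conv_bound lam ->
    conv_bound ((K2 + 12 / x * lam) / (1 - x^-1)).
  move=> lam0 cb k h hk; have ix0 : 0 < x^-1 by rewrite invr_gt0.
  have x1 : 0 < 1 - x^-1 by rewrite subr_gt0 invf_lt1//; lra.
  rewrite mulrAC ler_pdivlMr// mulrC.
  have := @slicing rho k K2 lam x^-1 h loc K20 cb ix0 hk; rewrite -/W invrK => sl.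
  rewrite -(ler_pM2l W0).
  (* The commutator costs 4 rho^2, which is 12/rho times the lower bound rho^3/3 of W. *)
  have key : x * (2 * rho.*2%:R * (lam * normsq k h)) <= W * (12 / x * (lam * normsq k h)).
    have ln : 0 <= lam * normsq k h by rewrite mulr_ge0.
    have k0 : x * (2 * rho.*2%:R) <= W * (12 / x).
      apply: le_trans (_ : x ^+ 3 / 3 * (12 / x) <= _).
        rewrite -muln2 natrM -/x le_eqVlt; apply/orP; left; apply/eqP.
        by field; rewrite gt_eqF.
      by rewrite ler_wpM2r// divr_ge0// ltW.
    by have := ler_wpM2r ln k0; rewrite -!mulrA.
  move: sl key; rewrite (mulrDl K2).
  set X := normsq k.+1 _; set Y := normsq k h.
  rewrite (_ : W * ((1 - x^-1) * X) = (1 - x^-1) * W * X); last by ring.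
  rewrite (_ : W * (K2 * Y + 12 / x * lam * Y) = K2 * W * Y + W * (12 / x * (lam * Y)));
    last by ring.
  by lra.
pose E := [set lam : R | 0 <= lam /\ conv_bound lam].
have Elb : has_lbound E by exists 0 => lam [].
have E0 : E !=set0 by have [lam lam0 cb] := conv_bound_exists; exists lam.
have x1 : 0 < 1 - x^-1 by rewrite subr_gt0 invf_lt1//; lra.
have infE : (1 - 13 / x) * inf E <= K2.
  have h lam : E lam -> ((1 - x^-1) * inf E - K2) / (12 / x) <= lam.
    move=> [lam0 cb]; rewrite ler_pdivrMr ?divr_gt0// lerBlDr mulrC -ler_pdivlMr//.
    apply: ge_inf => //; split; last first.
      by rewrite addrC [lam * _]mulrC; exact: improve.
    by rewrite divr_ge0 ?(ltW x1)// addr_ge0// mulr_ge0// divr_ge0// ltW.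
  have := lb_le_inf E0 h; rewrite ler_pdivrMr ?divr_gt0//.
  rewrite (_ : (1 - 13 / x) * inf E = (1 - x^-1) * inf E - inf E * (12 / x)); last by field; rewrite gt_eqF.
  lra.
have cbE : normsq n.+1 (convolve f) <= inf E * normsq n f.
  have [z|nz] := eqVneq (normsq n f) 0.
    have [lam [_ cb]] := E0; have := cb n f fn; rewrite z !mulr0.
    by [].
  have p : 0 < normsq n f by rewrite lt_neqAle eq_sym nz nn.
  rewrite -ler_pdivrMr//; apply: lb_le_inf => // lam [_ cb].
  by rewrite ler_pdivrMr//; exact: cb.
apply: le_trans (_ : (1 - 13 / x) * (inf E * normsq n f) <= _).
  by rewrite ler_wpM2l// subr_ge0 ler_pdivrMr// mul1r ltW.
by rewrite mulrA ler_wpM2r.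
Qed.

End Convolution.

(** * Transfer to random matrices *)

Lemma sum_uniq_eq (V : zmodType) (I : eqType) (r1 r2 : seq I) (f : I -> V) :
  uniq r1 -> uniq r2 -> (forall i, f i != 0 -> (i \in r1) = (i \in r2)) ->
  \sum_(i <- r1) f i = \sum_(i <- r2) f i.
Proof.
move=> u1 u2 e.
have nz r : \sum_(i <- r) f i = \sum_(i <- [seq i <- r | f i != 0]) f i.
  rewrite big_filter [RHS]big_mkcond/=; apply: eq_bigr => i _.
  by case: eqP => //= ->.
rewrite (nz r1) (nz r2); apply: perm_big; apply: uniq_perm; rewrite ?filter_uniq// => i.
by rewrite !mem_filter; case: eqP => //= /eqP /e.
Qed.

Section Model.
Context {R : realType} {A : cstarAlgType R} {d : nat} {H : hilbertType R}.
Variables (a : 'I_(d + d).+1 -> A) (pi : starRep A H).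
Local Notation F := (free_group d).

(** Index 0 is sent to the identity, the default of [oapp], so the constant term is one more summand
    of the convolution. *)
Definition gen (t : 'I_(d + d).+1) : F := oapp free_gens 1%g (unlift ord0 t).

Definition coef_op t : H -> H := rep_op pi (a t).

Definition gen_inv t : F := (gen t)^-1%g.

Lemma coef_op_lin t (k : R[i]) x y :
  coef_op t (k *: x + y) = k *: coef_op t x + coef_op t y.
Proof. by have [h _] := rep_bounded pi (a t); exact: h. Qed.

Lemma coef_op0 t : coef_op t 0 = 0.
Proof. by have := coef_op_lin t (-1) 0 0; rewrite !scaleN1r !addNr. Qed.

Lemma coef_opZ t k x : coef_op t (k *: x) = k *: coef_op t x.
Proof. by have := coef_op_lin t k x 0; rewrite !addr0 coef_op0 addr0. Qed.

Lemma coef_op_sum t (I : Type) (r : seq I) (f : I -> H) :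
  coef_op t (\sum_(i <- r) f i) = \sum_(i <- r) coef_op t (f i).
Proof.
elim: r => [|i r IH]; first by rewrite !big_nil coef_op0.
by rewrite !big_cons -IH -[f i]scale1r coef_op_lin !scale1r.
Qed.

Lemma coef_op_bnd t : exists2 K : R, 0 <= K & forall x, sq (coef_op t x) <= K * sq x.
Proof.
have [_ [M hM]] := rep_bounded pi (a t); exists (M ^+ 2); first exact: sqr_ge0.
move=> x; rewrite -lecR rmorphM/= !sq_norm rmorphXn/= -exprMn.
rewrite ler_sqr ?nnegrE//; first exact: hM.
exact: le_trans (hM x).
Qed.

Lemma len_free_gens i : len (@free_gens d i) = 1%N.
Proof. by rewrite /free_gens; case: fintype.split. Qed.

Lemma len_gen t : (len (gen t) <= 1)%N.
Proof.
by rewrite /gen; case: unliftP => [j _|_] //=; rewrite len_free_gens.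
Qed.

Lemma len_gen_inv t : (len (gen_inv t) <= 1)%N.
Proof. by rewrite len_inv len_gen. Qed.

Lemma A_freeE : A_free a = [seq (a t, lambda (gen t)) | t <- enum 'I_(d + d).+1].
Proof.
rewrite enum_ordSl /= {1}/gen unlift_none /A_free; congr (_ :: _).
by rewrite -map_comp; apply: eq_map => i /=; rewrite /gen liftK.
Qed.

Notation convA := (convolve coef_op gen_inv).

Lemma tfun_A_free (x : seq (H * l2 R F)) :
  tfun (tensor_op pi (A_free a) x) =1 convA (tfun x).
Proof.
move=> g; rewrite /tfun /tensor_op A_freeE big_allpairs_dep/= big_map big_enum/=.
apply: eq_bigr => t _; rewrite coef_op_sum; apply: eq_bigr => v _.
by rewrite coef_opZ.
Qed.

Section Matrices.
Context {N : nat}.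
Variable u : 'I_d -> 'M[R[i]]_N.
Hypothesis uu : forall j, u j \is unitarymx.
Local Notation Wd g := (word_mx u (word g)).

Lemma A_mxE : A_mx a u = [seq (a t, mx_elt (Wd (gen t))) | t <- enum 'I_(d + d).+1].
Proof.
rewrite enum_ordSl /= {1}/gen unlift_none /A_mx; congr (_ :: _).
rewrite -map_comp; apply: eq_map => i /=; rewrite /gen liftK/=.
congr (_, mx_elt _); rewrite /unitaries /free_gens.
by case: fintype.split => j; rewrite word_mx1.
Qed.

Lemma colvec_in (M : 'M[R[i]]_N) (c : 'I_N) : (fun i => M i c : R[i]^o) \in l2_pred.
Proof.
by apply/l2_predP; rewrite /fin_sum nnsum_ord ?ltry// => i; exact: sqmod_ge0.
Qed.

Definition colvec M c : l2 R 'I_N := L2 (colvec_in M c).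

(* f is transplanted to H (x) C^N by delta_h |-> U_h e_c. *)
Definition test_vector n (f : F -> H) (c : 'I_N) : seq (H * l2 R 'I_N) :=
  [seq (f h, colvec (Wd h) c) | h <- gball n].

Definition matrix_normsq n (f : F -> H) : R :=
  \sum_c \sum_i sq (\sum_(h <- gball n) Wd h i c *: f h).

Lemma Wd_mul g h : Wd (g * h)%g = Wd g *m Wd h.
Proof. by rewrite word_mulg word_mx_mul. Qed.

Lemma tfun_test_vector n f c i :
  tfun (test_vector n f c) i = \sum_(h <- gball n) Wd h i c *: f h.
Proof. by rewrite /tfun big_map. Qed.

Lemma tfun_A_mx n f c i : supported f n ->
  tfun (tensor_op pi (A_mx a u) (test_vector n f c)) i =
  \sum_(h <- gball n.+1) Wd h i c *: convA f h.
Proof.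
move=> fn; rewrite /tfun /tensor_op A_mxE big_allpairs_dep/= big_map big_enum/=.
under [RHS]eq_bigr => h _ do rewrite scaler_sumr.
rewrite [RHS]exchange_big/=; apply: eq_bigr => t _; rewrite big_map/=.
(* Substitution of g_t h for h: the word matrices are multiplicative on the free group since the
   [u j] are unitary. *)
transitivity (\sum_(h <- map (fun h => gen t * h)%g (gball n))
    Wd h i c *: coef_op t (f (gen_inv t * h)%g)).
  rewrite big_map; apply: eq_bigr => h _; rewrite /gen_inv mulKg Wd_mul mxE.
  by [].
apply: sum_uniq_eq; rewrite ?map_inj_uniq ?gball_uniq//; first exact: mulgI.
move=> g; have [->|fg _] := eqVneq (f (gen_inv t * g)%g) 0.
  by rewrite coef_op0 scaler0 eqxx.
have hn : (len (gen_inv t * g)%g <= n)%N by rewrite leqNgt; apply: contra fg => /fn ->.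
rewrite mem_gball; have -> : (len g <= n.+1)%N.
  by have [] := len_step g (len_gen_inv t); lia.
by apply/mapP; exists (gen_inv t * g)%g; rewrite ?mem_gball// /gen_inv mulVKg.
Qed.

Lemma matrix_normsq_tensor n f :
  matrix_normsq n f = \sum_c tensor_norm (test_vector n f c) ^+ 2.
Proof.
apply: eq_bigr => c _; apply: EFin_inj; rewrite -tensor_norm_sq nnsum_ord.
  by congr (_%:E); apply: eq_bigr => i _; rewrite tfun_test_vector.
by move=> i; exact: sq_ge0.
Qed.

Lemma matrix_normsq_tensor_A n f : supported f n ->
  matrix_normsq n.+1 (convA f) =
  \sum_c tensor_norm (tensor_op pi (A_mx a u) (test_vector n f c)) ^+ 2.
Proof.
move=> fn; apply: eq_bigr => c _; apply: EFin_inj; rewrite -tensor_norm_sq nnsum_ord.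
  by congr (_%:E); apply: eq_bigr => i _; rewrite tfun_A_mx.
by move=> i; exact: sq_ge0.
Qed.

Lemma tensor_op_scale (I : choiceType) (B : opAlg (l2 R I)) (t : seq (A * B)) (k : R)
    (x : seq (H * l2 R I)) :
  tensor_op pi t [seq (k%:C *: v.1, v.2) | v <- x] =
  [seq (k%:C *: v.1, v.2) | v <- tensor_op pi t x].
Proof.
rewrite /tensor_op map_allpairs allpairs_mapr; apply: eq_allpairs => // v w /=.
have [h _] := rep_bounded pi v.1; congr (_, _).
have h0 : rep_op pi v.1 0 = 0 by have := h (-1) 0 0; rewrite !scaleN1r !addNr.
by have := h k%:C w.1 0; rewrite !addr0 h0 addr0.
Qed.

Lemma rep_tensor_norm_bound (I : choiceType) (B : opAlg (l2 R I)) (t : seq (A * B))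
    (x : seq (H * l2 R I)) (m : R) : (rep_tensor_norm pi t <= m%:E)%E ->
  tensor_norm (tensor_op pi t x) <= m * tensor_norm x.
Proof.
move=> hm.
have ub (y : seq (H * l2 R I)) : tensor_norm y <= 1 -> tensor_norm (tensor_op pi t y) <= m.
  by move=> y1; rewrite -lee_fin; apply: le_trans hm; apply: ereal_sup_ubound; exists y.
have m0 : 0 <= m by apply: le_trans (ub [::] _); rewrite /tensor_norm ?sqrtr_ge0// big_nil sqrtr0.
(* A list of norm 0 stays in the unit ball under every scaling, so an image of positive norm could
   be blown up to norm m + 1. *)
have [z|nz] := eqVneq (tensor_norm x) 0.
  rewrite z mulr0 leNgt; apply/negP => p.
  pose k := (m + 1) / tensor_norm (tensor_op pi t x).
  have k0 : 0 < k by rewrite divr_gt0// ltr_wpDl.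
  have := ub [seq (k%:C *: v.1, v.2) | v <- x].
  rewrite tensor_op_scale !tensor_norm_scale z mulr0 ler01 ger0_norm ?(ltW k0)//.
  by rewrite /k divfK ?gt_eqF// => /(_ isT); lra.
have p : 0 < tensor_norm x by rewrite lt_neqAle eq_sym nz tensor_norm_ge0.
have := ub [seq (((tensor_norm x)^-1)%:C *: v.1, v.2) | v <- x].
rewrite tensor_op_scale !tensor_norm_scale ger0_norm ?invr_ge0 ?tensor_norm_ge0//.
by rewrite mulVf// lexx => /(_ isT); rewrite mulrC ler_pdivrMr.
Qed.

Lemma matrix_norm_bound n f (m : R) : supported f n ->
  (rep_tensor_norm pi (A_mx a u) <= m%:E)%E ->
  matrix_normsq n.+1 (convA f) <= m ^+ 2 * matrix_normsq n f.
Proof.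
move=> fn hm; rewrite matrix_normsq_tensor_A// matrix_normsq_tensor mulr_sumr.
apply: ler_sum => c _; rewrite -exprMn ler_sqr ?nnegrE ?tensor_norm_ge0//.
  exact: rep_tensor_norm_bound.
exact: le_trans (tensor_norm_ge0 _) (rep_tensor_norm_bound _ hm).
Qed.

Definition offdiag n (f : F -> H) : R :=
  \sum_(h <- gball n) \sum_(k <- gball n | k != h)
    cmod (ip (f h) (f k)) * cmod (\tr (Wd (h * k^-1)%g)).

Lemma matrix_normsq_dev n f : `|matrix_normsq n f - N%:R * normsq n f| <= offdiag n f.
Proof.
have trE h k : \tr (Wd (h * k^-1)%g) = \tr (Wd h *m adjmx (Wd k)).
  by rewrite Wd_mul -word_mx_inv.
have E : (matrix_normsq n f)%:C = \sum_(h <- gball n) \sum_(k <- gball n)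
    ip (f h) (f k) * \tr (Wd (h * k^-1)%g).
  under [RHS]eq_bigr => h _ do under eq_bigr => k _ do rewrite trE.
  rewrite /matrix_normsq rmorph_sum/=.
  under eq_bigr => c _ do rewrite rmorph_sum/=.
  under eq_bigr => c _ do under eq_bigr => i _ do rewrite -sqE ip_suml.
  under eq_bigr => c _ do rewrite exchange_big/=.
  rewrite exchange_big/=; apply: eq_bigr => h _.
  under eq_bigr => c _ do under eq_bigr => i _ do rewrite ip_sumr.
  under eq_bigr => c _ do rewrite exchange_big/=.
  rewrite exchange_big/=; apply: eq_bigr => k _.
  rewrite /mxtrace mulr_sumr exchange_big/=; apply: eq_bigr => i _.
  rewrite mxE mulr_sumr; apply: eq_bigr => c _.
  by rewrite ipZl ipZr adjmxE; ring.
have D : (N%:R * normsq n f)%:C = \sum_(h <- gball n) \sum_(k <- gball n | k == h)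
    ip (f h) (f k) * \tr (Wd (h * k^-1)%g).
  under [RHS]eq_bigr => h _ do under eq_bigr => k _ do rewrite trE.
  rewrite /normsq mulr_sumr rmorph_sum/= big_seq [RHS]big_seq; apply: eq_bigr => h hB.
  rewrite -big_filter (@filter_pred1_uniq _ (gball n) h) ?gball_uniq// big_seq1.
  by rewrite (mulmx_adj (word_mx_unitary uu _)) mxtrace1 sqE -(rmorph_nat (@real_complex R)) -rmorphM/= mulrC.
have -> : `|matrix_normsq n f - N%:R * normsq n f| =
    cmod (\sum_(h <- gball n) \sum_(k <- gball n | k != h)
      ip (f h) (f k) * \tr (Wd (h * k^-1)%g)).
  rewrite -cmod_real rmorphB/= E D -sumrB; congr cmod; apply: eq_bigr => h _.
  by rewrite (bigID (fun k => k == h))/= addrC addrK.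
apply: le_trans (cmod_sum _ _ _) _; apply: ler_sum => h _.
by apply: le_trans (cmod_sum _ _ _) _; apply: ler_sum => k _; rewrite cmodM.
Qed.

End Matrices.

End Model.

(** The integral of a nonnegative function is a supremum over the simple functions below it, and
    this is monotone. It serves to compare the random norm with a measurable minorant. *)
Lemma le_integral_nonneg (R : realType) (disp : measure_display)
  (T : measurableType disp) (mu : {measure set T -> \bar R}) (f1 f2 : T -> \bar R) :
  (forall x, 0 <= f1 x)%E -> (forall x, f1 x <= f2 x)%E ->
  (\int[mu]_x f1 x <= \int[mu]_x f2 x)%E.
Proof.
move=> f10 f12; rewrite !ge0_integralTE//; last first.
  by move=> x; exact: le_trans (f12 x).
apply: le_ereal_sup => _ [h hf <-]; exists h => // x.
exact: le_trans (hf x) (f12 x).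
Qed.

Section ZeroRepresentation.
Context {R : realType} {A : cstarAlgType R}.
Local Notation Z := (l2 R void).

Lemma l2_void (x y : Z) : x = y.
Proof. by apply/val_inj/funext; case. Qed.

(** It exists for every algebra, the zero algebra included, so the supremum in [min_norm] runs over
    a nonempty set and is at least 0. *)
Definition zero_rep : starRep A Z.
Proof.
refine (@StarRep R A Z (fun _ x => x) _ _ _ _ _) => //.
- by move=> a; exact: bounded_op_id.
- by move=> k a b x; exact: l2_void.
Defined.

Lemma min_norm_ge0 (K : hilbertType R) (B : opAlg K) (t : seq (A * B)) :
  (0 <= min_norm t)%E.
Proof.
apply: le_trans (_ : (rep_tensor_norm zero_rep t <= _)%E); last first.
  by apply: ereal_sup_ubound; exists Z, zero_rep.
apply: ereal_sup_ubound; exists [::] => /=.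
  by rewrite /tensor_norm big_nil sqrtr0.
have -> : tensor_op zero_rep t [::] = [::] by rewrite /tensor_op; elim: t => //.
by rewrite /tensor_norm big_nil sqrtr0.
Qed.

End ZeroRepresentation.

(** * The expected norm in a fixed representation *)

Section RandomModel.
Context {R : realType} {A : cstarAlgType R} {d N : nat} {H : hilbertType R}.
Variables (a : 'I_(d + d).+1 -> A) (pi : starRep A H).
Context {disp : measure_display} {T : measurableType disp}.
Variables (P : probability T R) (U : 'I_d -> T -> 'M[R[i]]_N).
Hypothesis haarU : forall j, haar_unitary P (U j).
Hypothesis indepU : mutually_independent P U.
Hypothesis N_gt0 : (0 < N)%N.
Local Notation F := (free_group d).
Local Notation tU := (tuple_rv U).
Local Notation convA := (convolve (coef_op a pi) (@gen_inv d)).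
Local Notation tr g om := (\tr (word_mx (tU om) (word g))).

Let uU w := tuple_rv_unitary haarU w.

Lemma bounded_rv_trace (g : F) : bounded_rv (fun om => cmod (tr g om)).
Proof. exact: (regular_bounded_cmod haarU (regular_tr (regular_word (word g)))). Qed.

(** From |z| <= (1 + |z|^2) / 2 and the second moment bound; the constant term is absorbed because
    32^n >= 1. *)
Lemma Ex_cmod_trace n (g : F) : g != 1%g -> (len g <= n)%N ->
  Ex P (fun om => cmod (tr g om)) <= 32 ^+ n.
Proof.
move=> g1 gn; have b := bounded_rv_trace g.
have b2 : bounded_rv (fun om => cmod (tr g om) ^+ 2).
  by under eq_fun do rewrite expr2; exact: bounded_rvM.
apply: le_trans (_ : Ex P (fun om => 2^-1 + 2^-1 * cmod (tr g om) ^+ 2) <= _).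
  apply: Ex_le => //.
    by apply: bounded_rvD; [exact: bounded_rv_cst|exact: bounded_rvZ].
  by move=> om; have := sqr_ge0 (cmod (tr g om) - 1); rewrite sqrrB expr1n mulr1; lra.
rewrite (ExD P (bounded_rv_cst _) (bounded_rvZ _ b2)) Ex_cst (ExZ P _ b2).
have wn0 : word g != [::].
  by apply: contra g1 => /eqP e; apply/eqP/val_inj; rewrite /= e.
have := word_trace_bound haarU indepU N_gt0 (word_reduced g) wn0.
have : (32 : R) ^+ size (word g) <= 32 ^+ n by rewrite ler_weXn2l// ler1n.
have : 1 <= (32 : R) ^+ n by rewrite exprn_ege1// ler1n.
by lra.
Qed.

Lemma bounded_rv_offdiag n (f : F -> H) : bounded_rv (fun om => offdiag (tU om) n f).
Proof.
apply: bounded_rv_sum => h; under eq_fun do rewrite big_mkcond/=.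
apply: bounded_rv_sum => k; case: (k != h); last exact: bounded_rv_cst.
by apply: bounded_rvZ; exact: (bounded_rv_trace (h * k^-1)%g).
Qed.

(** For h and k in the ball, h k^-1 has length at most 2n, and |<f(h), f(k)>| is at most the mean of
    the squared norms. Summing over the free index produces the cardinality of the ball. *)
Lemma Ex_offdiag n (f : F -> H) :
  Ex P (fun om => offdiag (tU om) n f) <=
  32 ^+ (n + n) * (size (gball (d := d) n))%:R * normsq n f.
Proof.
rewrite /offdiag.
under eq_fun do under eq_bigr => h _ do rewrite big_mkcond/=.
have b h k : bounded_rv (fun om => if k != h then
    cmod (ip (f h) (f k)) * cmod (tr (h * k^-1)%g om) else 0).
  case: (k != h); last exact: bounded_rv_cst.
  by apply: bounded_rvZ; exact: (bounded_rv_trace (h * k^-1)%g).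
rewrite Ex_sum; last by move=> h; apply: bounded_rv_sum => k; exact: b.
under eq_bigr => h _ do rewrite (Ex_sum _ _ (b h)).
apply: le_trans (_ : \sum_(h <- gball n) \sum_(k <- gball n)
    32 ^+ (n + n) * ((sq (f h) + sq (f k)) / 2) <= _).
  rewrite !big_seq; apply: ler_sum => h hB; rewrite !big_seq; apply: ler_sum => k kB.
  rewrite !mem_gball in hB kB.
  have s0 : 0 <= (sq (f h) + sq (f k)) / 2 by rewrite divr_ge0// addr_ge0// sq_ge0.
  case: (eqVneq k h) => [_|kh]; first by rewrite Ex_cst mulr_ge0// exprn_ge0.
  rewrite (ExZ P _ (bounded_rv_trace (h * k^-1)%g)) mulrC.
  apply: ler_pM; rewrite ?cmod_ge0//; last exact: ip_sq_bound.
    rewrite -[X in X <= _](Ex_cst P); apply: Ex_le; first exact: bounded_rv_cst.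
      exact: (bounded_rv_trace (h * k^-1)%g).
    by move=> om; exact: cmod_ge0.
  apply: Ex_cmod_trace.
    by apply: contra kh => /eqP e; rewrite -(mulgVK k h) e mul1g.
  apply: leq_trans (len_mul _ _) _; rewrite len_inv; exact: leq_add.
have cst (c : R) : \sum_(k <- gball (d := d) n) c = (size (gball (d := d) n))%:R * c.
  by rewrite big_const_seq count_predT iter_addr_0 mulr_natl.
under eq_bigr => h _ do
  rewrite -mulr_sumr -mulr_suml big_split/= cst -/(normsq n f).
rewrite -mulr_sumr -mulr_suml big_split/= -mulr_sumr cst -/(normsq n f) -mulrA.
by rewrite ler_wpM2l ?exprn_ge0//; lra.
Qed.

(** The relative off-diagonal error at radius n + 1, where A_F f lives when f lives on radius n; it
    dominates the error of f as well. *)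
Definition trace_error n : R :=
  32 ^+ (n.+1 + n.+1) * (size (gball (d := d) n.+1))%:R / N%:R.

(** Let x and y be the off-diagonal errors of A_F f and f, relative to N times their squared norms
    [al] and [be]. The squared norm of A_N is at least (al / be) (1 - x) / (1 + y), hence the norm
    is at least sqrt(al / be) (1 - x - y). This is linear in the errors, whose means are at most
    [trace_error n]. *)
Lemma expected_norm_bound n (f : F -> H) (I : R) : supported f n ->
  0 <= 1 - 2 * trace_error n ->
  (\int[P]_om min_norm (A_mx a (fun j => U j om)) <= I%:E)%E ->
  (1 - 2 * trace_error n) ^+ 2 * normsq n.+1 (convA f) <= I ^+ 2 * normsq n f.
Proof.
move=> fn err hI; set al := normsq n.+1 _; set be := normsq n f.
have NR : 0 < N%:R :> R by rewrite ltr0n.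
have al0 : 0 <= al := normsq_ge0 _ _; have be0 : 0 <= be := normsq_ge0 _ _.
have [z|alnz] := eqVneq al 0; first by rewrite z mulr0 mulr_ge0// sqr_ge0.
have alp : 0 < al by rewrite lt_neqAle eq_sym alnz.
have bep : 0 < be.
  rewrite lt_neqAle eq_sym be0 andbT; apply: contraNneq alnz => z.
  have [lam _ cb] := conv_bound_exists (@gen_inv d) (coef_op_bnd a pi).
  by have := cb n f fn; rewrite -/al -/be z mulr0 => h; apply/eqP/le_anti; rewrite h.
pose x om := offdiag (tU om) n.+1 (convA f) / (N%:R * al).
pose y om := offdiag (tU om) n f / (N%:R * be).
have off0 k (g : F -> H) om : 0 <= offdiag (tU om) k g.
  by apply: sumr_ge0 => ? _; apply: sumr_ge0 => ? _; rewrite mulr_ge0// cmod_ge0.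
have x0 om : 0 <= x om by rewrite divr_ge0// mulr_ge0// ltW.
have y0 om : 0 <= y om by rewrite divr_ge0// mulr_ge0// ltW.
pose L om := Num.sqrt (al / be) * (1 - x om - y om).
have point om : ((L om)%:E <= min_norm (A_mx a (fun j => U j om)))%E.
  have := min_norm_ge0 (A_mx a (fun j => U j om)).
  case e : (min_norm _) => [m| |] // m0; last by rewrite leey.
  rewrite lee_fin in m0 *.
  have hm : (rep_tensor_norm pi (A_mx a (tU om)) <= m%:E)%E.
    by rewrite -e; apply: ereal_sup_ubound; exists H, pi.
  have := matrix_norm_bound (uU om) fn hm.
  have := matrix_normsq_dev (uU om) n.+1 (convA f).
  rewrite -/al ler_distl => /andP[d1 _].
  have := matrix_normsq_dev (uU om) n f; rewrite -/be ler_distl => /andP[_ d2] d3.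
  have [s1|s1] := leP (1 - x om - y om) 0.
    by apply: le_trans m0; rewrite mulr_ge0_le0// sqrtr_ge0.
  have main : al * (1 - x om) <= m ^+ 2 * (be * (1 + y om)).
    rewrite -(ler_pM2l NR).
    have -> : N%:R * (al * (1 - x om)) = N%:R * al - offdiag (tU om) n.+1 (convA f).
      by rewrite /x; field; rewrite !gt_eqF.
    have -> : N%:R * (m ^+ 2 * (be * (1 + y om))) =
        m ^+ 2 * (N%:R * be + offdiag (tU om) n f).
      by rewrite /y; field; rewrite !gt_eqF.
    apply: le_trans d1 _; apply: le_trans d3 _.
    by rewrite ler_wpM2l ?sqr_ge0.
  (* Since 0 <= 1 - x - y <= 1, one square may be dropped, and (1 + y) (1 - x - y) = 1 - x - x y -
     y^2. *)
  have elem : (1 + y om) * (1 - x om - y om) ^+ 2 <= 1 - x om.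
    have := x0 om; have := y0 om; move: s1.
    move: (x om) (y om) => p q s1 q0 p0.
    have h1 : (1 - p - q) ^+ 2 <= 1 - p - q.
      by rewrite expr2 ler_piMr// ?(ltW s1)//; lra.
    have q1 : 0 <= 1 + q by lra.
    apply: le_trans (ler_wpM2l q1 h1) _.
    have := mulr_ge0 p0 q0; have := sqr_ge0 q; nra.
  have L0 : 0 <= L om by rewrite mulr_ge0 ?sqrtr_ge0 ?(ltW s1).
  suff : L om ^+ 2 <= m ^+ 2 by rewrite ler_sqr ?nnegrE//.
  have y1 : 0 < 1 + y om by have := y0 om; lra.
  rewrite /L exprMn sqr_sqrtr ?divr_ge0// mulrAC ler_pdivrMr//.
  rewrite -(ler_pM2r y1).
  apply: le_trans (_ : al * (1 - x om) <= _); last by rewrite -mulrA.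
  by rewrite -mulrA ler_wpM2l// mulrC.
have bx : bounded_rv x.
  by rewrite /x; under eq_fun do rewrite mulrC; apply: bounded_rvZ; exact: bounded_rv_offdiag.
have bY : bounded_rv y.
  by rewrite /y; under eq_fun do rewrite mulrC; apply: bounded_rvZ; exact: bounded_rv_offdiag.
have b1x : bounded_rv (fun om => 1 - x om) by apply: bounded_rvB => //; exact: bounded_rv_cst.
have bL : bounded_rv L by apply: bounded_rvZ; exact: bounded_rvB.
(* The positive part of [L]: integrals are compared for nonnegative functions, and the norm is
   nonnegative. *)
pose X om := 2^-1 * (L om + `|L om|).
have bX : bounded_rv X by apply: bounded_rvZ; apply: bounded_rvD => //; exact: bounded_rv_norm.
have X0 om : 0 <= X om by rewrite mulr_ge0// -lerBlDl sub0r -normrN ler_norm.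
have LX om : L om <= X om by rewrite /X; have := ler_norm (L om); lra.
have XM om : ((X om)%:E <= min_norm (A_mx a (fun j => U j om)))%E.
  rewrite /X; have [l0|l0] := leP 0 (L om).
    by rewrite ger0_norm// (_ : 2^-1 * _ = L om)//; lra.
  by rewrite ltr0_norm// subrr mulr0 min_norm_ge0.
have EXI : Ex P X <= I.
  rewrite -lee_fin; apply: le_trans hI.
  apply: le_trans (_ : (\int[P]_om (X om)%:E <= _)%E); last first.
    by apply: le_integral_nonneg => // om; rewrite lee_fin.
  rewrite /Ex /Rintegral fineK//.
  exact: (integrable_fin_num measurableT (bounded_rv_integrable P bX)).
have err_le k (g : F -> H) : (k <= n.+1)%N -> 0 < normsq k g ->
    Ex P (fun om => offdiag (tU om) k g / (N%:R * normsq k g)) <= trace_error n.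
  move=> kn g0.
  under eq_fun do rewrite mulrC.
  rewrite (ExZ P _ (bounded_rv_offdiag k g)) mulrC ler_pdivrMr ?mulr_gt0//.
  apply: le_trans (Ex_offdiag k g) _.
  rewrite /trace_error mulrA divfK ?gt_eqF// ler_wpM2r ?(ltW g0)//.
  apply: ler_pM; rewrite ?exprn_ge0//.
    by rewrite ler_weXn2l ?ler1n// leq_add.
  rewrite ler_nat; apply: uniq_leq_size; first exact: gball_uniq.
  by move=> h; rewrite !mem_gball => /leq_trans; apply.
have EL : Num.sqrt (al / be) * (1 - 2 * trace_error n) <= Ex P L.
  rewrite /L (ExZ P _ (bounded_rvB b1x bY)) ler_wpM2l ?sqrtr_ge0//.
  rewrite (ExB P b1x bY) (ExB P (bounded_rv_cst _) bx) Ex_cst.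
  have := err_le n.+1 (convA f) (leqnn _) alp; have := err_le n f (leqnSn _) bep.
  by rewrite -/(x _) /x /y; lra.
have fin : Num.sqrt (al / be) * (1 - 2 * trace_error n) <= I.
  by apply: le_trans EL _; apply: le_trans EXI; exact: Ex_le.
have l0 : 0 <= Num.sqrt (al / be) * (1 - 2 * trace_error n) by rewrite mulr_ge0// sqrtr_ge0.
have := fin; rewrite -ler_sqr ?nnegrE//; last exact: le_trans fin.
rewrite exprMn sqr_sqrtr ?divr_ge0// mulrAC ler_pdivrMr//.
by rewrite mulrC.
Qed.

End RandomModel.

(** * The norm of A_F and the choice of the radius *)

Section FreeNorm.
Context {R : realType} {A : cstarAlgType R} {d : nat} {H : hilbertType R}.
Variables (a : 'I_(d + d).+1 -> A) (pi : starRep A H).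
Local Notation F := (free_group d).

(** A partial sum of the squared norm over finitely many points sees the vector only on a ball, so
    the vector may be truncated. One extra unit of radius keeps the convolution unchanged at those
    points. *)
Lemma free_tensor_bound (lam : R) (x : seq (H * l2 R F)) : 0 <= lam ->
  conv_bound (coef_op a pi) (@gen_inv d) lam -> tensor_norm x <= 1 ->
  tensor_norm (tensor_op pi (A_free a) x) ^+ 2 <= lam.
Proof.
move=> lam0 cb x1; rewrite -lee_fin -tensor_norm_sq.
apply: ge_ereal_sup => _ [X [Xfin _] <-].
rewrite fsumEFin// lee_fin fsbig_finite//=; set s := finmap.enum_fset _.
pose n := \max_(g <- s) len g; pose f := tfun x.
pose f' g := if (len g <= n.+1)%N then f g else 0.
have f'n : supported f' n.+1 by move=> g gn; rewrite /f' leqNgt gn.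
have sn g : g \in s -> (len g <= n)%N by move=> gs; apply: leq_bigmax_seq.
apply: le_trans (_ : \sum_(g <- s) sq (convolve (coef_op a pi) (@gen_inv d) f' g) <= _).
  rewrite !big_seq; apply: ler_sum => g /sn gn; rewrite tfun_A_free.
  rewrite le_eqVlt; apply/orP; left; apply/eqP; congr sq; apply: eq_bigr => t _.
  rewrite /f' (_ : (len (gen_inv t * g)%g <= n.+1)%N)//.
  by have [] := len_step g (len_gen_inv t); lia.
apply: le_trans (_ : normsq n.+2 (convolve (coef_op a pi) (@gen_inv d) f') <= _).
  apply: sum_uniq_le; first exact: finmap.fset_uniq.
    by move=> g; exact: sq_ge0.
  by move=> g /sn gn _; rewrite mem_gball; lia.
apply: le_trans (cb _ _ f'n) _; rewrite -[leRHS]mulr1 ler_wpM2l//.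
have x2 : tensor_norm x ^+ 2 <= 1 by rewrite expr_le1// tensor_norm_ge0.
apply: le_trans x2; rewrite -lee_fin -tensor_norm_sq.
apply: esum_ge; exists [set` gball n.+1]; first by split=> //; exact: finite_seq.
rewrite fsumEFin; last exact: finite_seq.
rewrite lee_fin -fsbig_seq ?gball_uniq//.
rewrite /normsq !big_seq; apply: ler_sum => g; rewrite mem_gball => gn.
by rewrite /f' gn.
Qed.

End FreeNorm.

(** With D = 2d one has 32 <= D^5 and 2d + 1 <= D^2, and rho <= D^rho provides the factor 1/rho. The
    exponents add up to 25 rho + 12, which is below 72 rho. *)
Lemma trace_error_le (R : realType) (d N rho : nat) : (0 < d)%N -> (0 < rho)%N ->
  (((2 * d) ^ 72) ^ rho <= N)%N -> @trace_error R d N rho.*2 <= rho%:R^-1.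
Proof.
move=> d0 rho0 hN; set D := (2 * d)%N in hN.
have D2 : (2 <= D)%N by rewrite /D; lia.
have N0 : (0 < N)%N by apply: leq_trans hN; rewrite !expn_gt0; lia.
have main : (32 ^ (rho.*2.+1 + rho.*2.+1) * size (gball (d := d) rho.*2.+1) * rho <= N)%N.
  apply: leq_trans hN.
  have h1 : (32 ^ (rho.*2.+1 + rho.*2.+1) <= D ^ (5 * (rho.*2.+1 + rho.*2.+1)))%N.
    rewrite expnM leq_exp2r ?addnS//.
    by apply: (@leq_trans (2 ^ 5)); rewrite ?leq_exp2r.
  have h2 : (size (gball (d := d) rho.*2.+1) <= D ^ (2 * rho.*2.+1))%N.
    apply: leq_trans (size_gball _) _; rewrite expnM leq_exp2r//.
    by rewrite /D; nia.
  have h3 : (rho <= D ^ rho)%N.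
    by apply: leq_trans (ltnW (ltn_expl rho (ltnSn 1))) _; rewrite leq_exp2r.
  apply: leq_trans (leq_mul (leq_mul h1 h2) h3) _.
  by rewrite -!expnD -expnM leq_exp2l//; lia.
rewrite /trace_error ler_pdivrMr ?ltr0n// [leRHS]mulrC ler_pdivlMr ?ltr0n//.
by rewrite -natrX -!natrM ler_nat.
Qed.

Theorem theorem1p8 (R : realType) :
  exists2 c : R, 0 < c &
  forall (d N : nat), (1 <= d)%N -> (2 <= N)%N ->
  forall (A1 : cstarAlgType R) (a : 'I_(d + d).+1 -> A1)
    (disp : measure_display) (T : measurableType disp) (P : probability T R)
    (U : 'I_d -> T -> 'M[R[i]]_N),
  (forall j, haar_unitary P (U j)) -> mutually_independent P U ->
  (min_norm (A_free a) * (1 - c * ln (2 * d)%:R / ln N%:R)%:E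
   <= \int[P]_w min_norm (A_mx a (fun j => U j w)))%E.
Proof.
(* 2160 = 15 * 144: the losses 13/rho and 2/rho add up to 15/rho, and ln N <= 72 (rho + 1) ln D <=
   144 rho ln D. *)
exists 2160; first by rewrite ltr0n.
move=> d N d1 N2 A1 a disp T P U haarU indepU.
set D := (2 * d)%N; set del := 1 - _.
have D2 : (2 <= D)%N by rewrite /D; lia.
have lnN : 0 < ln N%:R :> R by rewrite ln_gt0// ltr1n.
have lnD : 0 < ln D%:R :> R by rewrite ln_gt0// ltr1n.
have int0 : (0 <= \int[P]_w min_norm (A_mx a (fun j => U j w)))%E.
  by apply: integral_ge0 => w _; exact: min_norm_ge0.
have [del0|del0] := leP del 0.
  by apply: le_trans int0; rewrite mule_ge0_le0 ?min_norm_ge0// lee_fin.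
(* The largest rho with D^(72 rho) <= N, as large as the trace bound is set up to allow. *)
pose rho := trunc_log (D ^ 72)%N N.
have D72 : (1 < D ^ 72)%N by rewrite -(exp1n 72) ltn_exp2r.
have hN : ((D ^ 72) ^ rho <= N)%N by rewrite trunc_logP// ltnW.
have lnle : ln N%:R <= 72 * (rho.+1)%:R * ln D%:R :> R.
  have Dp : 0 < D%:R :> R by rewrite ltr0n ltnW.
  have h : N%:R <= D%:R ^+ (72 * rho.+1) :> R.
    by rewrite -natrX ler_nat expnM ltnW// trunc_log_ltn.
  rewrite -natrM mulr_natl -lnXn// ler_ln// posrE ?ltr0n ?exprn_gt0//.
  exact: ltnW.
(* For rho = 0 one would have ln N <= 72 ln D, and then [del] is negative, the case already
   settled. *)
have rho0 : (0 < rho)%N.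
  rewrite lt0n; apply/eqP => r0; move: lnle del0; rewrite r0 /del subr_gt0 ltr_pdivrMr// mul1r.
  lra.
set x := rho%:R : R.
have x0 : 0 < x by rewrite ltr0n.
have xi : 0 < x^-1 by rewrite invr_gt0.
have del_le : del <= 1 - 15 / x.
  rewrite /del lerD2l lerN2 ler_pdivlMr// mulrAC ler_pdivrMr//.
  have : (rho.+1)%:R <= 2 * x :> R.
    by rewrite -natrM ler_nat; lia.
  move=> hx; apply: le_trans (ler_wpM2l _ lnle) _ => //.
  have := ler_wpM2r (ltW lnD) hx; lra.
have err : @trace_error R d N rho.*2 <= x^-1 := trace_error_le R d1 rho0 hN.
set e := @trace_error R d N rho.*2 in err *.
have e0 : 0 <= e.
  by rewrite divr_ge0// mulr_ge0// exprn_ge0.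
case Ie : (\int[P]_w _)%E int0 => [I| |] // I0; last by rewrite leey.
rewrite lee_fin in I0.
rewrite -lee_pdivlMr// -EFinM.
apply: ge_ereal_sup => _ [H [pi ->]].
apply: ge_ereal_sup => _ [v v1 <-]; rewrite lee_fin ler_pdivlMr//.
have p13 : 0 < 1 - 13 / x by lra.
have pe : 0 < 1 - 2 * e by lra.
have N0 : (0 < N)%N by exact: ltnW.
pose K2 := I ^+ 2 / (1 - 2 * e) ^+ 2.
have K20 : 0 <= K2 by rewrite divr_ge0// sqr_ge0.
have loc : local_conv_bound (coef_op a pi) (@gen_inv d) rho.*2 K2.
  move=> f fr; rewrite /K2 mulrAC ler_pdivlMr ?exprn_gt0// mulrC.
  have hI : (\int[P]_w min_norm (A_mx a (fun j => U j w)) <= I%:E)%E by rewrite Ie.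
  exact: (expected_norm_bound pi haarU indepU N0 fr (ltW pe) hI).
have cb : conv_bound (coef_op a pi) (@gen_inv d) (K2 / (1 - 13 / x)).
  move=> n f fn; rewrite mulrAC ler_pdivlMr// mulrC.
  exact: (local_to_global (coef_op_lin a pi) (coef_op_bnd a pi) (@len_gen_inv d) rho0 loc).
have tn := free_tensor_bound (divr_ge0 K20 (ltW p13)) cb v1.
set z := tensor_norm _ in tn *.
have z0 : 0 <= z := tensor_norm_ge0 _.
(* The bound on z^2 carries the factor 1 - 13/x only once; as it lies between 0 and 1 it may be
   squared, so that roots can be taken. *)
have key : z * ((1 - 13 / x) * (1 - 2 * e)) <= I.
  have h0 : 0 <= z * ((1 - 13 / x) * (1 - 2 * e)) by rewrite !mulr_ge0// ltW.
  suff : (z * ((1 - 13 / x) * (1 - 2 * e))) ^+ 2 <= I ^+ 2 by rewrite ler_sqr ?nnegrE.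
  rewrite ler_pdivlMr// in tn; rewrite /K2 ler_pdivlMr ?exprn_gt0// in tn.
  apply: le_trans tn; rewrite !exprMn mulrA ler_wpM2r ?sqr_ge0// ler_wpM2l ?sqr_ge0//.
  rewrite expr2 ler_piMl ?(ltW p13)//.
  by rewrite gerBl divr_ge0// ltW.
apply: le_trans key; rewrite ler_wpM2l//; apply: le_trans del_le _.
have h13 : 0 <= 13 / x * (2 * e) by rewrite !mulr_ge0// ltW.
lra.
Qed.
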